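(* Let $j\in\{1,2\}$. Assume $\Phi^{(\mathrm{mono})}_j[u_j]\in L^1(\Gamma_{\mathcal M})$, and assume one of the following: (a) (general interlayer many-body potentials) $\Psi_j^{(\mathrm{inter})}[u_1,u_2]\in L^1(\Gamma_{\mathcal M}\times\Gamma_{3-j})$, and $\Phi^{(\mathrm{inter})}_{j,\gamma}[u_1,u_2]\in L^1(\Gamma_{\mathcal M})$ for any $\gamma=(\gamma_1,\gamma_2)\in\Gamma_1\times\Gamma_2$; or (b) (interlayer pair potentials) the interlayer potential is given by pair potentials $v_\alpha$, and for some $r>1$ we have $u_k(\cdot,\alpha_k)\in L^\infty(\mathbb R^2)$ for $k=1,2$ and all $\alpha_k\in\mathcal A_k$, and $v_\alpha\in L^\infty_{2r}(\mathbb R^2\times[-L^z,L^z])$ for all $\alpha\in\mathcal A_1\times\mathcal A_2$. Then for almost all $\gamma=(\gamma_1,\gamma_2)\in\Gamma_1\times\Gamma_2$, $$\lim_{N\to\infty}e^{(\mathrm{mono})}_{j,N,\gamma_j}(u_j)=e^{(\mathrm{mono})}_j(u_j),\qquad \lim_{N\to\infty}e^{(\mathrm{inter})}_{j,N,\gamma}(u_1,u_2)=e^{(\mathrm{inter})}_{j,\gamma}(u_1,u_2).$$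
   Context: **Lattices.** Let $q>0$, $\theta\in\mathbb R$, $A\in GL_2(\mathbb R)$, and let $R_\phi$ be rotation of $\mathbb R^2$ by $\phi$. Set $A_1=q^{-1/2}R_{-\theta/2}A$, $A_2=q^{1/2}R_{\theta/2}A$, $\mathcal R_j=A_j\mathbb Z^2$, $\Gamma_j=A_j[0,1)^2$, $\mathcal R_j(N)=A_j\{-N,\dots,N\}^2$, $\mathcal R_j^*=2\pi A_j^{-T}\mathbb Z^2$. Standing assumptions: $\mathcal R_1^*\cap\mathcal R_2^*=\{0\}$ and $\mathcal R_1\cap\mathcal R_2=\{0\}$. Moiré lattice: $A_{\mathcal M}=(A_1^{-1}-A_2^{-1})^{-1}$, $\mathcal R_{\mathcal M}=A_{\mathcal M}\mathbb Z^2$, $\Gamma_{\mathcal M}=A_{\mathcal M}[0,1)^2$. Put $D_{j\to 3-j}=I-A_{3-j}A_j^{-1}$. ⨍$_\Omega=\frac1{|\Omega|}\int_\Omega$. **Displacements.** $\mathcal A_1,\mathcal A_2$ are finite sets; each $\alpha_j\in\mathcal A_j$ has a shift vector $\tau_j^{(\alpha_j)}\in\mathbb R^2$. Vectors of $\mathbb R^2$ are identified with vectors of $\mathbb R^3$ having zero third component. For $j=1,2$, $u_j\in L^1(\Gamma_{\mathcal M};(\mathbb R^3)^{\mathcal A_j})$, written $u_j(x,\alpha_j)$ and extended $\mathcal R_{\mathcal M}$-periodically to $x\in\mathbb R^2$. $Y_j(x,\alpha_j)=x+\tau_j^{(\alpha_j)}+u_j(x,\alpha_j)$; the positions $Y_j(\gamma_j+R_j,\alpha_j)$,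 $R_j\in\mathcal R_j$, are thus well defined up to a null set of shifts $\gamma_j\in\Gamma_j$. **Monolayer energy.** Given $V^{(\mathrm{mono})}_{j,\alpha_j}:(\mathbb R^3)^{\mathcal R_j\times\mathcal A_j}\to\mathbb R$, $$\Phi_j^{(\mathrm{mono})}[u_j](x)=\frac1{|\Gamma_j|}\sum_{\alpha_j\in\mathcal A_j}V^{(\mathrm{mono})}_{j,\alpha_j}\Big(\big(u_j(x+R_j',\alpha_j')-u_j(x,\alpha_j)\big)_{(R_j',\alpha_j')\in\mathcal R_j\times\mathcal A_j}\Big),$$ $e^{(\mathrm{mono})}_{j,N,\gamma_j}(u_j)=\frac1{(2N+1)^2}\sum_{R_j\in\mathcal R_j(N)}\Phi^{(\mathrm{mono})}_j[u_j](R_j+\gamma_j)$ and $e^{(\mathrm{mono})}_j(u_j)=$ ⨍$_{\Gamma_{\mathcal M}}\Phi_j^{(\mathrm{mono})}[u_j](x)\,dx$. **Interlayer energy.** $V^{(\mathrm{inter})}_{j,\alpha_j}:(\mathbb R^3)^{\mathcal R_{3-j}\times\mathcal A_{3-j}}\to\mathbb R$ is even ($V(a)=V(-a)$) and translation-invariant (unchanged when the family $(a_{R,\beta})$ is replaced by $(a_{R+R',\beta})$, for any $R'\in\mathcal R_{3-j}$). Then $$e^{(\mathrm{inter})}_{j,N,\gamma}(u_1,u_2)=\frac1{|\Gamma_j|(2N+1)^2}\sum_{R_j\in\mathcal R_j(N)}\sum_{\alpha_j\in\mathcal A_j}V^{(\mathrm{inter})}_{j,\alpha_j}\Big(\big(Y_j(R_j+\gamma_j,\alpha_j)-Y_{3-j}(R_{3-j}+\gamma_{3-j},\alpha_{3-j})\big)_{(R_{3-j},\alpha_{3-j})\in\mathcal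 R_{3-j}\times\mathcal A_{3-j}}\Big),$$ $$\Psi^{(\mathrm{inter})}_j[u_1,u_2](x,y)=\frac1{|\Gamma_j|}\sum_{\alpha_j\in\mathcal A_j}V^{(\mathrm{inter})}_{j,\alpha_j}\Big(\big(y-R_{3-j}+\tau_j^{(\alpha_j)}-\tau_{3-j}^{(\alpha_{3-j})}+u_j(x,\alpha_j)-u_{3-j}(x-y+R_{3-j},\alpha_{3-j})\big)_{(R_{3-j},\alpha_{3-j})}\Big),$$ $$\Phi^{(\mathrm{inter})}_{j,\gamma}[u_1,u_2](x)=\Psi^{(\mathrm{inter})}_j[u_1,u_2]\big(x,D_{j\to3-j}x+A_{3-j}A_j^{-1}\gamma_j-\gamma_{3-j}\big),$$ and $e^{(\mathrm{inter})}_{j,\gamma}(u_1,u_2)=$ ⨍$_{\Gamma_{\mathcal M}}\Phi^{(\mathrm{inter})}_{j,\gamma}[u_1,u_2](x)\,dx$. **Pair potentials.** For even functions $v_\alpha:\mathbb R^3\to\mathbb R$, $\alpha=(\alpha_1,\alpha_2)\in\mathcal A_1\times\mathcal A_2$, the interlayer pair potential case is $V^{(\mathrm{inter})}_{j,\alpha_j}\big((a_{R_{3-j},\alpha_{3-j}})\big)=\frac12\sum_{R_{3-j}\in\mathcal R_{3-j}}\sum_{\alpha_{3-j}\in\mathcal A_{3-j}}v_{\alpha}(a_{R_{3-j},\alpha_{3-j}})$. **Norms.** $\langle x\rangle=(1+|x|^2)^{1/2}$. $L^z=\max_{\alpha_1,\alpha_2}|\tau_1^{(\alpha_1)}-\tau_2^{(\alpha_2)}|+\|u_{1,z}\|_\infty+\|u_{2,z}\|_\infty$,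 where $u_{j,z}$ is the third component of $u_j$. $L^\infty_{2r}(\Omega)=\{f\in L^\infty(\Omega):\|\langle\cdot\rangle^{2r}f\|_{L^\infty(\Omega)}<\infty\}$.
   Formalization: In (b), v_α in L^∞_{2r} is read pointwise: v_α is Borel measurable on the slab and ⟨x⟩^{2r}|v_α| is bounded everywhere there, not just almost everywhere; for u = 0, v_α is only evaluated on the null plane z = 0, so an a.e. bound does not suffice. *)

(* Defs.v *)
From HB Require Import structures.
From mathcomp Require Import all_boot all_order all_algebra.
From mathcomp Require Import all_classical all_reals all_analysis.
Set Implicit Arguments.
Unset Strict Implicit.
Unset Printing Implicit Defensive.
Import Order.TTheory GRing.Theory Num.Theory numFieldNormedType.Exports.
Local Open Scope classical_set_scope.
Local Open Scope ring_scope.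

(* [measurableTypeR R] is [R] with its Borel sigma-algebra. The norm that the
   library puts on products is the sup norm, so Euclidean norms are defined
   separately below. *)
Notation vec2 R := (measurableTypeR R * measurableTypeR R)%type.
Notation vec3 R :=
  (measurableTypeR R * measurableTypeR R * measurableTypeR R)%type.

Section Geometry.
Context {R : realType}.
Implicit Types (M : 'M[R]_2) (x : vec2 R).

Definition leb2 : set (vec2 R) -> \bar R :=
  (@lebesgue_measure R \x @lebesgue_measure R)%E.

HB.instance Definition _ := Measure.on leb2.

Let leb2_sigma_finite : sigma_finite setT leb2.
Proof.
have /sigma_finiteP[F [TF ndF Foo]] := sigma_finiteT (@lebesgue_measure R).
exists (fun n => F n `*` F n).
  rewrite -setXTT TF predeqE => -[x y]; split.
    move=> [/= [n _ Fnx] [k _ Fky]]; exists (maxn n k) => //; split.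
    - by move: x Fnx; exact/subsetPset/ndF/leq_maxl.
    - by move: y Fky; exact/subsetPset/ndF/leq_maxr.
  by move=> [n _ []/= ? ?]; split; exists n.
move=> k; have [? ?] := Foo k; split; first exact: measurableX.
by rewrite /leb2 product_measure1E// lte_mul_pinfty// ge0_fin_numE.
Qed.

HB.instance Definition _ := Measure_isSigmaFinite.Build _ _ _ leb2
  leb2_sigma_finite.

Definition leb4 : set (vec2 R * vec2 R) -> \bar R := (leb2 \x leb2)%E.

HB.instance Definition _ := Measure.on leb4.

Definition emb x : vec3 R := (x, 0).

Definition enorm2 x : R := Num.sqrt (x.1 ^+ 2 + x.2 ^+ 2).

Definition enorm3 (x : vec3 R) : R :=
  Num.sqrt (x.1.1 ^+ 2 + x.1.2 ^+ 2 + x.2 ^+ 2).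

Definition japanese (x : vec3 R) : R := Num.sqrt (1 + enorm3 x ^+ 2).

Definition act M x : vec2 R :=
  let y := M *m \col_i (if i == ord0 then x.1 else x.2) in
  (y ord0 ord0, y ord_max ord0).

Definition rotation (phi : R) : 'M[R]_2 :=
  \matrix_(i, k) if i == k then cos phi
                 else if i == ord0 then - sin phi else sin phi.

Definition intpoint (n : int * int) : vec2 R := (n.1%:~R, n.2%:~R).

Definition lattice M : set (vec2 R) := [set act M (intpoint n) | n in setT].

Definition lattice_box M (N : nat) : set (vec2 R) :=
  [set act M (intpoint n) | n in
    [set n : int * int | (`|n.1| <= N%:Z)%R /\ (`|n.2| <= N%:Z)%R]].

Definition dual_lattice M : set (vec2 R) :=
  lattice ((2 * pi) *: (invmx M)^T).

Definition cell M : set (vec2 R) := act M @` (`[0, 1[ `*` `[0, 1[).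

Definition area (D : set (vec2 R)) : R := fine (leb2 D).

Definition avg (D : set (vec2 R)) (f : vec2 R -> R) : R :=
  (area D)^-1 * \int[leb2]_(x in D) f x.

Definition lattice_periodic (T : Type) M (f : vec2 R -> T) : Prop :=
  forall r x, lattice M r -> f (x + r) = f x.

Lemma lattice_add_subproof M (x y : lattice M) : val x + val y \in lattice M.
Proof.
case: x y => [x xM] [y yM] /=; move: xM yM.
rewrite !inE => -[m _ <-] [n _ <-]; exists (m.1 + n.1, m.2 + n.2) => //.
have E (a b c d : vec2 R) : a.1 + b.1 = c.1 + d.1 -> a.2 + b.2 = c.2 + d.2 ->
    a + b = c + d.
  by case: a b c d => [? ?] [? ?] [? ?] [? ?] /= e1 e2; congr pair.
rewrite /act /intpoint /= !mxE !big_ord_recl !big_ord0 !mxE /= !intrD.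
congr pair; rewrite !addr0 !mulrDr; exact: addrACA.
Qed.

Definition lattice_add M (x y : lattice M) : lattice M :=
  exist _ (val x + val y) (lattice_add_subproof x y).

Definition config M (S : Type) := lattice M -> S -> vec3 R.

Definition even_potential M (S : Type) (V : config M S -> R) : Prop :=
  forall a, V (fun r b => - a r b) = V a.

Definition translation_invariant M (S : Type) (V : config M S -> R) : Prop :=
  forall a r', V (fun r b => a (lattice_add r r') b) = V a.

(* The library's [esum] is meant for nonnegative families. *)
Definition abs_sum (I : choiceType) (f : I -> R) : R :=
  fine (\esum_(i in [set: I]) (Num.max (f i) 0)%:E) -
  fine (\esum_(i in [set: I]) (Num.max (- f i) 0)%:E).

(* A real-valued functional can agree with the pair sum only on the
   configurations for which the sum makes sense, i.e. converges absolutely. *)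
Definition is_pair_sum M (S : finType) (w : S -> vec3 R -> R)
    (V : config M S -> R) : Prop :=
  forall a,
    summable [set: lattice M * S] (fun p => (w p.2 (a p.1 p.2))%:E) ->
    V a = 2^-1 * abs_sum (fun p : lattice M * S => w p.2 (a p.1 p.2)).

End Geometry.

Section FunctionSpaces.
Context {R : realType}.

(* The library's measurable functions are Borel. Lebesgue measurable functions
   are those that agree almost everywhere with a Borel function. *)
Definition lebesgue_measurable_on d (T : measurableType d) d'
    (U : measurableType d') (mu : {measure set T -> \bar R}) (D : set T)
    (f : T -> U) : Prop :=
  exists2 g : T -> U, measurable_fun D g & f = g %[ae mu in D].

Definition L1 d (T : measurableType d) (mu : {measure set T -> \bar R})
    (D : set T) (f : T -> R) : Prop :=
  exists2 g : T -> R, mu.-integrable D (EFin \o g) & f = g %[ae mu in D].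

Definition L1_space d (T : measurableType d) (mu : {measure set T -> \bar R})
    (D : set T) (f : T -> vec3 R) : Prop :=
  [/\ L1 mu D (fun x => (f x).1.1), L1 mu D (fun x => (f x).1.2)
    & L1 mu D (fun x => (f x).2)].

Definition Linfty_vec (f : vec2 R -> vec3 R) : Prop :=
  lebesgue_measurable_on leb2 setT f /\
  ('N[leb2]_+oo[(fun x => (enorm3 (f x))%:E)] < +oo)%E.

(* A pair potential is evaluated along Lebesgue null subsets of R^3
   (a plane, when the displacements vanish; [D] itself is null when L^z = 0), so
   that a class of functions modulo null sets cannot be meant here: measurability
   is Borel measurability, and the norms are suprema over all of [D]. *)
Definition Linfty_ptwise (D : set (vec3 R)) (f : vec3 R -> R) : Prop :=
  measurable_fun D f /\ exists C : R, forall x, D x -> `|f x| <= C.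

Definition Linfty_weighted (s : R) (D : set (vec3 R)) (f : vec3 R -> R)
    : Prop :=
  Linfty_ptwise D f /\
  exists C : R, forall x, D x -> `|japanese x `^ s * f x| <= C.

End FunctionSpaces.

Inductive layer := layer1 | layer2.

Definition other (j : layer) : layer :=
  match j with layer1 => layer2 | layer2 => layer1 end.

Definition shift_of (T : Type) (g : T * T) (j : layer) : T :=
  match j with layer1 => g.1 | layer2 => g.2 end.

Section Lattices.
Context {R : realType} (q theta : R) (A : 'M[R]_2).

Definition Amx (j : layer) : 'M[R]_2 :=
  match j with
  | layer1 => (q `^ (- 2^-1)) *: (rotation (- (theta / 2)) *m A)
  | layer2 => (q `^ 2^-1) *: (rotation (theta / 2) *m A)
  end.

Definition moire : 'M[R]_2 := invmx (invmx (Amx layer1) - invmx (Amx layer2)).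

Definition disregistry (j : layer) : 'M[R]_2 :=
  1%:M - Amx (other j) *m invmx (Amx j).

End Lattices.

Section Energies.
Context {R : realType} (q theta : R) (A : 'M[R]_2) (S : layer -> finType).
Local Notation B := (Amx q theta A).
Local Notation BM := (moire q theta A).

Definition positions (tau : forall j, S j -> vec2 R)
    (u : forall j, vec2 R -> S j -> vec3 R) j (x : vec2 R) (a : S j)
    : vec3 R :=
  emb (x + tau j a) + u j x a.

Definition Phi_mono (Vmono : forall j, S j -> config (B j) (S j) -> R)
    (u : forall j, vec2 R -> S j -> vec3 R) j (x : vec2 R) : R :=
  (area (cell (B j)))^-1 *
  \sum_(a : S j) Vmono j a (fun r b => u j (x + val r) b - u j x a).

Definition e_mono_N (Vmono : forall j, S j -> config (B j) (S j) -> R)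
    (u : forall j, vec2 R -> S j -> vec3 R) j (N : nat) (gj : vec2 R) : R :=
  ((2 * N + 1) ^ 2)%N%:R^-1 *
  \sum_(r \in lattice_box (B j) N) Phi_mono Vmono u j (r + gj).

Definition e_mono (Vmono : forall j, S j -> config (B j) (S j) -> R)
    (u : forall j, vec2 R -> S j -> vec3 R) j : R :=
  avg (cell BM) (Phi_mono Vmono u j).

Variable Vinter :
  forall j, S j -> config (B (other j)) (S (other j)) -> R.
Variable tau : forall j, S j -> vec2 R.
Variable u : forall j, vec2 R -> S j -> vec3 R.
Local Notation Y := (positions tau u).

Definition e_inter_N j (N : nat) (g : vec2 R * vec2 R) : R :=
  (area (cell (B j)) * ((2 * N + 1) ^ 2)%N%:R)^-1 *
  \sum_(r \in lattice_box (B j) N) \sum_(a : S j)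
    Vinter a (fun r' b =>
      Y (r + shift_of g j) a - Y (val r' + shift_of g (other j)) b).

Definition Psi_inter j (x y : vec2 R) : R :=
  (area (cell (B j)))^-1 *
  \sum_(a : S j)
    Vinter a (fun r' b =>
      emb (y - val r' + tau a - tau b) + u x a - u (x - y + val r') b).

Definition Phi_inter j (g : vec2 R * vec2 R) (x : vec2 R) : R :=
  Psi_inter j x
    (act (disregistry q theta A j) x +
     act (B (other j) *m invmx (B j)) (shift_of g j) - shift_of g (other j)).

Definition e_inter j (g : vec2 R * vec2 R) : R :=
  avg (cell BM) (Phi_inter j g).

Definition pair_potential (v : S layer1 -> S layer2 -> vec3 R -> R)
    (j : layer) : S j -> S (other j) -> vec3 R -> R :=
  match j with
  | layer1 => fun a b => v a b
  | layer2 => fun a b => v b a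
  end.

(* [u] takes values in families indexed by a finite set; the sup norm over the
   index is used. *)
Definition uz_norm (j : layer) : R :=
  \big[Num.max/0]_(a : S j)
    fine ('N[leb2]_+oo[(fun x => ((u x a).2)%:E)])%E.

Definition Lz : R :=
  \big[Num.max/0]_(a : S layer1) \big[Num.max/0]_(b : S layer2)
    enorm2 (tau a - tau b)
  + uz_norm layer1 + uz_norm layer2.

End Energies.

(* Main.v *)
Require Import Defs.
From mathcomp Require Import all_boot all_order all_algebra.
From mathcomp Require Import all_classical all_reals all_analysis.
From mathcomp Require Import measurable_realfun ess_sup_inf zify ring lra.
Import Order.TTheory GRing.Theory Num.Theory numFieldNormedType.Exports.
Local Open Scope classical_set_scope.
Local Open Scope ring_scope.
Set Implicit Arguments.
Unset Strict Implicit.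
Unset Printing Implicit Defensive.

(* For a fixed shift, both energies are averages of a periodic function over the
   box [-N, N]^2 of a lattice acting by translations on the torus R^2 / R_M: the
   function is [Phi_mono] for the monolayer energy and, for the interlayer one,
   [x |-> Psi_inter x (D x + c)], where [c] only depends on the shift. The
   incommensurability of the dual lattices makes this action ergodic, and the
   limits follow from the pointwise ergodic theorem for Z^2 actions.

   The ergodic theorem holds for trigonometric polynomials by summing geometric
   progressions. By the Vitali covering argument the averages satisfy a weak
   (1,1) maximal inequality, so the functions that obey the theorem are closed
   in L^1, and trigonometric polynomials are dense there.

   The limit in the interlayer case depends on [c]: the action on the
   four-dimensional torus of [Psi_inter] is not ergodic, its ergodic components
   being the fibres [c = const]. The theorem is applied in almost every fibre
   and the exceptional sets are collected by Fubini's theorem.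

   For pair potentials with decay [2 r > 2] the lattice sum converges uniformly,
   so that [Psi_inter] is essentially bounded, in particular integrable. *)

(** * Boxes in the integer lattice *)

(** In the coordinate [t = A_M^-1 x] a vector [A_j n] of layer [j] acts by [t + L n] with
    [L = A_M^-1 A_j], so the character of frequency [k] is invariant exactly when [L^T k] is
    integral. Since [A_M^-1 = A_1^-1 - A_2^-1], such a [k] produces a vector common to both dual
    lattices, and ergodicity becomes a statement about phases alone. The maximal inequality is first
    proved on the orbit, a copy of Z^2, where covering is counting. Integration over the torus then
    transfers it, and the loss at the boundary of the window vanishes as the window grows. The
    delicate point is null sets. The given functions are only almost everywhere equal to Borel
    functions, whereas averages sample them on a countable orbit, and a single fibre is null in the
    four-dimensional torus. Hence each change of version is pulled back along explicit maps that
    scale the measure, for all lattice points at once, and the set of convergence of a Borel version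
    is shown to be measurable before Fubini's theorem is applied. *)

Definition in_box (p : int * int) (k : nat) (m : int * int) : bool :=
  (`|m.1 - p.1| <= k%:Z) && (`|m.2 - p.2| <= k%:Z).

(** The product form lets a sum over the box be written as two iterated sums over consecutive
    integers, as the progression argument in [trig_cos_avg0] requires. *)
Definition boxseq (k : nat) : seq (int * int) :=
  [seq ((i%:Z - k%:Z), (j%:Z - k%:Z)) | i <- iota 0 (2 * k + 1),
                                        j <- iota 0 (2 * k + 1)].

Lemma size_boxseq k : size (boxseq k) = ((2 * k + 1) ^ 2)%N.
Proof. by rewrite size_allpairs size_iota mulnn. Qed.

Lemma mem_boxseq k m : (m \in boxseq k) = in_box (0, 0) k m.
Proof.
rewrite /in_box !subr0; apply/allpairsP/andP => [[[i j] /= []]|[h1 h2]].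
  by rewrite !mem_iota => hi hj -> /=; lia.
exists (absz (m.1 + k%:Z), absz (m.2 + k%:Z)); rewrite /= !mem_iota; split.
- lia.
- lia.
- by case: m h1 h2 => a b /= h1 h2; congr pair; lia.
Qed.

Lemma boxseq_uniq k : uniq (boxseq k).
Proof.
apply: allpairs_uniq; [exact: iota_uniq|exact: iota_uniq|].
by move=> [a b] [c d] _ _ /= [] e1 e2; congr pair; lia.
Qed.

Lemma size_in_box (p : int * int) k (s : seq (int * int)) :
  uniq s -> all (in_box p k) s -> (size s <= (2 * k + 1) ^ 2)%N.
Proof.
move=> us /allP sp; rewrite -(size_boxseq k).
rewrite -(size_map (fun m : int * int => (m.1 + p.1, m.2 + p.2)) (boxseq k)).
apply: uniq_leq_size => // m /sp mp; apply/mapP.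
exists (m.1 - p.1, m.2 - p.2); first by rewrite mem_boxseq /in_box /= !subr0.
by case: m {mp} => a b /=; rewrite !subrK.
Qed.

(** Boxes about different centres become filters of one fixed list, so that the covering argument
    can compare them inside a common window. *)
Lemma boxseq_shift (p : int * int) (k K : nat) (V : nmodType) (F : int * int -> V) :
  (forall m, in_box p k m -> in_box (0, 0) K m) ->
  \sum_(m <- boxseq k) F (m.1 + p.1, m.2 + p.2) =
  \sum_(m <- boxseq K | in_box p k m) F m.
Proof.
move=> sub; rewrite -[RHS]big_filter.
rewrite -(big_map (fun m : int * int => (m.1 + p.1, m.2 + p.2)) xpredT F).
apply: perm_big; apply: uniq_perm.
- rewrite map_inj_uniq ?boxseq_uniq// => -[a b] [c d] /= [] e1 e2.
  by congr pair; lia.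
- exact/filter_uniq/boxseq_uniq.
- move=> m; rewrite mem_filter mem_boxseq; apply/mapP/andP.
    move=> [n nk ->]; suff h : in_box p k (n.1 + p.1, n.2 + p.2).
      by split=> //; exact: sub.
    by move: nk; rewrite mem_boxseq /in_box /= !subr0 !addrK.
  move=> [mp _]; exists (m.1 - p.1, m.2 - p.2).
    by rewrite mem_boxseq /in_box /= !subr0.
  by case: m {mp} => a b /=; rewrite !subrK.
Qed.

(* Greedy Vitali covering: the centres whose box meets a box of maximal radius
   lie in the box of twice that radius, which is at most four times as large. *)
Lemma box_covering (R : realFieldType) (lam : R) (f : int * int -> R)
    (rho : int * int -> nat) (s W : seq (int * int)) :
  0 <= lam -> (forall m, 0 <= f m) -> uniq s ->
  (forall p, p \in s ->
    lam * ((2 * rho p + 1) ^ 2)%:R <= \sum_(m <- W | in_box p (rho p) m) f m) ->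
  lam * (size s)%:R <= 4 * \sum_(m <- W) f m.
Proof.
move=> lam0 f0; have [n] := ubnP (size s).
elim: n s W => // n IH [|p0 s0] W sn us sW.
  by rewrite mulr0 mulr_ge0// sumr_ge0.
set s := p0 :: s0 in sn us sW *.
have [p ps pmax] : exists2 p, p \in s & forall q, q \in s -> (rho q <= rho p)%N.
  have : {p | p \in s & forall q, q \in s -> (rho q <= rho p)%N}.
    rewrite /s; elim: (s0) (p0) => [|a t IHt] b.
      by exists b; [rewrite mem_head|move=> q; rewrite inE => /eqP ->].
    have [c ct cmax] := IHt a.
    case: (leqP (rho b) (rho c)) => bc.
      exists c; first by rewrite inE ct orbT.
      by move=> q; rewrite inE => /orP[/eqP -> //|]; exact: cmax.
    exists b; first by rewrite mem_head.
    move=> q; rewrite inE => /orP[/eqP -> //|/cmax qc].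
    exact: leq_trans qc (ltnW bc).
  by case=> p; exists p.
pose near q := in_box p (rho p + rho q) q.
pose s' := [seq q <- s | ~~ near q].
(* The box of [p] also leaves the window, so that its mass is charged only once. The hypothesis
   survives for [s'] because the boxes of the remaining centres do not meet the box of [p]. *)
pose W' := [seq m <- W | ~~ in_box p (rho p) m].
have szs : size s = (count near s + size s')%N.
  by rewrite /s' size_filter count_predC.
have cnt : (count near s <= 4 * (2 * rho p + 1) ^ 2)%N.
  rewrite -size_filter; apply: (@leq_trans ((2 * (2 * rho p) + 1) ^ 2)%N).
    apply: (@size_in_box p); first exact: filter_uniq.
    apply/allP => q; rewrite mem_filter => /andP[+ /pmax].
    by rewrite /near /in_box => + ?; lia.
  by rewrite -!mulnn; nia.
have cnt0 : (0 < count near s)%N.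
  rewrite -has_count; apply/hasP; exists p => //.
  by rewrite /near /in_box; lia.
have IHs' : lam * (size s')%:R <= 4 * \sum_(m <- W') f m.
  apply: IH; [lia|exact: filter_uniq|].
  move=> q; rewrite mem_filter => /andP[nq qs].
  apply: le_trans (sW q qs) _; rewrite big_filter_cond le_eqVlt; apply/orP; left.
  apply/eqP; apply: eq_bigl => m.
  case qm : (in_box q (rho q) m); rewrite ?andbF// andbT.
  symmetry; apply: contra nq; move: qm; rewrite /near /in_box; lia.
rewrite szs natrD mulrDr (bigID (in_box p (rho p))) /= mulrDr.
apply: lerD; last by rewrite -big_filter.
apply: le_trans (_ : lam * (4 * (2 * rho p + 1) ^ 2)%:R <= _).
  by rewrite ler_wpM2l// ler_nat.
by rewrite natrM mulrCA ler_pM2l ?sW// ltr0n.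
Qed.

(** * Maps that multiply a measure by a constant *)

Section Scales.
Context {R : realType}.

(** A change of variables with constant Jacobian, recorded only through its effect on the measure.
    For most uses it is enough that some [c] exists: null sets pull back to null sets, and
    normalised averages cancel the constant. *)
Definition scales d1 d2 (T1 : measurableType d1) (T2 : measurableType d2)
    (m1 : set T1 -> \bar R) (m2 : set T2 -> \bar R)
    (c : R) (phi : T1 -> T2) : Prop :=
  [/\ measurable_fun setT phi, 0 < c
    & forall X, measurable X -> m1 (phi @^-1` X) = (c%:E * m2 X)%E].

Lemma scales_comp d1 d2 d3 (T1 : measurableType d1) (T2 : measurableType d2)
    (T3 : measurableType d3) (m1 : {measure set T1 -> \bar R})
    (m2 : {measure set T2 -> \bar R}) (m3 : {measure set T3 -> \bar R})
    c e (phi : T1 -> T2) (psi : T2 -> T3) :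
  scales m1 m2 c phi -> scales m2 m3 e psi ->
  scales m1 m3 (c * e) (psi \o phi).
Proof.
move=> [mphi c0 sphi] [mpsi e0 spsi]; split.
- exact: measurableT_comp.
- exact: mulr_gt0.
- move=> X mX; rewrite comp_preimage sphi; last first.
    by rewrite -[_ @^-1` _]setTI; exact: mpsi.
  by rewrite spsi// muleA EFinM.
Qed.

Section OneMap.
Context d1 d2 (T1 : measurableType d1) (T2 : measurableType d2)
  (m1 : {measure set T1 -> \bar R}) (m2 : {measure set T2 -> \bar R})
  (c : R) (phi : T1 -> T2) (sphi : scales m1 m2 c phi).

Lemma scales_negligible X : m2.-negligible X -> m1.-negligible (phi @^-1` X).
Proof.
case: sphi => mphi c0 sX [Y [mY Y0 XY]]; exists (phi @^-1` Y); split.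
- by rewrite -[_ @^-1` _]setTI; exact: mphi.
- by rewrite sX// Y0 mule0.
- exact: preimage_subset.
Qed.

Lemma scales_ae (P : T2 -> Prop) :
  {ae m2, forall y, P y} -> {ae m1, forall x, P (phi x)}.
Proof. exact: scales_negligible. Qed.

Lemma scales_ge0_integral (D : set T2) (f : T2 -> \bar R) :
  measurable D -> measurable_fun D f -> (forall x, D x -> 0 <= f x)%E ->
  (\int[m1]_(x in phi @^-1` D) f (phi x) = c%:E * \int[m2]_(y in D) f y)%E.
Proof.
case: sphi => mphi c0 sX mD mf f0.
rewrite -(ge0_integral_pushforward mphi)//; last first.
  by move=> y /[!inE]; exact: f0.
have c0' := ltW c0.
rewrite -(ge0_integral_mscale _ mD (NngNum c0') mf f0).
apply: eq_measure_integral => A mA _.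
by rewrite /= /mscale /= /pushforward sX.
Qed.

Lemma scales_integrable (D : set T2) (f : T2 -> \bar R) :
  measurable D -> m2.-integrable D f ->
  m1.-integrable (phi @^-1` D) (f \o phi).
Proof.
move=> mD /integrableP[mf intf]; case: (sphi) => mphi c0 sX.
have mD' : measurable (phi @^-1` D).
  by rewrite -[_ @^-1` _]setTI; exact: mphi.
apply/integrableP; split.
  apply: (measurable_comp mD) => //; first by move=> _ [x Dx <-].
  exact: measurable_funTS.
rewrite (scales_ge0_integral (f := fun y => `|f y|%E))//.
  by apply: lte_mul_pinfty => //; rewrite ?lee_fin ?ltW.
exact: measurableT_comp.
Qed.

Lemma scales_integral (D : set T2) (f : T2 -> \bar R) :
  measurable D -> m2.-integrable D f ->
  (\int[m1]_(x in phi @^-1` D) f (phi x) = c%:E * \int[m2]_(y in D) f y)%E.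
Proof.
move=> mD intf; have mf := measurable_int _ intf.
rewrite integralE.
under eq_integral do rewrite (funepos_comp f phi).
under [X in (_ - X)%E]eq_integral do rewrite (funeneg_comp f phi).
rewrite (@scales_ge0_integral _ (f^\+)%E)//; last exact: measurable_funepos.
rewrite (@scales_ge0_integral _ (f^\-)%E)//; last exact: measurable_funeneg.
rewrite [X in _ = (_ * X)%E]integralE [RHS]muleBr//.
by apply: fin_num_adde_defr; exact: integrable_pos_fin_num.
Qed.

End OneMap.

End Scales.

Section ScalesProduct.
Context {R : realType} d1 d2 (T1 : measurableType d1) (T2 : measurableType d2)
  (m1 : {sigma_finite_measure set T1 -> \bar R})
  (m2 : {sigma_finite_measure set T2 -> \bar R}).

(** The pushforward divided by [c * e] agrees with the product measure on rectangles, and a product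
    measure is determined by its values there. *)
Lemma scales_prod c e (phi : T1 -> T1) (psi : T2 -> T2) :
  scales m1 m1 c phi -> scales m2 m2 e psi ->
  scales (m1 \x m2)%E (m1 \x m2)%E (c * e) (fun z => (phi z.1, psi z.2)).
Proof.
move=> [mphi c0 sphi] [mpsi e0 spsi].
have mpp : measurable_fun setT (fun z : T1 * T2 => (phi z.1, psi z.2)).
  apply: measurable_fun_pair; apply: measurableT_comp => //.
split=> //; first exact: mulr_gt0.
have ce0 : 0 <= (c * e)^-1 by rewrite invr_ge0 mulr_ge0 ?ltW.
pose pm : {measure set (T1 * T2) -> \bar R} :=
  measure_function_pushforward__canonical__measure_function_Measure (m1 \x m2)%E mpp.
pose m' : {measure set (T1 * T2) -> \bar R} := mscale (NngNum ce0) pm.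
move=> X mX.
rewrite [in RHS](@product_measure_unique _ _ _ _ _ m1 m2 m')//; last first.
  move=> A B mA mB; rewrite /m' /= /mscale /= /pushforward.
  rewrite (_ : _ @^-1` _ = (phi @^-1` A) `*` (psi @^-1` B))//.
  have mA' : measurable (phi @^-1` A).
    by rewrite -[_ @^-1` _]setTI; exact: mphi.
  have mB' : measurable (psi @^-1` B).
    by rewrite -[_ @^-1` _]setTI; exact: mpsi.
  rewrite product_measure1E//.
  rewrite [X in (_ * (X * _))%E](sphi A mA) [X in (_ * (_ * X))%E](spsi B mB).
  rewrite [X in (_ * X)%E](_ : _ = (c * e)%:E * (m1 A * m2 B))%E; last first.
    by rewrite EFinM muleACA.
  rewrite muleA -EFinM mulVf ?mul1e//.
  by rewrite mulf_neq0 ?gt_eqF.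
rewrite /m' /= /mscale /= /pushforward muleA -EFinM mulfV ?mul1e//.
by rewrite mulf_neq0 ?gt_eqF.
Qed.

(** Tonelli computes the measure from the sections at fixed [z.1], and on each of them the map is
    [phi (x, _)]. This covers the shears of the plane as well as those of the product of two
    planes. *)
Lemma scales_skew c (phi : T1 * T2 -> T2) :
  0 < c -> measurable_fun setT phi ->
  (forall x, scales m2 m2 c (fun y => phi (x, y))) ->
  scales (m1 \x m2)%E (m1 \x m2)%E c (fun z => (z.1, phi z)).
Proof.
move=> c0 mphi sphi.
have mpp : measurable_fun setT (fun z : T1 * T2 => (z.1, phi z)).
  exact: measurable_fun_pair.
split=> // X mX; rewrite /product_measure1.
rewrite -ge0_integralZl//; last 2 first.
  exact: measurable_fun_xsection.
  by rewrite lee_fin ltW.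
apply: eq_integral => x _ /=.
have [_ _ sx] := sphi x.
rewrite -sx; last exact: measurable_xsection.
by congr (m2 _); apply/seteqP; split=> y; rewrite /= /xsection /= !inE.
Qed.

Lemma ae_xsection (P : T1 * T2 -> Prop) :
  {ae (m1 \x m2)%E, forall z, P z} ->
  {ae m1, forall x, {ae m2, forall y, P (x, y)}}.
Proof.
move=> [N [mN N0 PN]].
have mx : measurable_fun setT (m2 \o xsection N) by exact: measurable_fun_xsection.
have int0 : (\int[m1]_x `|(m2 \o xsection N) x| = 0)%E.
  by under eq_integral do rewrite gee0_abs//.
have := ae_eq_integral_abs m1 measurableT mx; move=> [+ _] => /(_ int0).
apply: filterS => x /(_ I) /= Nx0.
exists (xsection N x); split=> //; first exact: measurable_xsection.
by move=> y /= nP; rewrite /xsection /= inE; apply: PN.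
Qed.

(** Tonelli applied to the complement, which must therefore be measurable as a subset of the
    product. For this reason [measurable_cvgn] is proved further on. *)
Lemma ae_of_xsection (P : T1 * T2 -> Prop) :
  measurable [set z | P z] ->
  {ae m1, forall x, {ae m2, forall y, P (x, y)}} ->
  {ae (m1 \x m2)%E, forall z, P z}.
Proof.
move=> mP aeP; exists (~` [set z | P z]); split=> //; first exact: measurableC.
rewrite /product_measure1.
have mx : measurable_fun setT (m2 \o xsection (~` [set z | P z])).
  by apply: measurable_fun_xsection; exact: measurableC.
have <- : (\int[m1]_x `|(m2 \o xsection (~` [set z | P z])) x| = 0)%E.
  apply/(ae_eq_integral_abs m1 measurableT mx).
  apply: filterS aeP => x [M [mM M0 PM]] _ /=.
  apply: subset_measure0 (M0) => //.
    by apply: measurable_xsection; exact: measurableC.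
  by move=> y; rewrite /xsection /= inE => /= nP; exact: PM.
by apply: eq_integral => x _; rewrite gee0_abs.
Qed.

Lemma ae_fst (P : T1 -> Prop) :
  {ae m1, forall x, P x} -> {ae (m1 \x m2)%E, forall z, P z.1}.
Proof.
move=> [N [mN N0 PN]]; exists (N `*` setT); split.
- exact: measurableX.
- by rewrite product_measure1E// [X in (X * _)%E]N0 mul0e.
- by move=> [x y] /= /PN.
Qed.

End ScalesProduct.

Lemma scales_swap {R : realType} d (T : measurableType d)
    (m : {sigma_finite_measure set T -> \bar R}) :
  scales (m \x m)%E (m \x m)%E 1 (fun z => (z.2, z.1)).
Proof.
have mpp : measurable_fun setT (fun z : T * T => (z.2, z.1)).
  exact: measurable_fun_pair.
pose pm : {measure set (T * T) -> \bar R} :=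
  measure_function_pushforward__canonical__measure_function_Measure (m \x m)%E mpp.
split=> // X mX; rewrite mul1e.
rewrite [in RHS](@product_measure_unique _ _ _ _ _ m m pm)//.
move=> A B mA mB; rewrite /pm /= /pushforward.
rewrite (_ : _ @^-1` _ = B `*` A); first by rewrite product_measure1E// muleC.
by apply/seteqP; split=> -[x y] /= [].
Qed.

(** * Affine maps of the plane and Lebesgue measure *)

Section Lebesgue.
Context {R : realType}.
Local Notation leb1 := (@lebesgue_measure R).

Lemma scales_shift1 (s : R) : scales leb1 leb1 1 (fun x => x + s).
Proof.
have mphi : measurable_fun setT (fun x : measurableTypeR R => x + s : measurableTypeR R).
  by apply: measurable_funD.
split=> // X mX; rewrite mul1e.
pose pm : {measure set (measurableTypeR R) -> \bar R} :=
  measure_function_pushforward__canonical__measure_function_Measure leb1 mphi.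
rewrite [in RHS](@lebesgue_measure_unique _ pm)// => _ [[a b] _ <-].
rewrite /pm /= /pushforward.
rewrite (_ : _ @^-1` _ = [set` `]a - s, b - s]]); last first.
  by apply/seteqP; split=> x /=; rewrite !in_itv /= ltrBlDr lerBrDr.
by rewrite !lebesgue_measure_itv /= !lte_fin ltrD2r -!EFinD opprD addrACA subrr addr0.
Qed.

Lemma scales_mul1 (k : R) : k != 0 -> scales leb1 leb1 `|k|^-1 (fun x => k * x).
Proof.
move=> k0.
have mphi : measurable_fun setT (fun x : measurableTypeR R => k * x : measurableTypeR R).
  by apply: measurable_funM.
split=> //; first by rewrite invr_gt0 normr_gt0.
move=> X mX.
pose pm : {measure set (measurableTypeR R) -> \bar R} :=
  mscale (NngNum (normr_ge0 k))
  (measure_function_pushforward__canonical__measure_function_Measure leb1 mphi).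
rewrite [in RHS](@lebesgue_measure_unique _ pm)//; last first.
  move=> _ [[a b] _ <-].
  rewrite /pm /= /mscale /= /pushforward.
  have [kp|kn|/eqP] := ltgtP k 0; last by rewrite (negPf k0).
    rewrite (_ : _ @^-1` _ = [set` `[b / k, a / k[]); last first.
      by apply/seteqP; split=> x /=; rewrite !in_itv /= [k * x]mulrC ltr_ndivlMr// ler_ndivrMr// andbC.
    rewrite !lebesgue_measure_itv /= !lte_fin ltr_nM2r ?invr_lt0//.
    case: ifP => _; rewrite ?mule0// -EFinD -EFinM ltr0_norm//.
    by rewrite -mulrBl mulrC -mulrA mulrN mulVf// mulrN1 opprB.
  rewrite (_ : _ @^-1` _ = [set` `]a / k, b / k]]); last first.
    by apply/seteqP; split=> x /=; rewrite !in_itv /= [k * x]mulrC ltr_pdivrMr// ler_pdivlMr.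
  rewrite !lebesgue_measure_itv /= !lte_fin ltr_pM2r ?invr_gt0//.
  case: ifP => _; rewrite ?mule0// -EFinD -EFinM gtr0_norm//.
  by rewrite -mulrBl mulrC -mulrA mulVf// mulr1.
rewrite /pm /= /mscale /= /pushforward muleA -EFinM mulVf ?mul1e//.
by rewrite normr_eq0.
Qed.

Lemma scales_shift2 (s : vec2 R) : scales leb2 leb2 1 (fun x : vec2 R => x + s).
Proof.
have := scales_prod (scales_shift1 s.1) (scales_shift1 s.2).
by rewrite mulr1.
Qed.

Definition lin2 (a b c d : R) (x : vec2 R) : vec2 R :=
  (a * x.1 + b * x.2, c * x.1 + d * x.2).

Lemma scales_diag a d : a != 0 -> d != 0 ->
  scales leb2 leb2 (`|a|^-1 * `|d|^-1) (lin2 a 0 0 d).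
Proof.
move=> a0 d0; have := scales_prod (scales_mul1 a0) (scales_mul1 d0).
congr scales; apply/funext => x.
by rewrite /lin2 !mul0r addr0 add0r.
Qed.

Lemma scales_swap2 : scales leb2 leb2 1 (lin2 0 1 1 0 : vec2 R -> vec2 R).
Proof.
have := scales_swap leb1.
congr scales; apply/funext => x.
by rewrite /lin2 !mul0r addr0 add0r !mul1r.
Qed.

Lemma scales_shear c : scales leb2 leb2 1 (lin2 1 0 c 1).
Proof.
have sx x : scales leb1 leb1 1 (fun y => y + c * x) by exact: scales_shift1.
have mc : measurable_fun setT
    (fun z : vec2 R => z.2 + c * z.1 : measurableTypeR R).
  apply: measurable_funD; first exact: measurable_snd.
  by apply: measurable_funM => //; exact: measurable_fst.
have := @scales_skew R _ _ _ _ leb1 leb1 1 _ ltr01 mc sx.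
congr scales; apply/funext => x.
by rewrite /lin2 /= mul0r addr0 !mul1r addrC.
Qed.

(** Gaussian elimination: for [a != 0] the map is an upper shear, then the diagonal map with entries
    [a] and [(a d - b c) / a], then a lower shear. The upper shear is a lower one conjugated by the
    swap. If [a = 0] then [c != 0], and exchanging the rows reduces to the first case. *)
Lemma scales_lin2 a b c d : a * d - b * c != 0 ->
  exists e, scales leb2 leb2 e (lin2 a b c d).
Proof.
have nonzero_a (a' b' c' d' : R) : a' != 0 -> a' * d' - b' * c' != 0 ->
    exists e, scales leb2 leb2 e (lin2 a' b' c' d').
  move=> a0 D0; have D1 : (a' * d' - b' * c') / a' != 0.
    by rewrite mulf_neq0 ?invr_eq0.
  have s1 := scales_comp (scales_comp scales_swap2 (scales_shear (b' / a'))) scales_swap2.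
  have s2 := scales_comp (scales_comp s1 (scales_diag a0 D1)) (scales_shear (c' / a')).
  eexists; move: s2; congr scales; apply/funext => x; rewrite /lin2 /=.
  by congr pair; field.
have [->|a0] := eqVneq a 0; last exact: nonzero_a.
rewrite mul0r sub0r oppr_eq0 mulf_eq0 negb_or => /andP[b0 c0].
have [|e se] := nonzero_a c d 0 b c0; first by rewrite mulr0 subr0 mulf_neq0.
have := scales_comp se scales_swap2; rewrite mulr1 => s.
exists e; move: s; congr scales; apply/funext => x; rewrite /lin2 /=.
by congr pair; ring.
Qed.

Lemma actE (M : 'M[R]_2) (x : vec2 R) :
  act M x = lin2 (M ord0 ord0) (M ord0 ord_max) (M ord_max ord0) (M ord_max ord_max) x.
Proof.
have e : lift ord0 ord0 = ord_max :> 'I_2 by exact/val_inj.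
by rewrite /act /lin2 !mxE !big_ord_recl !big_ord0 !mxE /= !addr0 e.
Qed.

Lemma actD (M : 'M[R]_2) (x y : vec2 R) : act M (x + y) = act M x + act M y.
Proof. by rewrite !actE /lin2 /=; congr pair; rewrite /=; ring. Qed.

Lemma actN (M : 'M[R]_2) (x : vec2 R) : act M (- x) = - act M x.
Proof. by rewrite !actE /lin2 /=; congr pair; rewrite /=; ring. Qed.

Lemma act_mul (M N : 'M[R]_2) (x : vec2 R) : act (M *m N) x = act M (act N x).
Proof.
have e : lift ord0 ord0 = ord_max :> 'I_2 by exact/val_inj.
rewrite !actE /lin2 !mxE !big_ord_recl !big_ord0 /= !e.
by congr pair; rewrite /=; ring.
Qed.

Lemma act1 (x : vec2 R) : act 1%:M x = x.
Proof.
by rewrite actE /lin2 !mxE /=; case: x => a b /=; congr pair; ring.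
Qed.

Lemma actDl (M N : 'M[R]_2) (x : vec2 R) : act (M + N) x = act M x + act N x.
Proof. by rewrite !actE /lin2 !mxE; congr pair; rewrite /=; ring. Qed.

Lemma actNl (M : 'M[R]_2) (x : vec2 R) : act (- M) x = - act M x.
Proof. by rewrite !actE /lin2 !mxE; congr pair; rewrite /=; ring. Qed.

Lemma det2 (M : 'M[R]_2) :
  \det M = M ord0 ord0 * M ord_max ord_max - M ord0 ord_max * M ord_max ord0.
Proof.
have e : lift ord0 ord0 = ord_max :> 'I_2 by exact/val_inj.
rewrite (expand_det_row _ ord0) !big_ord_recl big_ord0 /cofactor !det_mx11 !mxE /= !e.
have -> : lift ord_max ord0 = ord0 :> 'I_2 by exact/val_inj.
by rewrite /=; ring.
Qed.

Lemma scales_act (M : 'M[R]_2) : M \in unitmx ->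
  exists c, scales leb2 leb2 c (act M).
Proof.
rewrite unitmxE unitfE det2 => /scales_lin2[e se]; exists e.
by move: se; congr scales; apply/funext => x; rewrite actE.
Qed.

Lemma actK (M : 'M[R]_2) : M \in unitmx -> cancel (act M) (act (invmx M)).
Proof. by move=> uM x; rewrite -act_mul mulVmx// act1. Qed.

Lemma actVK (M : 'M[R]_2) : M \in unitmx -> cancel (act (invmx M)) (act M).
Proof. by move=> uM x; rewrite -act_mul mulmxV// act1. Qed.

Lemma measurable_act (M : 'M[R]_2) : measurable_fun setT (act M).
Proof.
rewrite (_ : act M = lin2 (M ord0 ord0) (M ord0 ord_max) (M ord_max ord0) (M ord_max ord_max)).
  apply: measurable_fun_pair; apply: measurable_funD; apply: measurable_funM => //.
by apply/funext => x; rewrite actE.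
Qed.

End Lebesgue.

(** * The torus *)

Section Torus.
Context {R : realType}.
Local Notation leb1 := (@lebesgue_measure R).

Definition unit_itv : set (measurableTypeR R) := [set` `[0 : R, 1[].

Definition unit_square : set (vec2 R) := unit_itv `*` unit_itv.

Lemma measurable_unit_itv : measurable unit_itv.
Proof. exact: measurable_itv. Qed.

Lemma measurable_unit_square : measurable unit_square.
Proof. by apply: measurableX; exact: measurable_unit_itv. Qed.

Lemma leb1_unit_itv : leb1 unit_itv = 1%E.
Proof. by rewrite lebesgue_measure_itv /= lte_fin ltr01 oppr0 adde0. Qed.

Lemma leb2_setX (A B : set (measurableTypeR R)) : measurable A -> measurable B ->
  leb2 (A `*` B) = (leb1 A * leb1 B)%E.
Proof. exact: product_measure1E. Qed.

Lemma leb2_unit_square : leb2 unit_square = 1%E.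
Proof.
have mI := measurable_unit_itv.
by rewrite leb2_setX// leb1_unit_itv mul1e.
Qed.

Lemma leb2_unit_square_lty : (leb2 unit_square < +oo)%E.
Proof. by rewrite leb2_unit_square ltry. Qed.

Definition fracpart (x : measurableTypeR R) : measurableTypeR R :=
  x - (Num.floor x)%:~R.

Lemma measurable_fracpart : measurable_fun setT fracpart.
Proof.
apply: measurable_funB => //.
apply: (@nondecreasing_measurable R setT (fun x : R => (Num.floor x)%:~R)) => //.
by move=> x y xy; rewrite ler_int; exact: le_floor.
Qed.

Lemma fracpart_itv x : unit_itv (fracpart x).
Proof.
rewrite /unit_itv /= in_itv /= /fracpart subr_ge0 floor_le /= ltrBlDl.
by have := floorD1_gt x; rewrite intrD.
Qed.

Lemma fracpart_id x : unit_itv x -> fracpart x = x.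
Proof.
rewrite /unit_itv /= in_itv /= => /andP[x0 x1]; rewrite /fracpart.
suff -> : Num.floor x = 0 by rewrite subr0.
by apply: floor_def; rewrite x0 add0r.
Qed.

Lemma fracpartD x (n : int) : fracpart (x + n%:~R) = fracpart x.
Proof.
rewrite /fracpart (floorDrz _ (intr_int _ _)) intrKfloor intrD.
by rewrite opprD addrACA subrr addr0.
Qed.

Definition wrap2 (t : vec2 R) : vec2 R := (fracpart t.1, fracpart t.2).

(** The torus is not formed as a quotient: its functions are periodic functions on the plane, its
    integrals are integrals over the half-open unit square, and [wrap2] picks the unique
    representative there. *)
Definition zperiodic (T : Type) (f : vec2 R -> T) : Prop :=
  forall n t, f (t + intpoint n) = f t.

Lemma measurable_wrap2 : measurable_fun setT wrap2.
Proof.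
apply: measurable_fun_pair; apply: measurableT_comp => //; exact: measurable_fracpart.
Qed.

Lemma wrap2_square t : unit_square (wrap2 t).
Proof. by split; exact: fracpart_itv. Qed.

Lemma wrap2_id t : unit_square t -> wrap2 t = t.
Proof. by case: t => a b [/= a1 b1]; rewrite /wrap2 !fracpart_id. Qed.

Lemma wrap2D : zperiodic wrap2.
Proof. by move=> n t; rewrite /wrap2 /= !fracpartD. Qed.

Lemma wrap2E t : wrap2 t = t + intpoint (- Num.floor t.1, - Num.floor t.2).
Proof. by rewrite /wrap2 /fracpart /intpoint /= !intrN. Qed.

Lemma zperiodic_wrap2 (T : Type) (f : vec2 R -> T) : zperiodic f ->
  forall t, f (wrap2 t) = f t.
Proof. by move=> pf t; rewrite wrap2E pf. Qed.

Local Open Scope ereal_scope.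

(** By periodicity [s] may be replaced by its fractional part [r]. Then [[r, 1 + r)] consists of
    [[r, 1)] and [[1, 1 + r)], and the last piece is a unit translate of [[0, r)]. *)
Lemma ge0_integral_shift_unit (g : measurableTypeR R -> \bar R) (s : R) :
  measurable_fun setT g -> (forall x, 0 <= g x) ->
  (forall (n : int) x, g (x + n%:~R)%R = g x) ->
  \int[leb1]_(x in unit_itv) g (x + s)%R = \int[leb1]_(x in unit_itv) g x.
Proof.
move=> mg g0 pg; pose r := fracpart s.
have gr x : g (x + s)%R = g (x + r)%R.
  by rewrite -(pg (- Num.floor s)%R (x + s)%R) intrN /r /fracpart addrA.
under eq_integral do rewrite gr.
have /andP[r0 r1] : (0 <= r < 1)%R by have := fracpart_itv s; rewrite /unit_itv /= in_itv.
have shift (t a b : R) : \int[leb1]_(x in [set` `[a, b[%R]) g (x + t)%R =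
    \int[leb1]_(x in [set` `[a + t, b + t[%R]) g x.
  have := @scales_ge0_integral R _ _ _ _ leb1 leb1 1%R _ (scales_shift1 t)
    [set` `[a + t, b + t[%R] g.
  rewrite mul1e => <-; [|exact: measurable_itv|exact: measurable_funTS|by []].
  by congr integral; apply/seteqP; split=> x /=; rewrite !in_itv /= lerD2r ltrD2r.
have split_itv (a b c : R) : (a <= b)%R -> (b <= c)%R ->
    \int[leb1]_(x in [set` `[a, c[%R]) g x =
    \int[leb1]_(x in [set` `[a, b[%R]) g x + \int[leb1]_(x in [set` `[b, c[%R]) g x.
  move=> ab bc; rewrite -ge0_integral_setU//; last 2 first.
  - exact: measurable_funTS.
  - apply/disj_setPS => x /= []; rewrite !in_itv /= => /andP[_ xb] /andP[bx _].
    by have := lt_le_trans xb bx; rewrite ltxx.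
  congr integral; apply/seteqP; split=> x /=; rewrite !in_itv /=.
    by move=> /andP[ax xc]; case: (ltP x b) => xb; [left|right]; apply/andP.
  case=> /andP[h1 h2]; first by rewrite h1 (lt_le_trans h2 bc).
  by rewrite (le_trans ab h1) h2.
rewrite shift add0r (split_itv r 1%R)//; [|lra|lra].
rewrite [in RHS](split_itv 0%R r) ?(ltW r1)// addeC; congr (_ + _).
rewrite -[X in `[X, _[](add0r (1%R : R)) (addrC 1%R r) -shift.
apply: eq_integral => x _; exact: (pg 1%Z).
Qed.

Lemma ge0_integral_square (f : vec2 R -> \bar R) :
  measurable_fun setT f -> (forall x, 0 <= f x) ->
  \int[leb2]_(t in unit_square) f t =
  \int[leb1]_(x in unit_itv) \int[leb1]_(y in unit_itv) f (x, y).
Proof.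
move=> mf f0; rewrite integral_mkcond /leb2 fubini_tonelli1//; last 2 first.
- apply/(measurable_restrictT _ measurable_unit_square); exact: measurable_funTS.
- by move=> x; rewrite patchE; case: ifPn.
rewrite [RHS]integral_mkcond; apply: eq_integral => x _.
rewrite /fubini_F patchE; case: ifPn => xI.
  rewrite [RHS]integral_mkcond; apply: eq_integral => y _.
  rewrite !patchE; congr (if _ then _ else _).
  apply/idP/idP; rewrite !inE; first by case.
  by move=> yI; split=> //=; rewrite inE in xI.
rewrite integral0_eq// => y _; rewrite patchE; case: ifPn => //.
by rewrite inE => -[/= xI' _]; rewrite notin_setE in xI.
Qed.

Lemma ge0_integral_shift_square (f : vec2 R -> \bar R) (s : vec2 R) :
  measurable_fun setT f -> (forall x, 0 <= f x) -> zperiodic f ->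
  \int[leb2]_(t in unit_square) f (t + s)%R = \int[leb2]_(t in unit_square) f t.
Proof.
move=> mf f0 pf.
have mshift : measurable_fun setT (fun t : vec2 R => t + s)%R.
  by have [] := scales_shift2 s.
rewrite (ge0_integral_square (f := fun t => f (t + s)%R))//; last exact: measurableT_comp.
rewrite ge0_integral_square//.
pose h (x : measurableTypeR R) := \int[leb1]_(y in unit_itv) f (x, y).
have mh : measurable_fun setT h.
  have -> : h = fubini_F leb1 (f \_ (setT `*` unit_itv)).
    apply/funext => x; rewrite /h /fubini_F [LHS]integral_mkcond.
    apply: eq_integral => y _; rewrite !patchE; congr (if _ then _ else _).
    by apply/idP/idP; rewrite !inE; [split|case].
  apply: measurable_fun_fubini_tonelli_F.
    have mTI : measurable (setT `*` unit_itv : set (vec2 R)).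
      by apply: measurableX => //; exact: measurable_unit_itv.
    by apply/(measurable_restrictT _ mTI); exact: measurable_funTS.
  by move=> x; rewrite patchE; case: ifPn.
transitivity (\int[leb1]_(x in unit_itv) h (x + s.1)%R).
  apply: eq_integral => x _; rewrite /h.
  rewrite -(@ge0_integral_shift_unit (fun y => f (x + s.1, y)%R) s.2)//.
    by apply: measurableT_comp => //; exact: measurable_pair1.
  by move=> n y; have := pf (0%Z, n) (x + s.1, y)%R; rewrite /intpoint /= => <-;
    congr (f (_, _)); rewrite /= addr0.
apply: (@ge0_integral_shift_unit h) => //.
  by move=> x; apply: integral_ge0.
move=> n x; apply: eq_integral => y _.
by have := pf (n, 0%Z) (x, y)%R; rewrite /intpoint /= => <-;
    congr (f (_, _)); rewrite /= addr0.
Qed.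

End Torus.

(** * The maximal inequality *)

Section Maximal.
Context {R : realType} (L : 'M[R]_2).
Implicit Types (f g : vec2 R -> R) (t : vec2 R).

Definition box_avg (N : nat) f t : R :=
  (((2 * N + 1) ^ 2)%N%:R)^-1 *
  \sum_(m <- boxseq N) f (t + act L (intpoint m)).

(** The truncation at radius [M] keeps the boxes of the covering argument inside a window enlarged
    by [M]. It is removed by monotonicity in [maximal_ineqT]. *)
Definition maximal_set f (lam : R) (M : nat) : set (vec2 R) :=
  [set t | exists2 N, (N <= M)%N & lam < box_avg N f t].

Lemma intpointD (m n : int * int) :
  intpoint (m.1 + n.1, m.2 + n.2) = intpoint m + intpoint n :> vec2 R.
Proof. by rewrite /intpoint /= !intrD. Qed.

Lemma zperiodic_shift (T : Type) (h : vec2 R -> T) s :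
  zperiodic h -> zperiodic (fun t => h (t + s)).
Proof. by move=> ph n t; rewrite addrAC ph. Qed.

Lemma zperiodic_box_avg N f : zperiodic f -> zperiodic (box_avg N f).
Proof.
move=> pf n t; congr (_ * _); apply: eq_bigr => m _.
exact: (zperiodic_shift _ pf).
Qed.

Lemma measurable_box_avg N f : measurable_fun setT f -> measurable_fun setT (box_avg N f).
Proof.
move=> mf; apply: measurable_funM => //; apply: measurable_sum => m.
by apply: (measurableT_comp mf); have [] := scales_shift2 (act L (intpoint m)).
Qed.

Lemma maximal_setE f lam M : maximal_set f lam M =
  \bigcup_(N in [set N | (N <= M)%N]) [set t | lam < box_avg N f t].
Proof. by apply/seteqP; split=> t [N NM h]; exists N. Qed.

Lemma measurable_maximal_set f lam M : measurable_fun setT f -> measurable (maximal_set f lam M).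
Proof.
move=> mf; rewrite maximal_setE; apply: bigcup_measurable => N _.
rewrite (_ : [set _ | _] = box_avg N f @^-1` `]lam, +oo[%classic).
  by rewrite -[_ @^-1` _]setTI; apply: measurable_box_avg.
by apply/seteqP; split=> t /=; rewrite in_itv /= andbT.
Qed.

Lemma zperiodic_indic (A : set (vec2 R)) :
  zperiodic (fun t => A t) -> zperiodic (\1_A : vec2 R -> R).
Proof.
move=> pA n t; rewrite !indicE; congr ((_ : bool)%:R).
by apply/idP/idP; rewrite !inE pA.
Qed.

Lemma zperiodic_maximal_set f lam M : zperiodic f -> zperiodic (fun t => maximal_set f lam M t).
Proof.
by move=> pf n t; apply/propext; split=> -[N NM]; rewrite ?zperiodic_box_avg// => h;
  exists N => //; rewrite zperiodic_box_avg.
Qed.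

(** The covering lemma on the orbit of one point [t]: the centres are the [n] of the box of radius
    [K] that reach the maximal set, each with a radius at most [M] at which the average is large.
    Their boxes fit into the box of radius [K + M], whence the larger sum on the right. *)
Lemma maximal_pointwise f lam M K t : (forall t, 0 <= f t) -> 0 <= lam ->
  lam * \sum_(n <- boxseq K) \1_(maximal_set f lam M) (t + act L (intpoint n)) <=
  4 * \sum_(m <- boxseq (K + M)) f (t + act L (intpoint m)).
Proof.
move=> f0 lam0; pose E n := `[< maximal_set f lam M (t + act L (intpoint n)) >].
pose s := [seq n <- boxseq K | E n].
have -> : \sum_(n <- boxseq K) \1_(maximal_set f lam M) (t + act L (intpoint n)) =
    (size s)%:R :> R.
  rewrite /s size_filter -sum1_count. rewrite natr_sum [RHS]big_mkcond /=.
  apply: eq_bigr => n _; rewrite indicE /E.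
  by case: asboolP => h; [rewrite mem_set|rewrite memNset].
(* Stated as an implication so that choice gives a radius for every [n]; its value off [E] is
   immaterial. *)
have Ex n : exists N, E n -> (N <= M)%N /\
    lam < box_avg N f (t + act L (intpoint n)).
  have [/asboolP[N NM h]|nE] := boolP (E n); last by exists 0%N.
  by exists N.
pose rho n := projT1 (cid (Ex n)).
have rhoP n : E n -> (rho n <= M)%N /\
    lam < box_avg (rho n) f (t + act L (intpoint n)).
  exact: projT2 (cid (Ex n)).
apply: (@box_covering R lam (fun m => f (t + act L (intpoint m))) rho) => //.
  exact/filter_uniq/boxseq_uniq.
move=> p; rewrite mem_filter => /andP[Ep pK]; have [rM] := rhoP _ Ep.
rewrite /box_avg mulrC ltr_pdivlMr ?ltr0n ?expn_gt0 ?addn_gt0 ?orbT//.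
move=> /ltW /le_trans; apply.
rewrite -boxseq_shift.
  apply: ler_sum => m _; rewrite -addrA -actD addrC intpointD.
  by rewrite [X in _ <= f (X)]addrC [intpoint m + _]addrC.
move=> m; move: pK; rewrite mem_boxseq /in_box /= !subr0; lia.
Qed.

Local Open Scope ereal_scope.

Lemma integral_boxsum (h : vec2 R -> R) N :
  measurable_fun setT h -> (forall t, 0 <= h t)%R -> zperiodic h ->
  \int[leb2]_(t in unit_square)
    (\sum_(m <- boxseq N) h (t + act L (intpoint m)))%:E =
  (((2 * N + 1) ^ 2)%N%:R)%:E * \int[leb2]_(t in unit_square) (h t)%:E.
Proof.
move=> mh h0 ph.
under eq_integral do rewrite -sumEFin.
have mE : measurable_fun setT (EFin \o h) by exact/measurable_EFinP.
rewrite ge0_integral_sum//; last 3 first.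
- exact: measurable_unit_square.
- move=> m; apply: measurable_funTS; apply: (measurableT_comp mE).
  by have [] := scales_shift2 (act L (intpoint m)).
- by move=> m t _; rewrite lee_fin.
rewrite (eq_bigr (fun=> \int[leb2]_(t in unit_square) (h t)%:E)); last first.
  move=> m _; apply: (ge0_integral_shift_square (f := EFin \o h)) => //.
  by move=> n t; rewrite /= ph.
by rewrite big_const_seq count_predT size_boxseq iter_addr_0 mule_natl.
Qed.

(** Transference: integrating [maximal_pointwise] over the torus multiplies the two sides by the
    numbers of points in the boxes of radius [K] and [K + M], because translations preserve the
    integral. The ratio of these numbers tends to 1 as [K] grows. *)
Lemma maximal_ineq f lam M :
  measurable_fun setT f -> (forall t, 0 <= f t)%R -> zperiodic f -> (0 <= lam)%R ->
  lam%:E * leb2 (maximal_set f lam M `&` unit_square) <=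
  4%:E * \int[leb2]_(t in unit_square) (f t)%:E.
Proof.
move=> mf f0 pf lam0.
set E := maximal_set f lam M; set I := \int[leb2]_(t in _) _.
have mE : measurable E by exact: measurable_maximal_set.
have mQ := @measurable_unit_square R.
have I0 : 0 <= I by apply: integral_ge0 => t _; rewrite lee_fin.
have [Ioo|Ifin] := eqVneq I +oo; first by rewrite Ioo mulry gtr0_sg// mul1e leey.
have Inum : I \is a fin_num by rewrite ge0_fin_numE// lt_neqAle Ifin leey.
have EQ1 : leb2 (E `&` unit_square) <= 1.
  by rewrite -leb2_unit_square le_measure ?inE//; exact: measurableI.
have EQnum : leb2 (E `&` unit_square) \is a fin_num.
  by rewrite ge0_fin_numE// (le_lt_trans EQ1) ?ltry.
have m1E : measurable_fun setT (\1_E : vec2 R -> R) by exact: measurable_indic.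
have e1 : \int[leb2]_(t in unit_square) (lam * \1_E t)%:E =
    lam%:E * leb2 (E `&` unit_square).
  under eq_integral do rewrite EFinM.
  rewrite ge0_integralZl_EFin ?integral_indic//.
  by apply/measurable_EFinP; exact: measurable_funTS.
have e2 : \int[leb2]_(t in unit_square) (4 * f t)%:E = 4%:E * I.
  under eq_integral do rewrite EFinM.
  rewrite ge0_integralZl_EFin//; first by move=> t _; rewrite lee_fin.
  by apply/measurable_EFinP; exact: measurable_funTS.
have msum (h : vec2 R -> R) N : measurable_fun setT h -> measurable_fun unit_square
    (fun t => (\sum_(m <- boxseq N) h (t + act L (intpoint m)))%:E).
  move=> mh; apply/measurable_EFinP; apply: measurable_funTS.
  apply: measurable_sum => m; apply: (measurableT_comp mh).
  by have [] := scales_shift2 (act L (intpoint m)).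
have key K : (((2 * K + 1) ^ 2)%N%:R)%:E * (lam%:E * leb2 (E `&` unit_square)) <=
    (((2 * (K + M) + 1) ^ 2)%N%:R)%:E * (4%:E * I).
  have mh1 : measurable_fun setT (fun t => lam * \1_E t)%R.
    exact: measurable_funM.
  have mh2 : measurable_fun setT (fun t => 4 * f t)%R.
    exact: measurable_funM.
  rewrite -e1 -e2.
  rewrite -(integral_boxsum (h := fun t => lam * \1_E t)%R)//; last 2 first.
  - by move=> t; rewrite mulr_ge0// indicE.
  - by move=> n t; rewrite (zperiodic_indic (zperiodic_maximal_set lam M pf)).
  rewrite -(integral_boxsum (h := fun t => 4 * f t)%R)//; last 2 first.
  - by move=> t; rewrite mulr_ge0.
  - by move=> n t; rewrite pf.
  apply: ge0_le_integral => //.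
  - by move=> t _; rewrite lee_fin sumr_ge0// => m _; rewrite mulr_ge0// indicE.
  - exact: (msum (fun t => lam * \1_E t)%R).
  - exact: (msum (fun t => 4 * f t)%R).
  - by move=> t _; rewrite lee_fin -!mulr_sumr; exact: maximal_pointwise.
move: key; rewrite -(fineK EQnum) -(fineK Inum).
have : (0 <= fine I)%R by rewrite fine_ge0.
move: (fine I) (fine (leb2 (E `&` unit_square))) => i x i0 key.
rewrite -!EFinM lee_fin leNgt; apply/negP; set b := (4 * i)%R; set a := (lam * x)%R.
move=> ba; have b0 : (0 <= b)%R by rewrite mulr_ge0.
pose c : R := (2 * M)%:R.
have c0 : (0 <= c)%R by rewrite ler0n.
(* Write [X = 2 K + 1] and [c = 2 M]. If [b < a], the inequality [key K] gives
   [X^2 (a - b) <= 2 b c X + b c^2], and since [X >= 1] this fails as soon as [X] exceeds the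
   quotient below. *)
have [K hK] : exists K : nat, ((2 * b * c + b * c ^+ 2) / (a - b) < K%:R)%R.
  exists (Num.bound ((2 * b * c + b * c ^+ 2) / (a - b))%R).
  by apply: archi_boundP; rewrite divr_ge0 ?subr_ge0 ?(ltW ba)// addr_ge0 ?mulr_ge0// exprn_ge0.
have := key K; rewrite -!EFinM lee_fin -/a -/b => keyK.
have := hK; rewrite ltr_pdivrMr ?subr_gt0// => {}hK.
have eX : (((2 * K + 1) ^ 2)%N%:R = (2 * K%:R + 1) ^+ 2 :> R)%R.
  by rewrite natrX natrD natrM.
have eY : (((2 * (K + M) + 1) ^ 2)%N%:R = (2 * K%:R + 1 + c) ^+ 2 :> R)%R.
  by rewrite natrX /c natrD !natrM natrD; congr (_ ^+ 2)%R; ring.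
move: keyK; rewrite eX eY.
have : (0 <= K%:R :> R)%R by rewrite ler0n.
move: (K%:R : R) hK => k hK k0; set X := (2 * k + 1)%R => hX.
have X1 : (1 <= X)%R by rewrite /X; lra.
have kX : (k <= X)%R by rewrite /X; lra.
have bc0 : (0 <= b * c ^+ 2)%R by rewrite mulr_ge0// exprn_ge0.
have h1 : (b * c ^+ 2 <= b * c ^+ 2 * X)%R by rewrite ler_peMr.
have h2 : (k * (a - b) <= X * (a - b))%R by rewrite ler_wpM2r// subr_ge0 ltW.
have h3 : (X * (2 * b * c + b * c ^+ 2) < X * (X * (a - b)))%R.
  by rewrite ltr_pM2l; [exact: lt_le_trans hK h2|lra].
lra.
Qed.

End Maximal.

(** * Null sets and stability of the convergence of averages *)

Lemma ae_forall_count {R : realType} d (T : measurableType d)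
    (mu : {measure set T -> \bar R}) (I : countType) (P : I -> T -> Prop) :
  (forall i, {ae mu, forall x, P i x}) -> {ae mu, forall x, forall i, P i x}.
Proof.
move=> aeP; pose Q n x := if @unpickle I n is Some i then P i x else True.
have : {ae mu, forall x, forall n, Q n x}.
  apply: ae_foralln => n; rewrite /Q; case: (unpickle n) => [i|]; first exact: aeP.
  exact: aeW.
by apply: filterS => x Qx i; have := Qx (pickle i); rewrite /Q pickleK.
Qed.

Lemma negligible_eps {R : realType} d (T : measurableType d)
    (mu : {measure set T -> \bar R}) (X : set T) :
  (forall e : R, 0 < e ->
     exists C, [/\ measurable C, X `<=` C & (mu C <= e%:E)%E]) ->
  mu.-negligible X.
Proof.
move=> h; have /choice[C CP] : forall k : nat, exists C,
    [/\ measurable C, X `<=` C & (mu C <= (k.+1%:R^-1)%:E)%E].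
  by move=> k; apply: h; rewrite invr_gt0.
exists (\bigcap_k C k); split.
- by apply: bigcapT_measurable => k; case: (CP k).
- apply/eqP; rewrite eq_le measure_ge0 andbT.
  apply/lee_addgt0Pr => e e0; rewrite add0e.
  have [k hk] : exists k : nat, k.+1%:R^-1 < e.
    exists (Num.bound e^-1); rewrite invf_plt ?posrE//.
    by rewrite (lt_trans (archi_boundP _))// ?invr_ge0 ?ltW// ltr_nat.
  have [mC _ Ck] := CP k.
  apply: le_trans (_ : mu (C k) <= _)%E.
    apply: le_measure; rewrite ?inE//; last exact: bigcap_inf.
    by apply: bigcapT_measurable => i; case: (CP i).
  by apply: le_trans Ck _; rewrite lee_fin ltW.
- by move=> x Xx k _; have [_ + _] := CP k; apply.
Qed.

Lemma bounded_integrable {R : realType} d (T : measurableType d)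
    (mu : {measure set T -> \bar R}) (D : set T) (f : T -> R) (C : R) :
  measurable D -> (mu D < +oo)%E -> measurable_fun D f ->
  (forall x, D x -> `|f x| <= C) -> mu.-integrable D (EFin \o f).
Proof.
move=> mD Doo mf fC; apply/integrableP; split; first exact/measurable_EFinP.
have [->|/set0P[x0 Dx0]] := eqVneq D set0; first by rewrite integral_set0.
have C0 : 0 <= C by rewrite (le_trans _ (fC x0 Dx0)).
apply: (@le_lt_trans _ _ (\int[mu]_(x in D) C%:E)%E).
  apply: ge0_le_integral => //.
  by do 2 apply: measurableT_comp => //.
by rewrite integral_cst// lte_mul_pinfty.
Qed.

Section Convergence.
Context {R : realType} (L : 'M[R]_2).
Implicit Types (f g : vec2 R -> R) (t : vec2 R).

(** Each point is carried into the square by an integer translation, and there are only countably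
    many of these. *)
Lemma ae_wrap2 (P : vec2 R -> Prop) :
  {ae leb2, forall t, unit_square t -> P t} -> {ae leb2, forall t, P (wrap2 t)}.
Proof.
move=> aeP.
have : {ae leb2, forall t : vec2 R, forall n : int * int,
    unit_square (t + intpoint n) -> P (t + intpoint n)}.
  apply: ae_forall_count => n.
  exact: (scales_ae (scales_shift2 (intpoint n)) aeP).
apply: filterS => t /(_ (- Num.floor t.1, - Num.floor t.2)).
by rewrite -wrap2E; apply; exact: wrap2_square.
Qed.

Definition torus_integrable f : Prop :=
  [/\ measurable_fun setT f, zperiodic f
    & leb2.-integrable unit_square (EFin \o f)].

Definition avg_converges f : Prop :=
  {ae leb2, forall t, box_avg L N f t @[N --> \oo] -->
    (\int[leb2]_(x in unit_square) f x)%R}.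

Lemma integrable_bounded f (C : R) : measurable_fun setT f ->
  (forall t, `|f t| <= C) -> leb2.-integrable unit_square (EFin \o f).
Proof.
move=> mf fC; apply: (@bounded_integrable _ _ _ _ _ _ C) => //.
- exact: measurable_unit_square.
- exact: leb2_unit_square_lty.
- exact: measurable_funTS.
Qed.

Lemma torus_integrable_bounded f (C : R) : measurable_fun setT f -> zperiodic f ->
  (forall t, `|f t| <= C) -> torus_integrable f.
Proof. by move=> mf pf fC; split=> //; exact: (integrable_bounded mf fC). Qed.

Lemma torus_integrableD f g : torus_integrable f -> torus_integrable g ->
  torus_integrable (fun t => f t + g t).
Proof.
move=> [mf pf intf] [mg pg intg]; split.
- exact: measurable_funD.
- by move=> n t; rewrite pf pg.
- exact: (integrableD measurable_unit_square intf intg).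
Qed.

Lemma torus_integrableZ c f : torus_integrable f ->
  torus_integrable (fun t => c * f t).
Proof.
move=> [mf pf intf]; split.
- exact: measurable_funM.
- by move=> n t; rewrite pf.
- exact: (integrableZl measurable_unit_square c intf).
Qed.

Lemma box_avgD N f g t :
  box_avg L N (fun t => f t + g t) t = box_avg L N f t + box_avg L N g t.
Proof. by rewrite /box_avg big_split mulrDr. Qed.

Lemma box_avgZ N c f t : box_avg L N (fun t => c * f t) t = c * box_avg L N f t.
Proof. by rewrite /box_avg -mulr_sumr mulrCA. Qed.

Lemma avg_convergesD f g : torus_integrable f -> torus_integrable g ->
  avg_converges f -> avg_converges g -> avg_converges (fun t => f t + g t).
Proof.
move=> [_ _ intf] [_ _ intg]; apply: filterS2 => t cf cg.
rewrite RintegralD//; last exact: measurable_unit_square.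
under eq_fun do rewrite box_avgD.
exact: cvgD.
Qed.

Lemma avg_convergesZ c f : torus_integrable f ->
  avg_converges f -> avg_converges (fun t => c * f t).
Proof.
move=> [_ _ intf]; apply: filterS => t cf.
rewrite RintegralZl//; last exact: measurable_unit_square.
under eq_fun do rewrite box_avgZ.
exact: cvgMl_tmp.
Qed.

Lemma ler_norm_box_avg N f t : `|box_avg L N f t| <= box_avg L N (fun t => `|f t|) t.
Proof.
rewrite /box_avg normrM ger0_norm ?invr_ge0// ler_wpM2l ?invr_ge0//.
exact: ler_norm_sum.
Qed.

Lemma maximal_ineqT f lam :
  measurable_fun setT f -> (forall t, 0 <= f t) -> zperiodic f -> 0 <= lam ->
  (lam%:E * leb2 (\bigcup_M maximal_set L f lam M `&` unit_square) <=
   4%:E * \int[leb2]_(t in unit_square) (f t)%:E)%E.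
Proof.
move=> mf f0 pf lam0; rewrite setI_bigcupl.
have mE M : measurable (maximal_set L f lam M `&` unit_square).
  by apply: measurableI; [exact: measurable_maximal_set|exact: measurable_unit_square].
have cv : (lam%:E * leb2 (maximal_set L f lam M `&` unit_square))%E @[M --> \oo] -->
   (lam%:E * leb2 (\bigcup_M (maximal_set L f lam M `&` unit_square)))%E.
  apply: cvgeZl => //; apply: nondecreasing_cvg_mu => //.
    exact: bigcup_measurable.
  move=> M M' MM'; apply/subsetPset; apply: setSI => t [N NM h].
  by exists N => //; exact: leq_trans NM MM'.
rewrite -(cvg_lim _ cv)//; apply: lime_le; first by apply/cvg_ex; eexists; exact: cv.
by apply: nearW => M; exact: maximal_ineq.
Qed.

(* Stein's principle: the maximal inequality makes the set of functions with
   convergent averages closed in [L^1]. *)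
Lemma avg_converges_closed f : torus_integrable f ->
  (forall e : R, 0 < e -> exists g, [/\ torus_integrable g, avg_converges g &
     (\int[leb2]_(t in unit_square) (`|f t - g t|)%:E <= e%:E)%E]) ->
  avg_converges f.
Proof.
move=> [mf pf intf] approx.
have mQ := @measurable_unit_square R.
pose If := (\int[leb2]_(x in unit_square) f x)%R.
pose ok (d : R) t := \forall N \near \oo, `|If - box_avg L N f t| <= d.
have pok d : zperiodic (ok d).
  by move=> n t; apply/propext; split; apply: filterS => N; rewrite zperiodic_box_avg.
(* For a fixed tolerance the condition is periodic, so it is enough to treat the unit square. The
   tolerances [1 / (k + 1)] then form a countable family. *)
suff okQ (k : nat) : {ae leb2, forall t, unit_square t -> ok (k.+1%:R^-1) t}.
  have : {ae leb2, forall t, forall k : nat, ok (k.+1%:R^-1) t}.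
    apply: ae_foralln => k; have := ae_wrap2 (okQ k).
    by apply: filterS => t; rewrite zperiodic_wrap2.
  apply: filterS => t okt; apply/cvgrPdist_le => e e0.
  have [k hk] : exists k : nat, k.+1%:R^-1 < e.
    exists (Num.bound e^-1); rewrite invf_plt ?posrE//.
    by rewrite (lt_trans (archi_boundP _))// ?invr_ge0 ?ltW// ltr_nat.
  by apply: filterS (okt k) => N /le_trans; apply; exact: ltW.
set d := k.+1%:R^-1; have d0 : 0 < d by rewrite invr_gt0.
apply: negligible_eps => e e0.
(* The first bound brings the two integrals within [d / 4] of each other. The second gives
   [leb2 E <= e], since the maximal inequality yields [(d / 2) leb2 E <= 4 e1]. Off the exceptional
   set the errors add up to [d / 4 + d / 4 + d / 2 = d]. *)
pose e1 := Num.min (d / 4) (e * (d / 2) / 4).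
have e10 : 0 < e1 by rewrite lt_min !divr_gt0// !mulr_gt0// invr_gt0.
have [g [[mg pg intg] cg gf]] := approx _ e10.
pose h t := `|f t - g t|.
have mh : measurable_fun setT h by apply: measurableT_comp => //; exact: measurable_funB.
have ph : zperiodic h by move=> n t; rewrite /h pf pg.
have intfg : leb2.-integrable unit_square (EFin \o (fun t => f t - g t)).
  exact: (integrableB mQ intf intg).
pose E := \bigcup_M maximal_set L h (d / 2) M `&` unit_square.
have mE : measurable E.
  apply: measurableI => //; apply: bigcup_measurable => M _; exact: measurable_maximal_set.
have [Z [mZ Z0 gZ]] := cg.
exists (E `|` Z); split; first exact: measurableU.
  move=> t /= /not_implyP[Qt nok]; have [?|tZ] := pselect (Z t); [by right|left].
  apply: contrapT => nE; apply: nok.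
  have cgt : box_avg L N g t @[N --> \oo] --> (\int[leb2]_(x in unit_square) g x)%R.
    by apply: contrapT => /gZ.
  have hd N : box_avg L N h t <= d / 2.
    rewrite leNgt; apply/negP => hN; apply: nE; split=> //.
    by exists N => //; exists N.
  have Ifg : `|If - (\int[leb2]_(x in unit_square) g x)%R| <= d / 4.
    rewrite /If -RintegralB//.
    apply: le_trans (le_normr_Rintegral mQ intfg) _.
    rewrite -lee_fin /Rintegral fineK; last first.
      by apply: integrable_fin_num => //; exact: (integrable_norm intfg).
    by apply: le_trans gf _; rewrite lee_fin ge_min lexx.
  move/cvgrPdist_le: cgt => /(_ (d / 4)); rewrite divr_gt0// => /(_ isT).
  apply: filterS => N gN.
  have fgN : `|box_avg L N g t - box_avg L N f t| <= d / 2.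
    rewrite distrC; apply: le_trans (hd N).
    apply: le_trans (_ : `|box_avg L N (fun t => f t - g t) t| <= _).
      by rewrite /box_avg sumrB mulrBr.
    exact: ler_norm_box_avg.
  rewrite (_ : If - _ = (If - (\int[leb2]_(x in unit_square) g x)%R) +
     ((\int[leb2]_(x in unit_square) g x)%R - box_avg L N g t) +
     (box_avg L N g t - box_avg L N f t)); last by ring.
  apply: le_trans (ler_normD _ _) _.
  apply: le_trans (lerD (ler_normD _ _) fgN) _.
  by move: Ifg gN => ? ?; lra.
apply: le_trans (measureU2 _ _ _) _ => //; rewrite [X in (_ + X)%E]Z0 adde0.
have := maximal_ineqT mh (fun t => normr_ge0 _) ph (ltW (divr_gt0 d0 (ltr0n _ 2))).
rewrite -/E => Eh.
have d20 : (0 < (d / 2)%:E)%E by rewrite lte_fin divr_gt0.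
rewrite -(@lee_pmul2l _ (d / 2)%:E)//.
apply: le_trans Eh _.
apply: le_trans (_ : 4%:E * e1%:E <= _)%E; first by rewrite lee_pmul2l// lte_fin.
rewrite -!EFinM lee_fin /e1.
have : Num.min (d / 4) (e * (d / 2) / 4) <= e * (d / 2) / 4 by rewrite ge_min lexx orbT.
lra.
Qed.

End Convergence.

(** * Trigonometric polynomials *)

Section Trigonometry.
Context {R : realType}.
Implicit Types (x y a b : R).

Lemma cosD2piz x (n : int) : cos (x + 2 * pi * n%:~R) = cos x.
Proof.
have h (m : nat) y : cos (y + 2 * pi * m%:R) = cos y.
  have -> : 2 * pi * m%:R = (pi *+ 2) *+ m :> R by rewrite -[RHS]mulr_natr -[pi *+ 2]mulr_natl.
  exact: (periodicn (@cosD2pi R)).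
case: n => m; first exact: h.
by rewrite NegzE intrN mulrN -[LHS](h m.+1 (x - 2 * pi * m.+1%:R)) subrK.
Qed.

Lemma sin_pi_eq0 x : sin (pi * x) = 0 -> exists n : int, x = n%:~R.
Proof.
move=> s0; exists (Num.floor x); pose y := x - (Num.floor x)%:~R.
have /andP[y0 y1] : 0 <= y < 1 by have := fracpart_itv x; rewrite /unit_itv /= in_itv.
(* Doubling the angle turns a zero of the sine into a value of the cosine, which does not change
   when an integer is subtracted from [x]. The fractional part [y] thus inherits the zero. *)
have cos2 z : cos (2 * pi * z) = 1 - 2 * sin (pi * z) ^+ 2 :> R.
  by rewrite -mulrA mulr_natl cos_mulr2n cos2sin2; ring.
have : cos (2 * pi * y) = 1.
  rewrite -(cosD2piz _ (Num.floor x)) -mulrDr /y subrK cos2 s0.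
  by rewrite expr0n /= mulr0 subr0.
rewrite cos2 => sy.
have {}sy : sin (pi * y) = 0.
  by apply/eqP; rewrite -sqrf_eq0; apply/eqP; lra.
have [y00|yN0] := eqVneq y 0; first by apply/eqP; rewrite -subr_eq0; apply/eqP.
have yp : 0 < y by rewrite lt_neqAle eq_sym yN0.
have : 0 < sin (pi * y).
  by apply: sin_gt0_pi; rewrite mulr_gt0 ?pi_gt0//= gtr_pMr ?pi_gt0.
by rewrite sy ltxx.
Qed.

(** The factor [2 sin (a / 2)] turns each cosine into a difference of sines half a step to either
    side, and the sum telescopes. *)
Lemma sum_cos_arith (phi a : R) n :
  2 * sin (a / 2) * (\sum_(i <- iota 0 n) cos (phi + i%:R * a)) =
  sin (phi + n%:R * a - a / 2) - sin (phi - a / 2).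
Proof.
elim: n => [|n IH]; first by rewrite big_nil mulr0 mul0r addr0 subrr.
have -> : iota 0 n.+1 = iota 0 n ++ [:: n] by rewrite -addn1 iotaD.
rewrite big_cat /= big_seq1 mulrDr IH -[n.+1]addn1 natrD.
have -> : phi + (n%:R + 1) * a - a / 2 = phi + n%:R * a + a / 2 by lra.
move: (phi + n%:R * a) (sin (phi - a / 2)) => P Q.
rewrite sinB sinD; ring.
Qed.

Lemma sum_cos_bound (phi a : R) n : sin (a / 2) != 0 ->
  `|\sum_(i <- iota 0 n) cos (phi + i%:R * a)| <= `|sin (a / 2)|^-1.
Proof.
move=> s0; rewrite -[leRHS]mul1r ler_pdivlMr ?normr_gt0// -normrM.
have h := sum_cos_arith phi a n.
rewrite -(@ler_pM2l _ 2)// mulr1 -[X in X * _]ger0_norm// -normrM.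
rewrite (_ : 2 * _ = 2 * sin (a / 2) * (\sum_(i <- iota 0 n) cos (phi + i%:R * a))); last by ring.
rewrite h; apply: le_trans (ler_normB _ _) _.
have l1 (z : R) : `|sin z| <= 1 by rewrite ler_norml sin_geN1 sin_le1.
by have := l1 (phi + n%:R * a - a / 2); have := l1 (phi - a / 2); lra.
Qed.

(* The first factor tends to the indicator of [0 < x] except at [0], where it
   tends to [1/e]; the second factor vanishes at [0] and tends to [1] elsewhere. *)
Definition step_poly (n : nat) x : R :=
  (1 - ((1 - x) / 2) ^+ n) ^+ (2 ^ n) * (1 - (1 - x ^+ 2) ^+ n).

Lemma bernoulli_ineq y m : -1 <= y -> 1 + m%:R * y <= (1 + y) ^+ m.
Proof.
move=> y1; elim: m => [|m IH]; first by rewrite mul0r addr0 expr0.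
have m0 : 0 <= m%:R :> R by [].
rewrite exprS; apply: le_trans (_ : (1 + y) * (1 + m%:R * y) <= _).
  rewrite -[m.+1]addn1 natrD; nra.
by rewrite ler_wpM2l//; lra.
Qed.

Lemma step_poly_itv n x : -1 <= x <= 1 -> 0 <= step_poly n x <= 1.
Proof.
move=> /andP[xN1 x1]; have y0 : 0 <= (1 - x) / 2 by lra.
have y1 : (1 - x) / 2 <= 1 by lra.
have z0 : 0 <= 1 - x ^+ 2 by nra.
have z1 : 1 - x ^+ 2 <= 1 by nra.
have h (w : R) : 0 <= w -> w <= 1 -> 0 <= 1 - w ^+ n <= 1.
  by move=> w0 w1; rewrite subr_ge0 exprn_ile1//= lerBlDr lerDl exprn_ge0.
have /andP[a0 a1] := h _ y0 y1; have /andP[b0 b1] := h _ z0 z1.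
by rewrite mulr_ge0 ?exprn_ge0//= mulr_ile1 ?exprn_ge0 ?exprn_ile1.
Qed.

(** Write [y = (1 - x) / 2]. For [0 < x] Bernoulli's inequality bounds the first factor below by
    [1 - (2 y)^n], where [2 y < 1]. For [x < 0] the inequalities [(1 - y^n) (1 + y^n) <= 1] and
    [2^n y^n <= (1 + y^n)^(2^n)], again Bernoulli, bound it above by [(2 y)^-n], where [2 y > 1]. *)
Lemma cvg_step_poly x : -1 <= x <= 1 ->
  step_poly n x @[n --> \oo] --> ((0 < x)%R%:R : R).
Proof.
move=> xi; have /andP[xN1 x1] := xi; have y0 : 0 <= (1 - x) / 2 by lra.
set y := (1 - x) / 2 in y0 *; have y1 : y <= 1 by rewrite /y; lra.
have z0 : 0 <= 1 - x ^+ 2 by nra.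
have yn0 n : 0 <= y ^+ n by rewrite exprn_ge0.
have yn1 n : y ^+ n <= 1 by rewrite exprn_ile1.
have [xneg|xpos|x0] := ltgtP x 0.
- have y2 : 1 < 2 * y by rewrite /y; lra.
  have up n : step_poly n x <= ((2 * y)^-1) ^+ n.
    apply: le_trans (_ : (1 - y ^+ n) ^+ (2 ^ n) <= _).
      rewrite /step_poly ler_piMr ?exprn_ge0 ?subr_ge0//.
      by rewrite lerBlDr lerDl exprn_ge0.
    rewrite exprVn -[leRHS]mul1r ler_pdivlMr ?exprn_gt0//; last lra.
    apply: le_trans (_ : (1 - y ^+ n) ^+ (2 ^ n) * (1 + y ^+ n) ^+ (2 ^ n) <= _).
      rewrite ler_wpM2l ?exprn_ge0 ?subr_ge0//.
      apply: le_trans (bernoulli_ineq _ _); last by have := yn0 n; lra.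
      by rewrite natrX exprMn lerDr.
    rewrite -exprMn exprn_ile1//.
      by have := yn0 n; have := yn1 n; nra.
    by have := yn0 n; have := yn1 n; nra.
  apply: (squeeze_cvgr (f := fun=> 0) (h := fun n => ((2 * y)^-1) ^+ n)).
  + apply: nearW => n; rewrite up andbT.
    by have /andP[] := step_poly_itv n xi.
  + exact: cvg_cst.
  + apply: cvg_expr; rewrite ger0_norm ?invr_ge0; last lra.
    by rewrite invf_lt1; lra.
- have y2 : 2 * y < 1 by rewrite /y; lra.
  rewrite -[X in _ --> X]mulr1 /=; apply: cvgM.
    apply: (squeeze_cvgr (f := fun n => 1 - (2 * y) ^+ n) (h := fun=> 1)).
    + apply: nearW => n; apply/andP; split; last first.
        by rewrite exprn_ile1 ?subr_ge0// lerBlDr lerDl.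
      apply: le_trans (_ : 1 + (2 ^ n)%:R * - y ^+ n <= _).
        by rewrite natrX mulrN exprMn.
      by apply: bernoulli_ineq; have := yn1 n; lra.
    + rewrite -[X in _ --> X]subr0; apply: cvgB; first exact: cvg_cst.
      by apply: cvg_expr; rewrite ger0_norm; lra.
    + exact: cvg_cst.
  rewrite -[X in _ --> X]subr0; apply: cvgB; first exact: cvg_cst.
  by apply: cvg_expr; rewrite ger0_norm//; nra.
- rewrite (_ : (fun n => step_poly n x) = fun=> 0); first exact: cvg_cst.
  by apply/funext => n; rewrite /step_poly x0 expr0n /= subr0 expr1n subrr mulr0.
Qed.

(** A function on the circle that is positive exactly on the open arc from [0] to [a], whose
    midpoint is the maximum of the shifted cosine. Halving keeps the values in [[-1, 1]], the range
    on which [step_poly] is controlled. *)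
Definition arc_fun a x : R := (cos (2 * pi * x - pi * a) - cos (pi * a)) / 2.

Lemma arc_fun_itv a x : -1 <= arc_fun a x <= 1.
Proof.
rewrite /arc_fun; have := cos_le1 (2 * pi * x - pi * a).
have := cos_geN1 (2 * pi * x - pi * a).
by have := cos_le1 (pi * a); have := cos_geN1 (pi * a); lra.
Qed.

Lemma arc_fun_gt0 a x : 0 < a <= 1 -> 0 <= x < 1 ->
  (0 < arc_fun a x) = (0 < x < a).
Proof.
move=> /andP[a0 a1] /andP[x0 x1]; have pi0 := pi_gt0 R.
have pa0 : 0 < pi * a by rewrite mulr_gt0.
have pa1 : pi * a <= pi by rewrite ger_pMr.
have px1 : pi * x < pi by rewrite gtr_pMr.
have px0 : 0 <= pi * x by rewrite mulr_ge0// ltW.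
have -> : (0 < x < a) = (0 < pi * x < pi * a).
  by rewrite pmulr_rgt0// ltr_pM2l.
rewrite /arc_fun pmulr_lgt0 ?invr_gt0// subr_gt0.
have -> : 2 * pi * x = 2 * (pi * x) by rewrite mulrA.
move: (pi * a) (pi * x) pa0 pa1 px1 px0 => A X A0 A1 X1 X0.
have cos_lt (y z : R) : 0 <= y -> y <= pi -> 0 <= z -> z <= pi ->
    (cos y < cos z) = (z < y).
  by move=> ? ? ? ?; rewrite ltr_cos// in_itv /=; apply/andP.
(* The angle [2 X - A] lies between [- A] and [2 pi - A]. Evenness, or evenness combined with a
   shift by [2 pi], brings it into [[0, pi]], where the cosine decreases. *)
have [h|h] := leP (2 * X - A) 0.
  rewrite -[cos (2 * X - A)]cosN cos_lt; [|lra..].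
  by apply/idP/andP => [?|[? ?]]; [split|]; lra.
have [h'|h'] := leP (2 * X - A) pi.
  rewrite cos_lt; [|lra..].
  by apply/idP/andP => [?|[? ?]]; [split|]; lra.
have -> : cos (2 * X - A) = cos (2 * pi - (2 * X - A)).
  rewrite -[LHS]cosN -(cosD2piz _ 1); congr cos; rewrite /=; ring.
rewrite cos_lt; [|lra..].
by apply/idP/andP => [?|[? ?]]; [split|]; lra.
Qed.

End Trigonometry.

Section Trigpoly.
Context {R : realType}.
Implicit Types (f g : vec2 R -> R) (t : vec2 R) (k : int * int).

Definition phase k t : R := k.1%:~R * t.1 + k.2%:~R * t.2.

Lemma phaseD k s t : phase k (s + t) = phase k s + phase k t.
Proof. by rewrite /phase /= !mulrDr addrACA. Qed.

Lemma phase_int k n : phase k (intpoint n) = (k.1 * n.1 + k.2 * n.2)%:~R.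
Proof. by rewrite /phase /= intrD !intrM. Qed.

Lemma phase0 t : phase (0, 0) t = 0.
Proof. by rewrite /phase !mul0r addr0. Qed.

(* With a phase [theta] cosines suffice, and they are closed under products. *)
Inductive trigpoly : (vec2 R -> R) -> Prop :=
| trig_cos k theta : trigpoly (fun t => cos (2 * pi * phase k t + theta))
| trig_add f g : trigpoly f -> trigpoly g -> trigpoly (fun t => f t + g t)
| trig_scale c f : trigpoly f -> trigpoly (fun t => c * f t).

Lemma trig_ext f g : f =1 g -> trigpoly f -> trigpoly g.
Proof. by move=> /funext ->. Qed.

Lemma trig_cst c : trigpoly (fun=> c).
Proof.
apply: trig_ext (trig_scale c (trig_cos (0, 0) 0)) => t.
by rewrite phase0 mulr0 add0r cos0 mulr1.
Qed.

Lemma trig_mul f g : trigpoly f -> trigpoly g -> trigpoly (fun t => f t * g t).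
Proof.
move=> tf; elim: tf g => {f}[k th|f f' _ IHf _ IHf'|c f _ IHf] g tg.
- elim: tg => {g}[l th'|g g' _ IHg _ IHg'|c g _ IHg].
  + apply: trig_ext (trig_scale 2^-1 (trig_add
      (trig_cos (k.1 + l.1, k.2 + l.2) (th + th'))
      (trig_cos (k.1 - l.1, k.2 - l.2) (th - th')))) => t.
    have -> : 2 * pi * phase (k.1 + l.1, k.2 + l.2) t + (th + th') =
      (2 * pi * phase k t + th) + (2 * pi * phase l t + th').
      by rewrite /phase /= !intrD; ring.
    have -> : 2 * pi * phase (k.1 - l.1, k.2 - l.2) t + (th - th') =
      (2 * pi * phase k t + th) - (2 * pi * phase l t + th').
      by rewrite /phase /= !intrB; ring.
    by rewrite cosD cosB; field.
  + by apply: trig_ext (trig_add IHg IHg') => t; rewrite [RHS]mulrDr.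
  + by apply: trig_ext (trig_scale c IHg) => t; rewrite [LHS]mulrCA.
- by apply: trig_ext (trig_add (IHf g tg) (IHf' g tg)) => t; rewrite [RHS]mulrDl.
- by apply: trig_ext (trig_scale c (IHf g tg)) => t; rewrite [LHS]mulrA.
Qed.

Lemma trig_exp n f : trigpoly f -> trigpoly (fun t => f t ^+ n).
Proof.
move=> tf; elim: n => [|n IH]; first exact: trig_cst.
by apply: trig_ext (trig_mul tf IH) => t; rewrite exprS.
Qed.

Lemma trig_onem f : trigpoly f -> trigpoly (fun t => 1 - f t).
Proof.
move=> tf; apply: trig_ext (trig_add (trig_cst 1) (trig_scale (-1) tf)) => t.
by rewrite mulN1r.
Qed.

Lemma trig_step_poly n f : trigpoly f -> trigpoly (fun t => step_poly n (f t)).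
Proof.
move=> tf; apply: trig_mul; last by apply/trig_onem/trig_exp/trig_onem/trig_exp.
apply/trig_exp/trig_onem/trig_exp.
by apply: trig_ext (trig_scale 2^-1 (trig_onem tf)) => t; rewrite mulrC.
Qed.

Lemma trig_arc k a : trigpoly (fun t => arc_fun a (phase k t)).
Proof.
apply: trig_ext (trig_scale 2^-1 (trig_add (trig_cos k (- (pi * a)))
   (trig_cst (- cos (pi * a))))) => t.
by rewrite /arc_fun mulrC.
Qed.

Lemma trig_cos_integrable k theta :
  torus_integrable (fun t => cos (2 * pi * phase k t + theta)).
Proof.
apply: (@torus_integrable_bounded _ _ 1).
- have mcos : measurable_fun setT (@cos R).
    by apply: continuous_measurable_fun; exact: continuous_cos.
  apply: (measurableT_comp mcos).
  apply: measurable_funD => //; apply: measurable_funM => //.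
  by apply: measurable_funD; apply: measurable_funM => //.
- move=> n t; rewrite phaseD phase_int mulrDr addrAC.
  exact: cosD2piz.
- by move=> t; rewrite ler_norml cos_geN1 cos_le1.
Qed.

Lemma trig_integrable f : trigpoly f -> torus_integrable f.
Proof.
elim=> [k th|g h _ ? _ ?|c g _ ?]; first exact: trig_cos_integrable.
- exact: torus_integrableD.
- exact: torus_integrableZ.
Qed.

Local Notation intQ f := (\int[leb2]_(x in unit_square) f x)%R.

Lemma Rintegral_unit_cst (c : R) : intQ (fun=> c) = c.
Proof.
rewrite Rintegral_cst; last exact: measurable_unit_square.
by rewrite [X in fine X]leb2_unit_square mulr1.
Qed.

(* A translation by [s] with [phase k s = 1/2] changes the sign. *)
Lemma trig_cos_mean0 k theta : k != (0, 0) ->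
  intQ (fun t => cos (2 * pi * phase k t + theta)) = 0.
Proof.
move=> k0; set f := fun t => _.
have [mf pf intf] := trig_cos_integrable k theta.
have [s sk] : exists s, phase k s = 2^-1.
  have [k10|k1] := eqVneq k.1 0; last first.
    exists ((2 * k.1%:~R)^-1, 0); rewrite /phase /= mulr0 addr0 invfM mulrCA mulfV ?mulr1//.
    by rewrite intr_eq0.
  have k2 : k.2 != 0 by apply: contra k0 => /eqP k20; rewrite [k]surjective_pairing k10 k20.
  exists (0, (2 * k.2%:~R)^-1); rewrite /phase /= mulr0 add0r invfM mulrCA mulfV ?mulr1//.
  by rewrite intr_eq0.
have fs t : f (t + s) = - f t.
  rewrite /f phaseD sk mulrDr addrAC cosD.
  by rewrite (_ : 2 * pi * 2^-1 = pi :> R); [rewrite cospi sinpi; ring|field].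
have int1 := trig_integrable (trig_cst 1).
have [m1 _ i1] := torus_integrableD int1 (trig_cos_integrable k theta).
have [_ _ i2] := torus_integrableD int1 (torus_integrableZ (-1) (trig_cos_integrable k theta)).
have mQ := @measurable_unit_square R.
have f1 t : `|f t| <= 1 by rewrite ler_norml cos_geN1 cos_le1.
(* Translation invariance was proved for nonnegative integrands, hence the constant 1: [1 - f] is a
   translate of [1 + f]. *)
have : intQ (fun t => 1 + - 1 * f t) = intQ (fun t => 1 + f t).
  rewrite /Rintegral; congr fine.
  rewrite -(ge0_integral_shift_square (f := fun t => (1 + f t)%:E) s).
  - by apply: eq_integral => t _; rewrite fs mulN1r.
  - exact/measurable_EFinP.
  - by move=> t; rewrite lee_fin; have := f1 t; rewrite ler_norml; lra.
  - by move=> n t; rewrite /= /f pf.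
have [_ _ i0] := int1.
rewrite (RintegralD mQ i0 intf) (RintegralD mQ i0); last first.
  by have [] := torus_integrableZ (-1) (trig_cos_integrable k theta).
rewrite RintegralZl//= -/f; lra.
Qed.

Section Averages.
Variable L : 'M[R]_2.
Hypothesis Lfree : forall k, k != (0, 0) ->
  forall m, act L^T (intpoint k) <> intpoint m.

Lemma phase_act k t : phase k (act L t) =
  (act L^T (intpoint k)).1 * t.1 + (act L^T (intpoint k)).2 * t.2.
Proof. by rewrite !actE /lin2 /phase /= !mxE; ring. Qed.

(** Along the box the phase advances with the two frequencies [p = L^T k]. As [p] is not integral,
    one of its coordinates is not an integer; summing first in that direction gives a bounded
    quantity. The other direction contributes at most [2 N + 1] such terms, which is negligible
    against the [(2 N + 1)^2] points of the box. *)
Lemma trig_cos_avg0 k theta t : k != (0, 0) ->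
  box_avg L N (fun t => cos (2 * pi * phase k t + theta)) t @[N --> \oo] --> (0 : R).
Proof.
move=> k0; set f := fun t => _; set p := act L^T (intpoint k).
have bnd : exists2 C : R, 0 <= C & forall N,
    `|\sum_(m <- boxseq N) f (t + act L (intpoint m))| <= (2 * N + 1)%:R * C.
  have fE m : f (t + act L (intpoint m)) =
      cos (2 * pi * phase k t + theta + 2 * pi * (p.1 * m.1%:~R) + 2 * pi * (p.2 * m.2%:~R)).
    rewrite /f phaseD phase_act /=; congr cos; rewrite -/p; ring.
  have sz N : (\sum_(i <- iota 0 (2 * N + 1)) 1 = (2 * N + 1)%:R :> R).
    by rewrite big_const_seq count_predT size_iota iter_addr_0.
  have arith N : \sum_(m <- boxseq N) f (t + act L (intpoint m)) =
    \sum_(i <- iota 0 (2 * N + 1)) \sum_(j <- iota 0 (2 * N + 1))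
      cos (2 * pi * phase k t + theta - N%:R * (2 * pi * p.1) - N%:R * (2 * pi * p.2)
        + i%:R * (2 * pi * p.1) + j%:R * (2 * pi * p.2)).
    rewrite big_allpairs_dep; apply: eq_bigr => i _; apply: eq_bigr => j _.
    by rewrite fE /= !intrB; congr cos; rewrite -!pmulrn; ring.
  have [s1|s1] := eqVneq (sin (pi * p.1)) 0; last first.
    exists (`|sin (pi * p.1)|^-1); first by rewrite invr_ge0.
    move=> N; rewrite arith exchange_big /= -sz mulr_suml.
    apply: le_trans (ler_norm_sum _ _ _) _; apply: ler_sum => j _; rewrite mul1r.
    rewrite (eq_bigr (fun i => cos (2 * pi * phase k t + theta - N%:R * (2 * pi * p.1)
       - N%:R * (2 * pi * p.2) + j%:R * (2 * pi * p.2) + i%:R * (2 * pi * p.1)))).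
      have e : 2 * pi * p.1 / 2 = pi * p.1 by field.
      by rewrite -e; apply: sum_cos_bound; rewrite e.
    by move=> i _; rewrite addrAC.
  have [s2|s2] := eqVneq (sin (pi * p.2)) 0; last first.
    exists (`|sin (pi * p.2)|^-1); first by rewrite invr_ge0.
    move=> N; rewrite arith -sz mulr_suml.
    apply: le_trans (ler_norm_sum _ _ _) _; apply: ler_sum => j _; rewrite mul1r.
    have e : 2 * pi * p.2 / 2 = pi * p.2 by field.
    by rewrite -e; apply: sum_cos_bound; rewrite e.
  (* Both sines vanish only when both frequencies are integers, which [Lfree] excludes. *)
  have [m1 e1] := sin_pi_eq0 s1; have [m2 e2] := sin_pi_eq0 s2.
  by case: (Lfree k0 (m := (m1, m2))); rewrite -/p [LHS]surjective_pairing e1 e2.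
have [C C0 HC] := bnd.
apply/norm_cvg0P.
apply: (squeeze_cvgr (f := fun=> 0) (h := fun n => C * n.+1%:R^-1)).
- apply: nearW => N; rewrite normr_ge0 /= /box_avg normrM ger0_norm ?invr_ge0//.
  rewrite ler_pdivrMl ?ltr0n ?expn_gt0 ?addn_gt0 ?orbT//.
  apply: le_trans (HC N) _; rewrite -mulnn natrM -mulrA ler_wpM2l//.
  rewrite mulrCA ler_peMr// ler_pdivlMr// mul1r ler_nat; lia.
- exact: cvg_cst.
- rewrite -[X in _ --> X](mulr0 C); apply: cvgMl_tmp; exact: cvg_harmonic.
Qed.

Lemma trig_avg f : trigpoly f -> forall t, box_avg L N f t @[N --> \oo] --> intQ f.
Proof.
elim=> {f}[k th|f g tf IHf tg IHg|c f tf IHf] t.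
- have [->|k0] := eqVneq k (0, 0); last by rewrite trig_cos_mean0//; exact: trig_cos_avg0.
  have -> : (fun t => cos (2 * pi * phase (0, 0) t + th)) = fun=> cos th.
    by apply/funext => s; rewrite phase0 mulr0 add0r.
  rewrite Rintegral_unit_cst (_ : (fun N => _) = fun=> cos th); first exact: cvg_cst.
  apply/funext => N; rewrite /box_avg big_const_seq count_predT size_boxseq iter_addr_0.
  by rewrite -[cos th *+ _]mulr_natl mulKf// pnatr_eq0 expn_eq0 addn1.
- have [_ _ i1] := trig_integrable tf; have [_ _ i2] := trig_integrable tg.
  rewrite RintegralD//; last exact: measurable_unit_square.
  by under eq_fun do rewrite box_avgD; apply: cvgD.
- have [_ _ i1] := trig_integrable tf.
  rewrite RintegralZl//; last exact: measurable_unit_square.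
  by under eq_fun do rewrite box_avgZ; apply: cvgMl_tmp.
Qed.

End Averages.

End Trigpoly.

(** * The ergodic theorem on the torus *)

Section Density.
Context {R : realType} (L : 'M[R]_2).
Hypothesis Lfree : forall k : int * int, k != (0, 0) ->
  forall m, act L^T (intpoint k) <> intpoint m.
Implicit Types (f g : vec2 R -> R) (t : vec2 R).

Lemma avg_converges_trig f : trigpoly f -> avg_converges L f.
Proof. by move=> tf; apply: aeW => t; exact: trig_avg. Qed.

(** On a space of finite measure, bounded pointwise limits are limits in L^1, so
    [avg_converges_closed] applies. *)
Lemma avg_converges_dominated f (g : nat -> vec2 R -> R) :
  measurable_fun setT f -> zperiodic f -> (forall t, `|f t| <= 1) ->
  (forall n, torus_integrable (g n)) -> (forall n t, `|g n t| <= 1) ->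
  (forall n, avg_converges L (g n)) ->
  (forall t, g n t @[n --> \oo] --> f t) -> avg_converges L f.
Proof.
move=> mf pf f1 tg g1 cg gf.
have mQ := @measurable_unit_square R.
apply: avg_converges_closed; first exact: (torus_integrable_bounded mf pf f1).
move=> e e0.
have [] := @dominated_convergence _ _ _ leb2 unit_square mQ
  (fun n => EFin \o g n) (EFin \o f) (EFin \o cst (1 : R)).
- by move=> n; apply/measurable_EFinP/measurable_funTS; case: (tg n).
- by apply/measurable_EFinP; exact: measurable_funTS.
- by apply: aeW => t _; apply: cvg_EFin; [exact: nearW|exact: gf].
- apply: (@bounded_integrable _ _ _ _ _ _ 1) => //; first exact: leb2_unit_square_lty.
  by move=> x _; rewrite /= normr1.
- by apply: aeW => t n _; rewrite /= lee_fin.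
move=> _ cvI _.
have /fine_cvgP[_] := cvI; move/cvgrPdist_le => /(_ e e0) [N _ HN].
exists (g N); split=> //.
have := HN N (leqnn N); rewrite /= sub0r normrN => h.
have [mg pg ig] := tg N.
have ifg : leb2.-integrable unit_square (EFin \o (fun t => `|f t - g N t|)).
  apply: (@bounded_integrable _ _ _ _ _ _ 2) => //; first exact: leb2_unit_square_lty.
    by apply: measurable_funTS; apply: measurableT_comp => //; exact: measurable_funB.
  move=> t _; rewrite normr_id; apply: le_trans (ler_normB _ _) _.
  by have := f1 t; have := g1 N t; lra.
rewrite -(fineK (integrable_fin_num mQ ifg)) lee_fin.
apply: le_trans h; rewrite ger0_norm.
  rewrite le_eqVlt; apply/orP; left; apply/eqP; congr fine.
  by apply: eq_integral => t _ /=; rewrite distrC.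
by apply: fine_ge0; apply: integral_ge0.
Qed.

(* Only the open square can be cut out by strict inequalities between
   trigonometric polynomials; its boundary is negligible. *)
Definition open_unit_square : set (vec2 R) :=
  [set t | 0 < t.1 < 1 /\ 0 < t.2 < 1].

Lemma measurable_open_unit_square : measurable open_unit_square.
Proof.
rewrite (_ : open_unit_square = [set` `]0, 1[%R] `*` [set` `]0, 1[%R]).
  by apply: measurableX; exact: measurable_itv.
by apply/seteqP; split=> -[x y] /=; rewrite !in_itv.
Qed.

Definition torus_indic (X : set (vec2 R)) t : R :=
  \1_(X `&` open_unit_square) (wrap2 t).

Lemma torus_indicE X t : torus_indic X t = \1_X (wrap2 t) * torus_indic setT t.
Proof. by rewrite /torus_indic setTI indicI. Qed.

Lemma indic_wrap2_integrable X : measurable X ->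
  torus_integrable (fun t => \1_X (wrap2 t) : R).
Proof.
move=> mX; apply: (@torus_integrable_bounded _ _ 1).
- have m1 : measurable_fun setT (\1_X : vec2 R -> R) by exact: measurable_indic.
  exact: (measurableT_comp m1 measurable_wrap2).
- by move=> n t; rewrite wrap2D.
- by move=> t; rewrite indicE; case: (_ \in _); rewrite ?normr1 ?normr0.
Qed.

Lemma torus_indic_integrable X : measurable X -> torus_integrable (torus_indic X).
Proof.
move=> mX; apply: indic_wrap2_integrable; apply: measurableI => //.
exact: measurable_open_unit_square.
Qed.

(** A family stable under intersection that generates the Borel sets, and whose indicators are
    products of step functions in one variable. *)
Definition quadrant (a b : R) : set (vec2 R) := [set t | t.1 < a /\ t.2 < b].

(** In the open square a quadrant is the set where two arc functions, one for each coordinate, are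
    positive. Composing them with [step_poly] gives trigonometric polynomials that converge to the
    indicator at every point. *)
Lemma avg_converges_quadrant a b : avg_converges L (torus_indic (quadrant a b)).
Proof.
have mq : measurable (quadrant a b).
  rewrite (_ : quadrant a b = [set` `]-oo, a[%R] `*` [set` `]-oo, b[%R]).
    by apply: measurableX; exact: measurable_itv.
  by apply/seteqP; split=> -[x y] /=; rewrite !in_itv.
have [ab|] := boolP ((0 < a) && (0 < b)); last first.
  move=> nab; rewrite (_ : torus_indic _ = fun=> 0); first exact/avg_converges_trig/trig_cst.
  apply/funext => t; rewrite /torus_indic indicE memNset// => -[[/= h1 h2] [/andP[h3 _] /andP[h4 _]]].
  by case/negP: nab; rewrite (lt_trans h3 h1) (lt_trans h4 h2).
have /andP[a0 b0] := ab.
(* Arcs have length at most 1; inside the open square the truncation changes nothing. *)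
pose a' := Num.min a 1; pose b' := Num.min b 1.
have a'1 : 0 < a' <= 1 by rewrite lt_min a0 ltr01 ge_min lexx orbT.
have b'1 : 0 < b' <= 1 by rewrite lt_min b0 ltr01 ge_min lexx orbT.
pose e1 : int * int := (1, 0); pose e2 : int * int := (0, 1).
pose g n t := step_poly n (arc_fun a' (phase e1 t)) * step_poly n (arc_fun b' (phase e2 t)).
have tg n : trigpoly (g n) by apply: trig_mul; exact/trig_step_poly/trig_arc.
have [mf pf _] := torus_indic_integrable mq.
apply: (@avg_converges_dominated _ g) => //.
- by move=> t; rewrite /torus_indic indicE; case: (_ \in _); rewrite ?normr1 ?normr0.
- by move=> n; exact: trig_integrable.
- move=> n t; rewrite /g.
  have /andP[p0 p1] := step_poly_itv n (arc_fun_itv a' (phase e1 t)).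
  have /andP[q0 q1] := step_poly_itv n (arc_fun_itv b' (phase e2 t)).
  by rewrite ger0_norm; [exact: mulr_ile1|exact: mulr_ge0].
- by move=> n; exact: avg_converges_trig.
- move=> t.
  have -> : torus_indic (quadrant a b) t = (0 < arc_fun a' (phase e1 t))%R%:R *
      (0 < arc_fun b' (phase e2 t))%R%:R.
    have arcw c (k : int * int) : arc_fun c (phase k t) = arc_fun c (phase k (wrap2 t)).
      rewrite wrap2E phaseD phase_int /arc_fun.
      move: (phase k t) (_ + _ : int) => p z.
      have -> : 2 * pi * (p + z%:~R) - pi * c = 2 * pi * p - pi * c + 2 * pi * z%:~R.
        by ring.
      by rewrite cosD2piz.
    have [/= w1 w2] := wrap2_square t.
    rewrite /unit_itv /= !in_itv /= in w1 w2.
    rewrite !arcw /phase /= !mul1r !mul0r addr0 add0r.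
    rewrite !arc_fun_gt0// -natrM mulnb /torus_indic indicE; congr ((_ : bool)%:R).
    rewrite /a' /b' !lt_min.
    move/andP: w1 => [_ ->]; move/andP: w2 => [_ ->]; rewrite !andbT.
    apply/idP/idP; rewrite inE /=.
      by move=> [[/= -> ->] [/andP[-> _] /andP[-> _]]].
    move=> /andP[/andP[u1 u2] /andP[u3 u4]]; split; split=> //=; apply/andP; split=> //.
    + by have := fracpart_itv t.1; rewrite /unit_itv /= in_itv => /andP[].
    + by have := fracpart_itv t.2; rewrite /unit_itv /= in_itv => /andP[].
  by apply: cvgM; apply: cvg_step_poly; exact: arc_fun_itv.
Qed.

Definition quadrants : set (set (vec2 R)) :=
  [set X | exists a b, X = quadrant a b].

Lemma measurable_quadrants : @measurable _ (vec2 R) = <<s quadrants >>.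
Proof.
apply/seteqP; split; last first.
  apply: smallest_sub; first exact: sigma_algebra_measurable.
  move=> _ [a [b ->]].
  rewrite (_ : quadrant a b = [set` `]-oo, a[%R] `*` [set` `]-oo, b[%R]).
    by apply: measurableX; exact: measurable_itv.
  by apply/seteqP; split=> -[x y] /=; rewrite !in_itv.
have m1 : @measurable_fun _ _ (g_sigma_algebraType quadrants) (measurableTypeR R) setT
    (fun t : vec2 R => t.1).
  apply: (measurability _ (RGenInftyO.measurableE R)) => _ [_ [a ->] <-].
  rewrite (_ : _ `&` _ = \bigcup_n quadrant a n%:R).
    by apply: bigcup_measurable => n _; apply: sub_gen_smallest; exists a, n%:R.
  apply/seteqP; split=> t.
    move=> [_ /=]; rewrite in_itv /= => ta.
    exists (Num.bound `|t.2|) => //; split=> //=.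
    by apply: le_lt_trans (ler_norm _) _; apply: archi_boundP.
  by move=> [n _ [/= ta _]]; split=> //=; rewrite in_itv.
have m2 : @measurable_fun _ _ (g_sigma_algebraType quadrants) (measurableTypeR R) setT
    (fun t : vec2 R => t.2).
  apply: (measurability _ (RGenInftyO.measurableE R)) => _ [_ [a ->] <-].
  rewrite (_ : _ `&` _ = \bigcup_n quadrant n%:R a).
    by apply: bigcup_measurable => n _; apply: sub_gen_smallest; exists n%:R, a.
  apply/seteqP; split=> t.
    move=> [_ /=]; rewrite in_itv /= => ta.
    exists (Num.bound `|t.1|) => //; split=> //=.
    by apply: le_lt_trans (ler_norm _) _; apply: archi_boundP.
  by move=> [n _ [/= _ ta]]; split=> //=; rewrite in_itv.
rewrite measurable_prod_measurableType; apply: smallest_sub.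
  exact: smallest_sigma_algebra.
move=> _ [X mX [Y mY <-]].
have -> : X `*` Y = (setT `&` (fun t : vec2 R => t.1) @^-1` X) `&`
    (setT `&` (fun t : vec2 R => t.2) @^-1` Y) by rewrite !setTI.
by apply: (@measurableI _ (g_sigma_algebraType quadrants)); [exact: m1|exact: m2].
Qed.

(** Dynkin induction from the quadrants. Complements are differences from the whole open square,
    which is cut out by the quadrant at [(1, 1)]; countable disjoint unions are bounded pointwise
    limits of finite sums. *)
Lemma avg_converges_torus_indic X : measurable X -> avg_converges L (torus_indic X).
Proof.
move=> mX; have : <<s quadrants >> X by rewrite -measurable_quadrants.
have cT : avg_converges L (torus_indic setT).
  rewrite (_ : torus_indic setT = torus_indic (quadrant 1 1)).
    exact: avg_converges_quadrant.
  apply/funext => t; rewrite /torus_indic setTI; congr (\1_ _ _).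
  apply/seteqP; split=> s; last by case.
  by move=> [/andP[s0 s1] /andP[s2 s3]]; split=> //; split; rewrite /= ?s0 ?s1 ?s2 ?s3.
move: X {mX}; apply: (@dynkin_induction _ (vec2 R) quadrants
  (fun X => avg_converges L (torus_indic X))).
- exact: measurable_quadrants.
- move=> _ _ [a [b ->]] [c [d ->]]; exists (Num.min a c), (Num.min b d).
  apply/seteqP; split=> t /=; rewrite /quadrant /= !lt_min.
    by move=> [[-> ->] [-> ->]].
  by move=> [/andP[-> ->] /andP[-> ->]].
- exact: cT.
- by move=> _ [a [b ->]]; exact: avg_converges_quadrant.
- move=> X mX cX.
  rewrite (_ : torus_indic _ = fun t => torus_indic setT t + (-1) * torus_indic X t).
    apply: avg_convergesD => //.
    + exact: torus_indic_integrable.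
    + exact/torus_integrableZ/torus_indic_integrable.
    + by apply: avg_convergesZ => //; exact: torus_indic_integrable.
  apply/funext => t; rewrite (torus_indicE X) (torus_indicE (~` X)).
  by rewrite [\1_X _]indicE [\1_(~` X) _]indicE in_setC; case: (_ \in X) => /=; ring.
- move=> F mF tF cF.
  pose g n := torus_indic (\big[setU/set0]_(i < n) F i).
  have mU n : measurable (\big[setU/set0]_(i < n) F i).
    exact: bigsetU_measurable.
  have [mf pf _] := torus_indic_integrable (bigcupT_measurable _ mF).
  have b1 X t : `|torus_indic X t| <= 1.
    by rewrite /torus_indic indicE; case: (_ \in _); rewrite ?normr1 ?normr0.
  apply: (@avg_converges_dominated _ g) => //.
  + by move=> n; exact: torus_indic_integrable.
  + by move=> n t; exact: b1.
  + elim=> [|n IHn].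
      rewrite /g big_ord0 (_ : torus_indic _ = fun=> 0).
        exact/avg_converges_trig/trig_cst.
      by apply/funext => t; rewrite /torus_indic set0I indic0.
    rewrite (_ : g n.+1 = fun t => g n t + torus_indic (F n) t).
      by apply: avg_convergesD => //; exact: torus_indic_integrable.
    apply/funext => t; rewrite /g big_ord_recr /= (torus_indicE (_ `|` _)).
    rewrite (torus_indicE (\big[_/_]_(_ < _) _)) (torus_indicE (F n)) -mulrDl.
    congr (_ * _); set w := wrap2 t; rewrite !indicE in_setU.
    have [Fn|_] := boolP (w \in F n); last by rewrite orbF addr0.
    rewrite orbT memNset ?add0r// -bigcup_mkord => -[i /= ni Fi].
    have : i = n by apply: (tF i n) => //; exists w; split=> //; exact: set_mem.
    by move=> e; rewrite e ltnn in ni.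
  + move=> t; have [[k _ Fk]|nF] := pselect ((\bigcup_k F k) (wrap2 t)).
      apply: cvg_near_cst; exists k.+1 => // n /= kn.
      rewrite /g torus_indicE [RHS]torus_indicE; congr (_ * _).
      rewrite !indicE !mem_set//; first by exists k.
      by rewrite -bigcup_mkord; exists k.
    rewrite (_ : (fun n => _) = fun=> torus_indic (\bigcup_k F k) t); first exact: cvg_cst.
    apply/funext => n; rewrite /g torus_indicE [RHS]torus_indicE; congr (_ * _).
    rewrite !indicE !memNset// -bigcup_mkord => -[k _ Fk].
    by apply: nF; exists k.
Qed.

Lemma leb2_square_boundary : leb2 (unit_square `\` open_unit_square) = 0%E.
Proof.
have mo := measurable_open_unit_square.
have o1 : leb2 open_unit_square = 1%E.
  rewrite (_ : open_unit_square = [set` `]0, 1[%R] `*` [set` `]0, 1[%R]).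
    have mi : measurable ([set` `]0, 1[%R] : set (measurableTypeR R)) by exact: measurable_itv.
    by rewrite leb2_setX// !lebesgue_measure_itv /= lte_fin ltr01 oppr0 adde0 mul1e.
  by apply/seteqP; split=> -[x y] /=; rewrite !in_itv.
have sub : open_unit_square `<=` unit_square.
  move=> [x y] [/= /andP[x0 x1] /andP[y0 y1]].
  by split; rewrite /unit_itv /= in_itv /= ?x1 ?y1 andbT ltW.
rewrite measureD//; last 2 first.
- exact: measurable_unit_square.
- by rewrite leb2_unit_square_lty.
rewrite setIidr// [X in (X - _)%E]leb2_unit_square [X in (_ - X)%E]o1.
by rewrite subee.
Qed.

Lemma avg_converges_indic X : measurable X -> avg_converges L (fun t => \1_X (wrap2 t)).
Proof.
move=> mX; have mo := measurable_open_unit_square.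
have mQ := @measurable_unit_square R.
have tX := indic_wrap2_integrable mX.
apply: avg_converges_closed => // e e0; exists (torus_indic X); split.
- exact: torus_indic_integrable.
- exact: avg_converges_torus_indic.
- apply: le_trans (_ : 0 <= _)%E; last by rewrite lee_fin ltW.
  rewrite -leb2_square_boundary.
  have mB : measurable (unit_square `\` open_unit_square : set (vec2 R)) by exact: measurableD.
  apply: le_trans (_ : \int[leb2]_(t in unit_square) (\1_(unit_square `\` open_unit_square) t)%:E <= _)%E.
    apply: ge0_le_integral => //.
    + apply/measurable_EFinP/measurable_funTS; apply: measurableT_comp => //.
      apply: measurable_funB; first by have [] := tX.
      by have [] := torus_indic_integrable mX.
    + by apply/measurable_EFinP/measurable_funTS; exact: measurable_indic.
    + move=> t Qt; rewrite lee_fin torus_indicE /torus_indic setTI wrap2_id//.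
      rewrite !indicE; case: (t \in X); rewrite ?mul1r ?mul0r ?subr0 ?normr0//.
      case: (boolP (t \in open_unit_square)) => h; first by rewrite subrr normr0.
      rewrite subr0 normr1 mem_set//; split=> //.
      by rewrite notin_setE in h.
  rewrite integral_indic//; apply: le_measure; rewrite ?inE//.
  exact: measurableI.
Qed.

Lemma avg_converges_sum (I : Type) (s : seq I) (F : I -> vec2 R -> R) :
  (forall i, torus_integrable (F i)) -> (forall i, avg_converges L (F i)) ->
  torus_integrable (fun t => \sum_(i <- s) F i t) /\
  avg_converges L (fun t => \sum_(i <- s) F i t).
Proof.
move=> tF cF; elim: s => [|i s [IHt IHc]].
  under eq_fun do rewrite big_nil.
  split; first exact/trig_integrable/trig_cst.
  exact/avg_converges_trig/trig_cst.
under eq_fun do rewrite big_cons.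
by split; [exact: torus_integrableD|exact: avg_convergesD].
Qed.

Import HBSimple.

(** Simple functions are dense in L^1 of the square; composed with [wrap2] they become finite
    combinations of periodic indicators, for which convergence is known. *)
Theorem ergodic_torus f : torus_integrable f -> avg_converges L f.
Proof.
move=> tf; have [mf pf intf] := tf.
have mQ := @measurable_unit_square R.
apply: avg_converges_closed => // e e0.
have [g_ [ig _ cg]] := approximation_sfun_integrable mQ intf.
have /fine_cvgP[nfin] := cg; move/cvgrPdist_le => /(_ e e0) ng.
have [N [Nfin HN]] : exists N,
    (\int[leb2]_(z in unit_square) `|(EFin \o f) z - (g_ N z)%:E|)%E \is a fin_num /\
    `|0 - fine (\int[leb2]_(z in unit_square) `|(EFin \o f) z - (g_ N z)%:E|)%E| <= e.
  have [N1 _ H1] := nfin; have [N2 _ H2] := ng.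
  exists (maxn N1 N2); split; first exact: (H1 _ (leq_maxl _ _)).
  exact: (H2 _ (leq_maxr _ _)).
pose g := g_ N; pose gs t : R := \sum_(y <- finmap.enum_fset (fset_set (range g))) y * \1_(g @^-1` [set y]) (wrap2 t).
have gsE t : gs t = g (wrap2 t) by rewrite fimfunE fsbig_finite.
have mg y : measurable (g @^-1` [set y]) by [].
have ti y := indic_wrap2_integrable (mg y).
have [tg cgs] := @avg_converges_sum _ (finmap.enum_fset (fset_set (range g)))
  (fun y t => y * \1_(g @^-1` [set y]) (wrap2 t))
  (fun y => torus_integrableZ y (ti y))
  (fun y => avg_convergesZ y (ti y) (avg_converges_indic (mg y))).
exists gs; split=> //.
rewrite (_ : (\int[leb2]_(t in unit_square) _)%E =
  (\int[leb2]_(z in unit_square) `|(EFin \o f) z - (g_ N z)%:E|)%E); last first.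
  apply: eq_integral => t; rewrite inE => Qt.
  by rewrite gsE wrap2_id.
rewrite -(fineK Nfin) lee_fin; apply: le_trans HN.
by rewrite sub0r normrN ler_norm.
Qed.

End Density.

(** * Measurable versions *)

Section AeIntegral.
Local Open Scope ereal_scope.
Context {R : realType} d (T : measurableType d) (mu : {measure set T -> \bar R}).
Implicit Types (D : set T) (f g : T -> \bar R).

Import HBNNSimple.

(* The integral of a nonmeasurable function is a lower integral, hence it
   is still insensitive to null sets. *)
Lemma ge0_integral_ae D f g : measurable D -> measurable_fun D g ->
  (forall x, 0 <= f x) -> (forall x, 0 <= g x) -> f = g %[ae mu in D] ->
  \int[mu]_(x in D) f x = \int[mu]_(x in D) g x.
Proof.
move=> mD mg f0 g0 [N [mN N0 fgN]].
have mgD : measurable_fun setT (g \_ D) by exact/(measurable_restrictT _ mD).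
have fD0 x : 0 <= (f \_ D) x by rewrite patchE; case: ifPn.
have gD0 x : 0 <= (g \_ D) x by rewrite patchE; case: ifPn.
have fg x : ~ N x -> (f \_ D) x = (g \_ D) x.
  move=> nN; rewrite !patchE; case: ifPn => // xD; rewrite inE in xD.
  by apply: contrapT => ne; apply/nN/fgN => /= /(_ xD).
rewrite integral_mkcond [RHS]integral_mkcond.
apply/eqP; rewrite eq_le; apply/andP; split.
  rewrite [leLHS]ge0_integralTE//; apply: ge_ereal_sup => _ [h /= hf <-].
  rewrite -integralT_nnsfun; apply: ae_ge0_le_integral => //.
  - by move=> x _; rewrite lee_fin.
  - by apply/measurable_EFinP.
  - exists N; split=> // x /= nle; apply: contrapT => nN; apply: nle => _.
    by rewrite -fg.
have -> : \int[mu]_x (g \_ D) x = \int[mu]_x ((g \_ D) \_ (~` N)) x.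
  rewrite -[RHS]integral_mkcond (ge0_negligible_integral mN)//.
  by rewrite setTD.
rewrite !ge0_integralTE//; last first.
  by move=> x; rewrite patchE; case: ifPn.
apply: le_ereal_sup => _ [h /= hg <-]; exists h => //= x.
apply: le_trans (hg x) _; rewrite patchE; case: ifPn => [|//].
by rewrite inE => /fg ->.
Qed.

Lemma integral_ae D f g : measurable D -> measurable_fun D g ->
  f = g %[ae mu in D] -> \int[mu]_(x in D) f x = \int[mu]_(x in D) g x.
Proof.
move=> mD mg fg; rewrite integralE [RHS]integralE; congr (_ - _).
- apply: ge0_integral_ae => //; first exact: measurable_funepos.
  by apply: filterS fg => x h Dx; rewrite !funeposE h.
- apply: ge0_integral_ae => //; first exact: measurable_funeneg.
  by apply: filterS fg => x h Dx; rewrite !funenegE h.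
Qed.

End AeIntegral.

Lemma Rintegral_ae {R : realType} d (T : measurableType d)
    (mu : {measure set T -> \bar R}) (D : set T) (f g : T -> R) :
  measurable D -> measurable_fun D g -> f = g %[ae mu in D] ->
  (\int[mu]_(x in D) f x = \int[mu]_(x in D) g x)%R.
Proof.
move=> mD mg fg; rewrite /Rintegral; congr fine; apply: integral_ae => //.
  exact/measurable_EFinP.
by apply: filterS fg => x h Dx; rewrite h.
Qed.

Lemma L1_ae {R : realType} d (T : measurableType d)
    (mu : {measure set T -> \bar R}) (D : set T) (f g : T -> R) :
  f = g %[ae mu in D] -> mu.-integrable D (EFin \o g) -> L1 mu D f.
Proof. by move=> fg ig; exists g. Qed.

Lemma measurable_section_integral {R : realType} d1 d2 (T1 : measurableType d1)
    (T2 : measurableType d2) (m2 : {sigma_finite_measure set T2 -> \bar R})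
    (D : set T2) (F : T1 * T2 -> \bar R) :
  measurable D -> measurable_fun setT F ->
  measurable_fun setT (fun x => \int[m2]_(y in D) F (x, y))%E.
Proof.
move=> mD mF.
have mTD : measurable ([set: T1] `*` D) by exact: measurableX.
have h (G : T1 * T2 -> \bar R) : measurable_fun setT G -> (forall z, 0 <= G z)%E ->
    measurable_fun setT (fun x => \int[m2]_(y in D) G (x, y))%E.
  move=> mG G0.
  rewrite (_ : (fun x => _) = fubini_F m2 (G \_ (setT `*` D))).
    apply: measurable_fun_fubini_tonelli_F.
      by apply/(measurable_restrictT _ mTD); exact: measurable_funTS.
    by move=> x; rewrite patchE; case: ifPn.
  apply/funext => x; rewrite /fubini_F [LHS]integral_mkcond.
  apply: eq_integral => y _; rewrite !patchE; congr (if _ then _ else _).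
  by apply/idP/idP; rewrite !inE; [split|case].
under eq_fun do rewrite integralE.
apply: emeasurable_funB.
- rewrite (_ : (fun x => _) = fun x => (\int[m2]_(y in D) F^\+ (x, y))%E).
    by apply: (h (F^\+)%E) => //; exact: measurable_funepos.
  by apply/funext => x; apply: eq_integral => y _; rewrite !funeposE.
- rewrite (_ : (fun x => _) = fun x => (\int[m2]_(y in D) F^\- (x, y))%E).
    by apply: (h (F^\-)%E) => //; exact: measurable_funeneg.
  by apply/funext => x; apply: eq_integral => y _; rewrite !funenegE.
Qed.

(** Convergence means that the upper limit of [|u n - l|] is at most 0, and an upper limit of
    measurable functions is measurable. *)
Lemma measurable_cvgn {R : realType} d (T : measurableType d)
    (u : nat -> T -> R) (l : T -> R) :
  (forall n, measurable_fun setT (u n)) -> measurable_fun setT l ->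
  measurable [set x | u n x @[n --> \oo] --> l x].
Proof.
move=> mu ml; pose e n x := (`|u n x - l x|)%:E.
have me : measurable_fun setT (fun x => limn_esup (e ^~ x)).
  apply: measurable_fun_limn_esup => n.
  by apply/measurable_EFinP; apply: measurableT_comp => //; exact: measurable_funB.
rewrite (_ : [set x | _] = (fun x => limn_esup (e ^~ x)) @^-1` [set y | (y <= 0)%E]).
  rewrite -[_ @^-1` _]setTI; apply: me => //.
  rewrite (_ : [set y | _] = [set` `]-oo, 0%E]]); first exact: emeasurable_itv.
  by apply/seteqP; split=> y /=; rewrite in_itv.
have e0 x n : (0 <= e n x)%E by rewrite lee_fin.
apply/seteqP; split=> x /=.
- move=> ux; have cv : e n x @[n --> \oo] --> 0%E.
    apply: cvg_EFin; first exact: nearW.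
    by apply/norm_cvg0P; rewrite -(subrr (l x)); apply: cvgB => //; exact: cvg_cst.
  by rewrite is_cvg_limn_esupE ?(cvg_lim _ cv)//; apply/cvg_ex; exists 0%E.
- move=> le0; have /fine_cvgP[_ cv] := limn_esup_le_cvg le0 (e0 x).
  apply/subr_cvg0/norm_cvg0P; exact: cv.
Qed.

(** * Periodic Borel versions and the ergodic theorem on fibres *)

Section PeriodicVersions.
Context {R : realType}.
Implicit Types (f g : vec2 R -> R) (t : vec2 R).

Lemma periodic_version f : zperiodic f -> L1 leb2 unit_square f ->
  exists2 g, torus_integrable g & {ae leb2, forall t, f t = g t}.
Proof.
move=> pf [g ig fg]; have mQ := @measurable_unit_square R.
have mg : measurable_fun unit_square g.
  by apply/measurable_EFinP; exact: measurable_int ig.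
exists (fun t => g (wrap2 t)).
  split.
  - apply: (measurable_comp mQ _ mg) => //; last exact: measurable_wrap2.
    by move=> _ [t _ <-]; exact: wrap2_square.
  - by move=> n t; rewrite wrap2D.
  - by apply: eq_integrable ig => // t; rewrite inE => Qt; rewrite /= wrap2_id.
have := ae_wrap2 fg; apply: filterS => t.
by rewrite zperiodic_wrap2.
Qed.

Lemma eq_box_avg (L : 'M[R]_2) N f g t :
  (forall n, f (t + act L (intpoint n)) = g (t + act L (intpoint n))) ->
  box_avg L N f t = box_avg L N g t.
Proof. by move=> fg; congr (_ * _); apply: eq_bigr => m _. Qed.

Lemma ergodic_periodic (L : 'M[R]_2) f :
  (forall k : int * int, k != (0, 0) -> forall m, act L^T (intpoint k) <> intpoint m) ->
  zperiodic f -> L1 leb2 unit_square f -> avg_converges L f.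
Proof.
move=> Lfree pf f1; have [g tg fg] := periodic_version pf f1.
(* The averages sample [f] on the whole orbit of [t], so that the version has to agree with [f] at
   all points of the orbit; these are countably many. *)
have aeL : {ae leb2, forall t, forall n : int * int,
    f (t + act L (intpoint n)) = g (t + act L (intpoint n))}.
  apply: ae_forall_count => n.
  exact: (scales_ae (scales_shift2 (act L (intpoint n))) fg).
have := ergodic_torus Lfree tg; apply: filterS2 aeL => t fgt.
rewrite (Rintegral_ae (g := g)); last 3 first.
- exact: measurable_unit_square.
- by apply: measurable_funTS; case: tg.
- by apply: filterS fg => x.
by under [in X in _ -> X]eq_fun do rewrite (eq_box_avg _ fgt).
Qed.

Definition biperiodic (T : Type) (H : vec2 R * vec2 R -> T) : Prop :=
  forall m n z, H (z.1 + intpoint m, z.2 + intpoint n) = H z.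

Local Notation QQ := (unit_square `*` unit_square).

Lemma scales_shift4 (a b : vec2 R) :
  scales leb4 leb4 1 (fun z : vec2 R * vec2 R => (z.1 + a, z.2 + b)).
Proof. by have := scales_prod (scales_shift2 a) (scales_shift2 b); rewrite mulr1. Qed.

Definition wrap4 (z : vec2 R * vec2 R) := (wrap2 z.1, wrap2 z.2).

Lemma measurable_QQ : measurable (QQ : set (vec2 R * vec2 R)).
Proof. by apply: measurableX; exact: measurable_unit_square. Qed.

Lemma biperiodic_version (H : vec2 R * vec2 R -> R) : biperiodic H ->
  L1 leb4 QQ H ->
  exists G : vec2 R * vec2 R -> R, [/\ measurable_fun setT G, biperiodic G,
    leb4.-integrable QQ (EFin \o G) & {ae leb4, forall z, H z = G z}].
Proof.
move=> pH [g ig Hg]; have mQ := measurable_QQ.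
have mg : measurable_fun QQ g by apply/measurable_EFinP; exact: measurable_int ig.
have mw : measurable_fun setT wrap4.
  by apply: measurable_fun_pair; apply: measurableT_comp => //; exact: measurable_wrap2.
exists (g \o wrap4); split.
- apply: (measurable_comp mQ _ mg mw).
  by move=> _ [z _ <-]; split; exact: wrap2_square.
- by move=> m n z; rewrite /wrap4 /= !wrap2D.
- apply: eq_integrable ig => // -[t s]; rewrite inE => -[/= Qt Qs].
  by rewrite /wrap4 /= !wrap2_id.
- have : {ae leb4, forall z : vec2 R * vec2 R, forall n : (int * int) * (int * int),
      QQ (z.1 + intpoint n.1, z.2 + intpoint n.2) ->
      H (z.1 + intpoint n.1, z.2 + intpoint n.2) = g (z.1 + intpoint n.1, z.2 + intpoint n.2)}.
    apply: ae_forall_count => n.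
    exact: (scales_ae (scales_shift4 (intpoint n.1) (intpoint n.2)) Hg).
  apply: filterS => z /(_ ((- Num.floor z.1.1, - Num.floor z.1.2),
     (- Num.floor z.2.1, - Num.floor z.2.2))) /=.
  rewrite pH -!wrap2E => -> //.
  by split; exact: wrap2_square.
Qed.

Lemma ge0_integral_QQ (K : vec2 R * vec2 R -> \bar R) :
  measurable_fun setT K -> (forall z, 0 <= K z)%E ->
  (\int[leb4]_(z in QQ) K z =
   \int[leb2]_(t in unit_square) \int[leb2]_(s in unit_square) K (t, s))%E /\
  (\int[leb4]_(z in QQ) K z =
   \int[leb2]_(s in unit_square) \int[leb2]_(t in unit_square) K (t, s))%E.
Proof.
move=> mK K0.
have mKr : measurable_fun setT (K \_ QQ).
  by apply/(measurable_restrictT _ measurable_QQ); exact: measurable_funTS.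
have Kr0 z : (0 <= (K \_ QQ) z)%E by rewrite patchE; case: ifPn.
have inQQ t s : ((t, s) \in QQ) = (t \in unit_square) && (s \in unit_square).
  by apply/idP/andP; rewrite !inE => -[].
have zero (D : set (vec2 R)) : (\int[leb2]_(s in D) 0 = 0 :> \bar R)%E by exact: integral0.
split; rewrite integral_mkcond /leb4.
- rewrite fubini_tonelli1// [RHS]integral_mkcond; apply: eq_integral => t _.
  rewrite /fubini_F patchE; case: ifPn => tQ.
    rewrite [RHS]integral_mkcond; apply: eq_integral => s _.
    by rewrite !patchE inQQ tQ.
  by apply: integral0_eq => s _; rewrite patchE inQQ (negPf tQ).
- rewrite fubini_tonelli2// [RHS]integral_mkcond; apply: eq_integral => s _.
  rewrite /fubini_G patchE; case: ifPn => sQ.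
    rewrite [RHS]integral_mkcond; apply: eq_integral => t _.
    by rewrite !patchE inQQ sQ andbT.
  by apply: integral0_eq => t _; rewrite patchE inQQ (negPf sQ) andbF.
Qed.

(* The moire coordinate [t] is, up to a sign that depends on the layer, the
   difference of the coordinates with respect to the two layers. *)
Variable sg : bool.

Definition sgv (t : vec2 R) : vec2 R := if sg then - t else t.

Lemma sgvD s t : sgv (s + t) = sgv s + sgv t.
Proof. by rewrite /sgv; case: sg => //; rewrite opprD. Qed.

Lemma sgv_intpoint (n : int * int) : exists m : int * int, sgv (intpoint n) = intpoint m.
Proof.
rewrite /sgv; case: sg; last by exists n.
by exists (- n.1, - n.2); rewrite /intpoint /= !intrN.
Qed.

Lemma measurable_sgv : measurable_fun setT sgv.
Proof.
rewrite /sgv; case: sg; last exact: measurable_id.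
rewrite (_ : (fun t : vec2 R => - t) = (fun t => (- t.1, - t.2))).
  by apply: measurable_fun_pair; apply: measurableT_comp => //; exact: oppr_measurable.
by apply/funext => -[].
Qed.

(** Fibre coordinates: [z.1] labels the fibre, [z.2] is the position on it, and [n] is a
    displacement along the fibre. The map is a swap, a translation and a shear, so null sets of the
    four-dimensional torus stay null in these coordinates. *)
Lemma scales_shear4 (n : vec2 R) :
  scales leb4 leb4 1 (fun z : vec2 R * vec2 R => (z.2 + n, z.1 + sgv (z.2 + n))).
Proof.
have sx (t : vec2 R) : scales leb2 leb2 1 (fun s => s + sgv t).
  exact: scales_shift2.
have mphi : measurable_fun setT (fun z : vec2 R * vec2 R => z.2 + sgv z.1).
  rewrite (_ : (fun _ => _) = (fun z => (z.2.1 + (sgv z.1).1, z.2.2 + (sgv z.1).2)))//.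
  have ms : measurable_fun setT (fun z : vec2 R * vec2 R => sgv z.1).
    by apply: measurableT_comp => //; exact: measurable_sgv.
  apply: measurable_fun_pair; apply: measurable_funD.
  - by apply: measurableT_comp => //; exact: measurable_snd.
  - by apply: measurableT_comp ms.
  - by apply: measurableT_comp => //; exact: measurable_snd.
  - by apply: measurableT_comp ms.
have s1 := @scales_skew R _ _ _ _ leb2 leb2 1 _ ltr01 mphi sx.
have s2 := scales_comp (scales_comp (scales_swap leb2)
  (scales_prod (scales_shift2 n) (scales_shift2 0))) s1.
move: s2; rewrite !mulr1; congr scales; apply/funext => z /=.
by rewrite addr0.
Qed.

(** A null set may contain a whole fibre, so [H] is exchanged for its Borel version [G] on almost
    every fibre only. Integrability on the fibre is part of the conclusion because [avg_cell] asks
    for it when the average over the moire cell is identified. *)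
Lemma ergodic_fibres (L : 'M[R]_2) (H : vec2 R * vec2 R -> R) :
  (forall k : int * int, k != (0, 0) -> forall m, act L^T (intpoint k) <> intpoint m) ->
  biperiodic H -> L1 leb4 QQ H ->
  {ae leb4, forall z : vec2 R * vec2 R,
    L1 leb2 unit_square (fun t => H (t, z.1 + sgv t)) /\
    (box_avg L N (fun t => H (t, z.1 + sgv t)) z.2 @[N --> \oo] -->
     (\int[leb2]_(t in unit_square) H (t, z.1 + sgv t))%R)}.
Proof.
move=> Lfree pH H1; have [G [mG pG iG HG]] := biperiodic_version pH H1.
have mQ := @measurable_unit_square R.
pose F (z : vec2 R * vec2 R) := G (z.2, z.1 + sgv z.2).
have mF : measurable_fun setT F.
  have [m0 _ _] := scales_shear4 0.
  apply: (measurableT_comp mG); move: m0; congr measurable_fun.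
  by apply/funext => z; rewrite addr0.
have mFs s : measurable_fun setT (fun t => F (s, t)).
  exact: (measurableT_comp mF (measurable_pair1 s)).
have pF s : zperiodic (fun t => F (s, t)).
  move=> n t; rewrite /F /= sgvD addrA; have [m ->] := sgv_intpoint n.
  exact: (pG n m (t, s + sgv t)).
have pF1 t : zperiodic (fun s => F (s, t)).
  move=> n s; rewrite /F /= addrAC.
  have := pG (0, 0) n (t, s + sgv t).
  by rewrite /= (_ : t + intpoint (0, 0) = t)//; case: (t) => a b; congr pair; exact: addr0.
(* Tonelli and translation invariance on the second torus *)
have iF : {ae leb2, forall s, leb2.-integrable unit_square (EFin \o (fun t => F (s, t)))}.
  pose K z := (`|F z|)%:E.
  have mK : measurable_fun setT K by apply/measurable_EFinP; exact: measurableT_comp.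
  have K0 z : (0 <= K z)%E by rewrite lee_fin.
  have mKi : measurable_fun setT (fun s => \int[leb2]_(t in unit_square) K (s, t))%E.
    exact: measurable_section_integral.
  have Kfin : leb2.-integrable unit_square
      (fun s => \int[leb2]_(t in unit_square) K (s, t))%E.
    apply/integrableP; split; first exact: measurable_funTS.
    under eq_integral do rewrite gee0_abs ?integral_ge0//.
    have [<- ->] := ge0_integral_QQ mK K0.
    have mG' : measurable_fun setT (fun z => (`|G z|)%:E).
      by apply/measurable_EFinP; exact: measurableT_comp.
    rewrite (_ : (\int[_]_(_ in _) _)%E = (\int[leb4]_(z in QQ) (`|G z|)%:E)%E).
      by move/integrableP: iG => [].
    have [-> _] := ge0_integral_QQ mG' (fun z => normr_ge0 _).
    apply: eq_integral => t _; rewrite /K /F /=.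
    rewrite (ge0_integral_shift_square (f := fun s => (`|G (t, s)|)%:E))//.
      exact: (measurableT_comp mG' (measurable_pair1 t)).
    move=> n s; have := pG (0, 0) n (t, s).
    rewrite /= (_ : t + intpoint (0, 0) = t); first by move=> ->.
    by case: (t) => a b; congr pair; exact: addr0.
  (* Finiteness holds for almost every label in the unit square; periodicity in the label extends it
     to the plane. *)
  have := integrable_ae mQ Kfin; move/ae_wrap2; apply: filterS => s.
  rewrite ge0_fin_numE ?integral_ge0// => Ks; apply/integrableP; split.
    by apply/measurable_EFinP; exact: measurable_funTS.
  apply: le_lt_trans Ks; rewrite le_eqVlt; apply/orP; left; apply/eqP.
  apply: eq_integral => t _; rewrite /K /=; congr (`| _ |%:E).
  by rewrite -(zperiodic_wrap2 (pF1 t)).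
have cvF : {ae leb4, forall z : vec2 R * vec2 R,
    box_avg L N (fun t => F (z.1, t)) z.2 @[N --> \oo] -->
    (\int[leb2]_(t in unit_square) F (z.1, t))%R}.
  apply: ae_of_xsection.
    apply: (measurable_cvgn (u := fun N z => box_avg L N (fun t => F (z.1, t)) z.2)
       (l := fun z => (\int[leb2]_(t in unit_square) F (z.1, t))%R)).
    + move=> N; apply: measurable_funM => //; apply: measurable_sum => m.
      apply: (measurableT_comp mF); apply: measurable_fun_pair => //.
      by have [ms _ _] := scales_shift2 (act L (intpoint m)); apply: (measurableT_comp ms).
    + apply: (measurableT_comp (f := fun s => (\int[leb2]_(t in unit_square) F (s, t))%R)) => //.
      rewrite /Rintegral; apply: measurableT_comp => //.
      apply: (@measurable_section_integral _ _ _ _ _ leb2 unit_square (EFin \o F)) => //.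
      exact/measurable_EFinP.
  apply: filterS iF => s iFs.
  have tF : torus_integrable (fun t => F (s, t)) by split.
  by have := ergodic_torus Lfree tF; apply: filterS => t.
have HFn : {ae leb4, forall z : vec2 R * vec2 R, forall n : int * int,
    H (z.2 + act L (intpoint n), z.1 + sgv (z.2 + act L (intpoint n))) =
    F (z.1, z.2 + act L (intpoint n))}.
  apply: ae_forall_count => n.
  exact: (scales_ae (scales_shear4 (act L (intpoint n))) HG).
have HF0 : {ae leb4, forall z : vec2 R * vec2 R, H (z.2, z.1 + sgv z.2) = F z}.
  have := scales_ae (scales_shear4 0) HG.
  by apply: filterS => z; rewrite addr0.
have HFI : {ae leb4, forall z : vec2 R * vec2 R,
    L1 leb2 unit_square (fun t => H (t, z.1 + sgv t)) /\
    (\int[leb2]_(t in unit_square) H (t, z.1 + sgv t) =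
     \int[leb2]_(t in unit_square) F (z.1, t))%R}.
  apply: (@ae_fst _ _ _ _ _ leb2 leb2 (fun s =>
    L1 leb2 unit_square (fun t => H (t, s + sgv t)) /\
    (\int[leb2]_(t in unit_square) H (t, s + sgv t) =
     \int[leb2]_(t in unit_square) F (s, t))%R)).
  have := ae_xsection HF0; apply: filterS2 iF => s iFs HFs.
  have HFQ : (fun t => H (t, s + sgv t)) = (fun t => F (s, t)) %[ae leb2 in unit_square].
    by apply: filterS HFs => t.
  split; first exact: L1_ae HFQ iFs.
  by apply: Rintegral_ae => //; exact: measurable_funTS.
apply: filterS3 cvF HFn HFI => z cz hn [h1 hI]; split=> //; rewrite hI.
under eq_fun => N.
  rewrite (@eq_box_avg L N _ (fun t => F (z.1, t))); last by move=> n; exact: hn.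
  over.
exact: cz.
Qed.

End PeriodicVersions.

(** * Lattices and cells *)

Section Cells.
Context {R : realType}.
Implicit Types (M B : 'M[R]_2) (x w : vec2 R).

Lemma cellE M : M \in unitmx -> cell M = act (invmx M) @^-1` unit_square.
Proof.
move=> uM; apply/seteqP; split=> x.
  by move=> [t Qt <-]; rewrite /preimage /= actK.
by move=> Qx; exists (act (invmx M) x) => //; rewrite actVK.
Qed.

Lemma preimage_cell M : M \in unitmx -> act M @^-1` cell M = unit_square.
Proof.
by move=> uM; rewrite cellE//; apply/seteqP; split=> x; rewrite /preimage /= actK.
Qed.

Lemma measurable_cell M : M \in unitmx -> measurable (cell M).
Proof.
move=> uM; rewrite cellE// -[_ @^-1` _]setTI.
by apply: measurable_act => //; exact: measurable_unit_square.
Qed.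

Lemma leb2_cell_lty M : M \in unitmx -> (leb2 (cell M) < +oo)%E.
Proof.
move=> uM; have [c [_ c0 cX]] := scales_act uM.
have := cX _ (measurable_cell uM); rewrite preimage_cell// [LHS]leb2_unit_square => h.
rewrite ltNge leye_eq; apply/eqP => e; move: h; rewrite [X in (_ * X)%E]e.
by rewrite gt0_muley.
Qed.

Lemma L1_scales d1 d2 (T1 : measurableType d1) (T2 : measurableType d2)
    (m1 : {measure set T1 -> \bar R}) (m2 : {measure set T2 -> \bar R})
    (c : R) (phi : T1 -> T2) (D : set T2) (f : T2 -> R) :
  scales m1 m2 c phi -> measurable D ->
  L1 m2 D f -> L1 m1 (phi @^-1` D) (f \o phi).
Proof.
move=> sphi mD [g ig fg]; exists (g \o phi).
  exact: (scales_integrable sphi mD ig).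
exact: (scales_ae sphi fg).
Qed.

(** The preimage of the cell is the unit square, so the constant by which [act M] scales the measure
    is the inverse of the cell's area. It cancels against the normalisation. *)
Lemma avg_cell M (f : vec2 R -> R) : M \in unitmx ->
  L1 leb2 unit_square (f \o act M) ->
  avg (cell M) f = (\int[leb2]_(t in unit_square) f (act M t))%R.
Proof.
move=> uM fM1; have uiM : invmx M \in unitmx by rewrite unitmx_inv.
have mQ := @measurable_unit_square R; have mC := measurable_cell uM.
have [c sc] := scales_act uM; have [e se] := scales_act uiM.
have [g ig fg] : L1 leb2 (cell M) f.
  have := L1_scales se mQ fM1; rewrite -cellE// => -[g ig fg]; exists g => //.
  by apply: filterS fg => x /=; rewrite actVK.
have mg := measurable_int _ ig.
have [_ c0 cX] := sc.
have area_c : area (cell M) = c^-1.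
  have := cX _ mC; rewrite preimage_cell// /area.
  rewrite [LHS](leb2_unit_square) => h.
  have fin : leb2 (cell M) \is a fin_num.
    by rewrite ge0_fin_numE//; exact: leb2_cell_lty.
  move: h; rewrite -(fineK fin) -EFinM => -[h].
  by rewrite -[RHS]mulr1 h mulKf ?gt_eqF.
rewrite /avg area_c (Rintegral_ae mC _ fg); last exact/measurable_EFinP.
have fgM : (fun t => f (act M t)) = g \o act M %[ae leb2 in unit_square].
  by have := scales_ae sc fg; rewrite -(preimage_cell uM).
rewrite (Rintegral_ae mQ _ fgM); last first.
  have mgC : measurable_fun (cell M) g by exact/measurable_EFinP.
  apply: (measurable_comp mC _ mgC).
  - by move=> _ [t Qt <-]; exists t.
  - by apply: measurable_funTS; exact: measurable_act.
rewrite /Rintegral -(preimage_cell uM) (scales_integral sc mC ig).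
rewrite -(fineK (integrable_fin_num mC ig)) -EFinM /= invrK.
reflexivity.
Qed.

Lemma sum_lattice_box B N (F : vec2 R -> R) : B \in unitmx ->
  \sum_(r \in lattice_box B N) F r =
  \sum_(m <- boxseq N) F (act B (intpoint m)).
Proof.
move=> uB; rewrite (fsbig_seq _ _ (boxseq_uniq N)).
have inj : set_inj [set` boxseq N] (fun n : int * int => act B (intpoint n)).
  move=> m n _ _ /(can_inj (actK uB)) [/intr_inj e1 /intr_inj e2].
  by rewrite [m]surjective_pairing e1 e2 -surjective_pairing.
have -> : lattice_box B N =
    [set act B (intpoint n) | n in [set` boxseq N]].
  apply/seteqP; split=> _ [n hn <-]; exists n => //.
  - by rewrite /= mem_boxseq /in_box !subr0; case: hn => -> ->.
  - by move: hn; rewrite /= mem_boxseq /in_box !subr0 => /andP[].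
exact: (@fsbig_image _ _ _ _ _ _ (fun n : int * int => act B (intpoint n)) F inj).
Qed.

Definition lattice_avg B N (f : vec2 R -> R) : R :=
  ((2 * N + 1) ^ 2)%N%:R^-1 * \sum_(r \in lattice_box B N) f r.

Lemma lattice_avg_box M B N (f : vec2 R -> R) x : M \in unitmx -> B \in unitmx ->
  lattice_avg B N (fun r => f (r + x)) =
  box_avg (invmx M *m B) N (f \o act M) (act (invmx M) x).
Proof.
move=> uM uB; rewrite /lattice_avg sum_lattice_box//; congr (_ * _).
by apply: eq_bigr => m _; rewrite /= actD act_mul !actVK// addrC.
Qed.

Lemma lattice_periodic_zperiodic (T : Type) M (f : vec2 R -> T) :
  lattice_periodic M f -> zperiodic (f \o act M).
Proof. by move=> pf n t; rewrite /= actD pf//; exists n. Qed.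

(** No nontrivial character of the torus of [M] is trivial on the lattice of [B]: the character of
    frequency [k] takes at [B n] the phase [(M^-1 B)^T k . n], which is an integer for every [n]
    only if the vector [(M^-1 B)^T k] is integral. *)
Definition incommensurable M B : Prop :=
  forall k : int * int, k != (0, 0) ->
  forall m, act (invmx M *m B)^T (intpoint k) <> intpoint m :> vec2 R.

Lemma lattice_ergodic M B (f : vec2 R -> R) :
  M \in unitmx -> B \in unitmx -> incommensurable M B ->
  lattice_periodic M f -> L1 leb2 (cell M) f ->
  {ae leb2, forall x, lattice_avg B N (fun r => f (r + x)) @[N --> \oo] -->
    avg (cell M) f}.
Proof.
move=> uM uB MB pf f1; have uiM : invmx M \in unitmx by rewrite unitmx_inv.
have [c sc] := scales_act uM; have [e se] := scales_act uiM.
have fM1 : L1 leb2 unit_square (f \o act M).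
  by rewrite -(preimage_cell uM); apply: (L1_scales sc) => //; exact: measurable_cell.
have := scales_ae se (ergodic_periodic MB (lattice_periodic_zperiodic pf) fM1).
apply: filterS => x; rewrite avg_cell//.
by under [in X in _ -> X]eq_fun do rewrite (lattice_avg_box _ _ _ uM uB).
Qed.

(** Passage from the pair of shifts to the label of the fibre and the position on it. The first
    coordinate depends on the second shift through an invertible linear map, which makes the whole a
    skew map up to a swap. *)
Lemma scales_fibre_coords M B B' : M \in unitmx -> B \in unitmx -> B' \in unitmx ->
  exists c, scales leb4 leb4 c (fun z : vec2 R * vec2 R =>
    (act (invmx B) z.1 - act (invmx B') z.2, act (invmx M) z.1)).
Proof.
move=> uM uB uB'; have uiM : invmx M \in unitmx by rewrite unitmx_inv.
have uiB' : invmx B' \in unitmx by rewrite unitmx_inv.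
have [c sc] := scales_act uiM; have [e se] := scales_act uiB'.
have uN : (- 1%:M : 'M[R]_2) \in unitmx by rewrite -scaleN1r unitmxZ ?unitrN1// unitmx1.
have [d sd] := scales_act uN; have [_ d0 _] := sd.
pose phi (z : vec2 R * vec2 R) := act (- 1%:M) z.2 + act (invmx B *m M) z.1.
have mphi : measurable_fun setT phi.
  apply: measurable_fun_pair.
  - apply: measurable_funD.
    + by do 2 apply: measurableT_comp => //; exact: measurable_act.
    + by do 2 apply: measurableT_comp => //; exact: measurable_act.
  - apply: measurable_funD.
    + by do 2 apply: measurableT_comp => //; exact: measurable_act.
    + by do 2 apply: measurableT_comp => //; exact: measurable_act.
have sphi t : scales leb2 leb2 d (fun y => phi (t, y)).
  by have := scales_comp sd (scales_shift2 (act (invmx B *m M) t)); rewrite mulr1.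
have := scales_comp (scales_comp (scales_prod sc se)
  (@scales_skew R _ _ _ _ leb2 leb2 d _ d0 mphi sphi)) (scales_swap leb2).
move=> s; eexists; move: s; congr scales; apply/funext => z /=.
by rewrite /phi /= act_mul actVK// actNl act1 addrC.
Qed.

(* In the coordinates [x = act M t], [y = act B' (s + sgv sg t)] the fibres are
   [s = const]. *)
Lemma lattice_ergodic_fibres M B B' (sg : bool) (Psi : vec2 R -> vec2 R -> R) :
  M \in unitmx -> B \in unitmx -> B' \in unitmx -> incommensurable M B ->
  (forall x, sgv sg (act (invmx M) x) = act (invmx B') x - act (invmx B) x) ->
  (forall y, lattice_periodic M (Psi ^~ y)) ->
  (forall x, lattice_periodic B' (Psi x)) ->
  L1 leb4 (cell M `*` cell B') (fun z => Psi z.1 z.2) ->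
  {ae leb4, forall z : vec2 R * vec2 R,
    lattice_avg B N (fun r => Psi (r + z.1) (r + z.1 - z.2)) @[N --> \oo] -->
    avg (cell M) (fun x => Psi x (act (1%:M - B' *m invmx B) x +
      act (B' *m invmx B) z.1 - z.2))}.
Proof.
move=> uM uB uB' MB hsg pM pB' Psi1.
pose H (z : vec2 R * vec2 R) := Psi (act M z.1) (act B' z.2).
have pH : biperiodic H.
  by move=> m n z; rewrite /H /= !actD pM ?pB'//; [exists n|exists m].
have H1 : L1 leb4 (unit_square `*` unit_square) H.
  have [c sc] := scales_act uM; have [e se] := scales_act uB'.
  have := L1_scales (scales_prod sc se) (measurableX (measurable_cell uM) (measurable_cell uB')) Psi1.
  have eM x : cell M (act M x) = unit_square x by rewrite -(preimage_cell uM).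
  have eB x : cell B' (act B' x) = unit_square x by rewrite -(preimage_cell uB').
  congr (L1 _ _ _); apply/seteqP; split=> z [/=]; rewrite ?eM ?eB//.
have [c sc] := scales_fibre_coords uM uB uB'.
have := scales_ae sc (ergodic_fibres sg MB pH H1); apply: filterS => -[x w] /=.
set s := act (invmx B) x - act (invmx B') w.
(* The left side is the point of the fibre above [y]; the right side is the second argument of
   [Phi_inter] at [y] for the shifts [x] and [w]. *)
have key y : act B' (s + sgv sg (act (invmx M) y)) =
    y - act (B' *m invmx B) y + act (B' *m invmx B) x - w.
  rewrite hsg /s !actD !actN !actVK// !act_mul.
  by rewrite addrC -!addrA; congr (_ + _); rewrite addrC -!addrA; congr (_ + _).
have fE : (fun x' => Psi x' (act (1%:M - B' *m invmx B) x' + act (B' *m invmx B) x - w)) \o act M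
   = fun t => H (t, s + sgv sg t).
  apply/funext => t; rewrite /H /= -{4}(actK uM t) key actDl actNl act1.
  by [].
move=> [h1 h2]; rewrite avg_cell//; last by rewrite fE.
rewrite (_ : (fun N => lattice_avg B N _) = fun N =>
  box_avg (invmx M *m B) N (fun t => H (t, s + sgv sg t)) (act (invmx M) x)).
  by move: h2; rewrite -fE.
apply/funext => N; rewrite /lattice_avg sum_lattice_box//.
congr (_ * _); apply: eq_bigr => m _.
set r := act B (intpoint m).
have -> : act (invmx M) x + act (invmx M *m B) (intpoint m) = act (invmx M) (x + r).
  by rewrite actD act_mul.
rewrite /H /= actVK// key (addrC r x); set y := x + r.
(* For [r] in the lattice of [B] the vector [B' B^-1 r] lies in the lattice of [B']. Modulo that
   lattice the argument on the fibre is thus [y - w], the one that occurs in the finite energy. *)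
have -> : y - act (B' *m invmx B) y + act (B' *m invmx B) x - w =
    y - w + act B' (intpoint (- m.1, - m.2)).
  rewrite (_ : intpoint (- m.1, - m.2) = - intpoint m); last first.
    by rewrite /intpoint /= !intrN.
  have eP : act (B' *m invmx B) r = act B' (intpoint m) by rewrite act_mul actK.
  have -> : act (B' *m invmx B) y = act B' (intpoint m) + act (B' *m invmx B) x.
    by rewrite /y actD eP addrC.
  rewrite actN opprD addrA subrK.
  by rewrite addrAC.
by rewrite [RHS]pB'//; exists (- m.1, - m.2).
Qed.

End Cells.

(** * The moire lattice and the energies *)

Section MoireAlgebra.
Context {R : realType} (q theta : R) (A : 'M[R]_2).
Hypotheses (q_gt0 : 0 < q) (A_unit : A \in unitmx).
Local Notation B := (Amx q theta A).
Local Notation BM := (moire q theta A).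

Lemma act0 (M : 'M[R]_2) : act M 0 = 0.
Proof. by rewrite actE /lin2 /= !mulr0 addr0. Qed.

Lemma rotation_unit (phi : R) : rotation phi \in unitmx.
Proof.
rewrite unitmxE unitfE det2 !mxE /= mulNr opprK -!expr2 cos2Dsin2.
exact: oner_neq0.
Qed.

Lemma Amx_unit j : B j \in unitmx.
Proof.
have h (r phi : R) : (q `^ r) *: (rotation phi *m A) \in unitmx.
  by rewrite unitmxZ ?unitfE ?gt_eqF ?powR_gt0// unitmx_mul rotation_unit.
by case: j; exact: h.
Qed.

Hypothesis dual_incommensurate :
  dual_lattice (B layer1) `&` dual_lattice (B layer2) = [set 0].
Hypothesis incommensurate : lattice (B layer1) `&` lattice (B layer2) = [set 0].

Lemma Amx_neq : B layer1 <> B layer2.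
Proof.
move=> B12; have : (lattice (B layer1) `&` lattice (B layer2)) (act (B layer1) (intpoint (1, 0))).
  by split; rewrite -?B12; exists (1, 0).
rewrite incommensurate /= => h.
have := actK (Amx_unit layer1) (intpoint (1, 0)); rewrite h act0 => -[] /eqP.
by rewrite eq_sym oner_eq0.
Qed.

(** One has [A_1^-1 - A_2^-1 = A_1^-1 (A_2 - A_1) A_2^-1], and with [a = q^(-1/2)], [b = q^(1/2)],
    [phi = theta / 2] the determinant of [b R_phi - a R_(-phi)] is [((b - a) cos phi)^2 + ((b + a)
    sin phi)^2]. It vanishes only if [sin phi = 0] and [a = b], and then the two layers coincide. *)
Lemma invAmxB_unit : invmx (B layer1) - invmx (B layer2) \in unitmx.
Proof.
have u1 := Amx_unit layer1; have u2 := Amx_unit layer2.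
have -> : invmx (B layer1) - invmx (B layer2) =
    invmx (B layer1) *m (B layer2 - B layer1) *m invmx (B layer2).
  by rewrite mulmxBr mulVmx// mulmxBl mul1mx mulmxK.
rewrite !unitmx_mul !unitmx_inv u1 u2 andbT /=.
set a := q `^ (- 2^-1); set b := q `^ 2^-1; set phi := theta / 2.
have -> : B layer2 - B layer1 = (b *: rotation phi - a *: rotation (- phi)) *m A.
  by rewrite mulmxBl -!scalemxAl.
rewrite unitmx_mul A_unit andbT unitmxE unitfE; apply/negP => /eqP.
rewrite det2 !mxE /= cosN sinN => d0.
have a0 : 0 < a by exact: powR_gt0.
have b0 : 0 < b by exact: powR_gt0.
have cs : cos phi ^+ 2 + sin phi ^+ 2 = 1 := cos2Dsin2 phi.
have d1 : ((b - a) * cos phi) ^+ 2 + ((b + a) * sin phi) ^+ 2 = 0 by rewrite -d0; ring.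
have s0 : sin phi = 0.
  have : (b + a) * sin phi = 0.
    by apply/eqP; rewrite -sqrf_eq0; apply/eqP; have := sqr_ge0 ((b - a) * cos phi);
      have := sqr_ge0 ((b + a) * sin phi); lra.
  by move/eqP; rewrite mulf_eq0 gt_eqF ?addr_gt0//= => /eqP.
have ab : a = b.
  have : ((b - a) * cos phi) ^+ 2 = 0 by move: d1; rewrite s0; lra.
  rewrite exprMn; have -> : cos phi ^+ 2 = 1 by move: cs; rewrite s0; lra.
  by rewrite mulr1 => /eqP; rewrite sqrf_eq0 subr_eq0 => /eqP.
apply: Amx_neq; rewrite /Amx -/a -/b -/phi ab; congr (_ *: (_ *m _)).
by apply/matrixP => i k; rewrite !mxE cosN sinN s0 !oppr0.
Qed.

Lemma moire_unit : BM \in unitmx.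
Proof. by rewrite unitmx_inv invAmxB_unit. Qed.

Lemma invmx_moire : invmx BM = invmx (B layer1) - invmx (B layer2).
Proof. exact: invmxK. Qed.

Lemma dual_act_eq0 (k n : int * int) :
  act (invmx (B layer1))^T (intpoint n) = act (invmx (B layer2))^T (intpoint k) ->
  n = (0, 0) /\ k = (0, 0).
Proof.
move=> e; have actZ (M : 'M[R]_2) x : act (2 * pi *: M) x = act (2 * pi)%:M (act M x).
  by rewrite -act_mul mul_scalar_mx.
have eq0 j (m : int * int) : act (2 * pi *: (invmx (B j))^T) (intpoint m) = 0 ->
    m = (0, 0).
  have u : (2 * pi *: (invmx (B j))^T : 'M[R]_2) \in unitmx.
    rewrite unitmxZ ?unitmx_tr ?unitmx_inv ?Amx_unit// unitfE.
    by rewrite mulf_neq0// gt_eqF// pi_gt0.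
  move=> m0; have := actK u (intpoint m); rewrite m0 act0 => -[].
  move=> /esym/eqP; rewrite intr_eq0 => /eqP e1 /esym/eqP; rewrite intr_eq0 => /eqP e2.
  by rewrite [m]surjective_pairing e1 e2.
have : (dual_lattice (B layer1) `&` dual_lattice (B layer2))
    (act ((2 * pi) *: (invmx (B layer2))^T) (intpoint k)).
  by split; [exists n => //; rewrite !actZ e|exists k].
rewrite dual_incommensurate /= => v0; split; last exact: (eq0 layer2).
by apply: (eq0 layer1); rewrite actZ e -actZ.
Qed.

(** An integral value [m] of [(A_M^-1 A_j)^T k] means [A_1^-T k - A_2^-T k = A_j^-T m]. Collecting
    terms, [A_1^-T (k - m) = A_2^-T k] for the first layer and [A_1^-T k = A_2^-T (k + m)] for the
    second: up to the factor [2 pi] a vector of both dual lattices, so [k = 0]. *)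
Lemma incommensurable_moire j : incommensurable BM (B j).
Proof.
move=> k k0 m km; move/eqP: k0; apply.
have uj := Amx_unit j.
have {km} : act (invmx (B layer1))^T (intpoint k) - act (invmx (B layer2))^T (intpoint k) =
    act (invmx (B j))^T (intpoint m).
  rewrite -km -act_mul trmx_mul mulmxA -trmx_mul mulmxV// trmx1 mul1mx.
  by rewrite invmx_moire linearB /= actDl actNl.
have sub (a b : int * int) : intpoint (a.1 - b.1, a.2 - b.2) = intpoint a - intpoint b :> vec2 R.
  by rewrite /intpoint /= !intrB.
case: j {uj} => e.
- have [] // := @dual_act_eq0 k (k.1 - m.1, k.2 - m.2).
  by rewrite sub actD actN -e opprB addrCA subrr addr0.
- have [] // := @dual_act_eq0 (k.1 + m.1, k.2 + m.2) k.
  by rewrite intpointD actD -e addrC subrK.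
Qed.

Lemma moire_sign j : exists sg : bool, forall x : vec2 R,
  sgv sg (act (invmx BM) x) = act (invmx (B (other j))) x - act (invmx (B j)) x.
Proof.
rewrite invmx_moire; case: j => /=; [exists true|exists false] => x.
  by rewrite /sgv actDl actNl opprB.
by rewrite /sgv actDl actNl.
Qed.

End MoireAlgebra.

(** * Periodicity and convergence of the energies *)

Section EnergyLimits.
Context {R : realType} (q theta : R) (A : 'M[R]_2) (S : layer -> finType).
Local Notation B := (Amx q theta A).
Local Notation BM := (moire q theta A).
Variable tau : forall j, S j -> vec2 R.
Variable u : forall j, vec2 R -> S j -> vec3 R.
Variable Vmono : forall j, S j -> config (B j) (S j) -> R.
Variable Vinter : forall j, S j -> config (B (other j)) (S (other j)) -> R.
Hypothesis u_periodic : forall j (a : S j),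
  lattice_periodic BM (fun x => u x a).
Hypothesis Vinter_translation : forall j (a : S j),
  translation_invariant (Vinter a).

Lemma Phi_mono_periodic j : lattice_periodic BM (Phi_mono (@Vmono) (@u) j).
Proof.
move=> r x rM; congr (_ * _); apply: eq_bigr => a _; congr (Vmono _).
apply/funext => r'; apply/funext => b.
by congr (_ - _); [rewrite addrAC|]; exact: u_periodic.
Qed.

Lemma Psi_inter_periodicl j y : lattice_periodic BM (Psi_inter (@Vinter) (@tau) (@u) j ^~ y).
Proof.
move=> r x rM; congr (_ * _); apply: eq_bigr => a _; congr (Vinter _).
apply/funext => r'; apply/funext => b.
congr (_ + _ - _); first exact: u_periodic.
rewrite [x + r - y]addrAC [x - y + r + _]addrAC; exact: u_periodic.
Qed.

Lemma lattice_opp (M : 'M[R]_2) (r : vec2 R) : lattice M r -> - r \in lattice M.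
Proof.
move=> [n _ <-]; rewrite inE; exists (- n.1, - n.2) => //.
by rewrite -actN; congr act; rewrite /intpoint /= !intrN.
Qed.

(** Adding a lattice vector to [y] only relabels the sites of the opposite layer, which translation
    invariance of the potential absorbs. *)
Lemma Psi_inter_periodicr j x : lattice_periodic (B (other j)) (Psi_inter (@Vinter) (@tau) (@u) j x).
Proof.
move=> r y rB; congr (_ * _); apply: eq_bigr => a _.
pose r0 : lattice (B (other j)) := exist _ (- r) (lattice_opp rB).
rewrite -[RHS](@Vinter_translation j a _ r0); congr (Vinter _).
apply/funext => r'; apply/funext => b /=.
have e : y + r - val r' = y - (val r' - r) by rewrite opprB addrA addrAC.
rewrite e; congr (_ - u _ _).
by rewrite opprD !addrA [LHS]addrAC.
Qed.

(** At a site [x] of layer [j], taking [y = x - w] with [w] the shift of the other layer gives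
    [x - y + R' = R' + w], so [Psi_inter] sees the displacements of the other layer exactly at its
    shifted lattice points. *)
Lemma e_inter_NE j N (g : vec2 R * vec2 R) :
  e_inter_N (@Vinter) (@tau) (@u) j N g =
  lattice_avg (B j) N (fun r => Psi_inter (@Vinter) (@tau) (@u) j (r + shift_of g j)
    (r + shift_of g j - shift_of g (other j))).
Proof.
rewrite /e_inter_N /lattice_avg /Psi_inter invfM [_^-1 * _^-1]mulrC -mulrA.
congr (_ * _).
rewrite mulr_fsumr.
apply: eq_fsbigr => r _; congr (_ * _).
apply: eq_bigr => a _; congr (Vinter _).
apply/funext => r'; apply/funext => b; rewrite /positions.
set x := r + shift_of g j; set w := shift_of g (other j).
have -> : x - (x - w) + val r' = val r' + w by rewrite opprB addrCA subrr addr0 addrC.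
have -> : emb (x - w - val r' + tau a - tau b) =
    emb (x + tau a) - emb (val r' + w + tau b).
  have zE (V : zmodType) (c d e f h : V) : c - d - e + f - h = c + f - (e + d + h).
    rewrite !opprD !addrA; congr (_ - _).
    by rewrite [c - d - e + f]addrAC [c - d + f]addrAC [LHS]addrAC.
  rewrite /emb; congr (_, _); last by rewrite /= subr0.
  exact: zE.
by rewrite opprD [LHS]addrACA [LHS]addrA.
Qed.

Lemma ae_shift_of j (P : vec2 R * vec2 R -> Prop) :
  {ae leb4, forall z, P z} ->
  {ae leb4, forall g, P (shift_of g j, shift_of g (other j))}.
Proof.
case: j => [|aeP] /=; first by apply: filterS => -[].
exact: (scales_ae (scales_swap leb2) aeP).
Qed.

Hypotheses (q_gt0 : 0 < q) (A_unit : A \in unitmx).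
Hypothesis dual_incommensurate :
  dual_lattice (B layer1) `&` dual_lattice (B layer2) = [set 0].
Hypothesis incommensurate : lattice (B layer1) `&` lattice (B layer2) = [set 0].

Lemma ae_cvg_energies j :
  L1 leb2 (cell BM) (Phi_mono (@Vmono) (@u) j) ->
  L1 leb4 (cell BM `*` cell (B (other j)))
    (fun z => Psi_inter (@Vinter) (@tau) (@u) j z.1 z.2) ->
  {ae leb4, forall g : vec2 R * vec2 R,
     ((fun N => e_mono_N (@Vmono) (@u) j N (shift_of g j)) @ \oo
        --> e_mono (@Vmono) (@u) j) /\
     ((fun N => e_inter_N (@Vinter) (@tau) (@u) j N g) @ \oo
        --> e_inter (@Vinter) (@tau) (@u) j g)}.
Proof.
move=> mono1 inter1.
have uM := moire_unit q_gt0 A_unit incommensurate.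
have uB k := Amx_unit theta q_gt0 A_unit k.
have MB : incommensurable BM (B j) by exact: incommensurable_moire.
have [sg hsg] := moire_sign q theta A j.
have perm : lattice_periodic BM (Phi_mono (@Vmono) (@u) j) by exact: Phi_mono_periodic.
have perl y : lattice_periodic BM (Psi_inter (@Vinter) (@tau) (@u) j ^~ y).
  exact: Psi_inter_periodicl.
have perr x : lattice_periodic (B (other j)) (Psi_inter (@Vinter) (@tau) (@u) j x).
  exact: Psi_inter_periodicr.
have mono := lattice_ergodic uM (uB j) MB perm mono1.
have inter := lattice_ergodic_fibres uM (uB j) (uB (other j)) MB hsg perl perr inter1.
have mono4 := @ae_fst _ _ _ _ _ leb2 leb2 _ mono.
have mono' := ae_shift_of j mono4; have inter' := ae_shift_of j inter.
apply: filterS2 mono' inter' => g /= h1 h2; split; first exact: h1.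
under eq_fun do rewrite e_inter_NE.
exact: h2.
Qed.

End EnergyLimits.

(** * Pair potentials *)

Section Summability.
Context {R : realType}.

Lemma esum_le_exhaustion (I : choiceType) (f : I -> R) (T : nat -> seq I) (C : R) :
  (forall i, 0 <= f i) -> (forall N, uniq (T N)) ->
  (forall M N, (M <= N)%N -> {subset T M <= T N}) ->
  (forall i, exists N, i \in T N) ->
  (forall N, \sum_(i <- T N) f i <= C) ->
  (\esum_(i in [set: I]) (f i)%:E <= C%:E)%E.
Proof.
move=> f0 uT mT eT TC; apply: ge_ereal_sup => _ [X [finX _] <-].
rewrite fsbig_finite// sumEFin lee_fin; set s := finmap.enum_fset (fset_set X).
have us : uniq s by exact: finmap.fset_uniq.
have [N sN] : exists N, {subset s <= T N}.
  elim: (s) => [|i t [N tN]]; first by exists 0%N.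
  have [M iM] := eT i; exists (maxn M N) => k; rewrite inE => /orP[/eqP ->|/tN].
    exact: mT (leq_maxl _ _) _ iM.
  exact: mT (leq_maxr _ _) _.
apply: le_trans (TC N); rewrite [leRHS](bigID [in s])/=.
have pm : perm_eq [seq i <- T N | i \in s] s.
  apply: uniq_perm; [exact: filter_uniq|exact: us|].
  by move=> i; rewrite mem_filter andb_idr// => /sN.
rewrite -[X in _ <= X + _]big_filter (perm_big s pm).
by rewrite lerDl sumr_ge0.
Qed.

(* Dyadic blocks: the block [2^i, 2^(i+1)) contributes at most [2^(i(1-r))]. *)
Lemma pseries_bound (r : R) : 1 < r -> exists C : R, forall N : nat,
  \sum_(k <- iota 0 N) (k.+1%:R : R) `^ (- r) <= C.
Proof.
move=> r1; pose rho : R := 2 `^ (1 - r).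
have rho0 : 0 < rho by exact: powR_gt0.
have rho1 : rho < 1.
  have -> : rho = 2 / 2 `^ r.
    by rewrite /rho powRB ?pnatr_eq0 ?implybT// powRr1.
  rewrite ltr_pdivrMr ?powR_gt0// mul1r -[X in X < _]powRr1//.
  rewrite /powR !gt_eqF// ltr_expR ltr_pM2r//.
  by rewrite ln_gt0// ltr1n.
(* The summand is indexed by [k.+1], so the first [2 ^ M - 1] terms fill exactly the dyadic blocks
   below [2 ^ M]. *)
have blk M : \sum_(k <- iota 0 (2 ^ M - 1)) (k.+1%:R : R) `^ (- r) <=
    \sum_(i < M) rho ^+ i.
  elim: M => [|M IH]; first by rewrite big_nil big_ord0.
  have e : (2 ^ M.+1 - 1 = (2 ^ M - 1) + 2 ^ M)%N.
    by rewrite expnS; have := expn_gt0 2 M; lia.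
  rewrite e iotaD add0n big_cat big_ord_recr /=; apply: lerD => //.
  apply: le_trans (_ : \sum_(k <- iota (2 ^ M - 1) (2 ^ M)) (2 ^ M)%:R `^ (- r) <= _).
    rewrite big_seq [leRHS]big_seq; apply: ler_sum => k; rewrite mem_iota => /andP[k1 _].
    have k2 : (2 ^ M <= k.+1)%N by have := expn_gt0 2 M; lia.
    rewrite !powRN lef_pV2 ?posrE ?powR_gt0 ?ltr0n ?expn_gt0//.
    by apply: ge0_ler_powR; rewrite ?nnegrE ?ler_nat//; lra.
  have e1 : (2 ^ M)%:R = 2 `^ M%:R :> R by rewrite natrX powR_mulrn.
  rewrite big_const_seq count_predT size_iota iter_addr_0 -[_ `^ _ *+ _]mulr_natl e1 -powRrM.
  rewrite -powRD; last by rewrite pnatr_eq0 implybT.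
  rewrite -powR_mulrn ?(ltW rho0)// /rho -powRrM.
  by have -> : M%:R + M%:R * - r = (1 - r) * M%:R by ring.
exists (1 - rho)^-1 => N.
have N2 : (N <= 2 ^ N - 1)%N by have := ltn_expl N (isT : (1 < 2)%N); lia.
apply: le_trans (_ : \sum_(k <- iota 0 (2 ^ N - 1)) (k.+1%:R : R) `^ (- r) <= _).
  rewrite -[in leRHS](subnKC N2) iotaD big_cat /= lerDl.
  by apply: sumr_ge0 => k _; exact: powR_ge0.
apply: le_trans (blk N) _.
have := subrX1 rho N; have : 0 <= rho ^+ N by rewrite exprn_ge0// ltW.
move: (\sum_(i < N) rho ^+ i) (rho ^+ N) => s p p0 sp.
by rewrite -[leRHS]mul1r ler_pdivlMr ?subr_gt0//; lra.
Qed.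

Definition intseq (N : nat) : seq int :=
  [seq Posz k | k <- iota 0 N] ++ [seq Negz k | k <- iota 0 N].

Lemma mem_intseq N m : (m \in intseq N) = (- N%:Z <= m < N%:Z).
Proof.
rewrite mem_cat; apply/orP/idP.
  by case=> /mapP[k]; rewrite mem_iota => hk ->; rewrite ?NegzE; lia.
case: m => k hk; [left|right]; apply/mapP; exists k => //; rewrite mem_iota; move: hk.
  by lia.
by rewrite NegzE; lia.
Qed.

Lemma intseq_uniq N : uniq (intseq N).
Proof.
rewrite cat_uniq !map_inj_uniq ?iota_uniq//= ?andbT.
- by apply/hasPn => m /mapP[k _ ->]; apply/negP => /mapP[l _].
- by move=> k l [].
- by move=> k l [].
Qed.

Definition decay (r : R) (m : int) : R := (1 + `|m|%:~R) `^ (- r).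

Lemma decay_ge0 r m : 0 <= decay r m.
Proof. exact: powR_ge0. Qed.

Lemma decay_bound (r : R) : 1 < r -> exists2 C : R, 0 <= C & forall N : nat,
  \sum_(m <- intseq N) decay r m <= C.
Proof.
move=> r1; have [C hC] := pseries_bound r1; exists (C + C).
  by have := hC 0%N; rewrite big_nil; lra.
move=> N; rewrite big_cat !big_map /=; apply: lerD.
  apply: le_trans (hC N); apply: ler_sum => k _; rewrite /decay.
  by rewrite -[k.+1]add1n natrD.
apply: le_trans (hC N); apply: ler_sum => k _; rewrite /decay.
have -> : 1 + `|Negz k|%:~R = k.+2%:R :> R.
  by rewrite NegzE normrN -[k.+2]add1n natrD.
rewrite !powRN lef_pV2 ?posrE ?powR_gt0 ?ltr0n//.
by apply: ge0_ler_powR; rewrite ?nnegrE ?ler_nat//; lra.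
Qed.

Lemma esum_decay (S : finType) (r : R) : 1 < r -> exists2 C : R, 0 <= C &
  forall c : R, 0 <= c ->
  (\esum_(p in [set: (int * int) * S]) (c * (decay r p.1.1 * decay r p.1.2))%:E
    <= (c * C)%:E)%E.
Proof.
move=> r1; have [C C0 hC] := decay_bound r1.
exists (C * C * #|S|%:R) => [|c c0]; first by rewrite !mulr_ge0.
pose T N := [seq (n, b) | n <- [seq (m1, m2) | m1 <- intseq N, m2 <- intseq N], b <- enum S].
apply: (@esum_le_exhaustion _ _ T).
- by move=> p; rewrite !mulr_ge0 ?decay_ge0.
- move=> N; apply: allpairs_uniq; [|exact: enum_uniq|by move=> [? ?] [? ?]].
  by apply: allpairs_uniq; [exact: intseq_uniq|exact: intseq_uniq|move=> [? ?] [? ?]].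
- move=> M N MN [[m1 m2] b] /allpairsP[[n b'] [/allpairsP[[n1 n2] [/= h1 h2 ->]] hb [-> -> ->]]] /=.
  apply/allpairsP; exists ((n1, n2), b'); split=> //=.
  apply/allpairsP; exists (n1, n2); split=> //=; move: h1 h2; rewrite !mem_intseq; lia.
- move=> [[m1 m2] b]; have [K hK] : exists K, K = (absz m1 + absz m2).+1 by eexists.
  exists K.
  apply/allpairsP; exists ((m1, m2), b); split=> //=; last by rewrite mem_enum.
  by apply/allpairsP; exists (m1, m2); split=> //=; rewrite mem_intseq; lia.
- move=> N; rewrite -mulr_sumr ler_wpM2l// big_allpairs_dep /=.
  under eq_bigr do rewrite big_const_seq count_predT -cardE iter_addr_0 -mulr_natr.
  rewrite -mulr_suml ler_wpM2r// big_allpairs_dep /=.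
  under eq_bigr do rewrite -mulr_sumr.
  rewrite -mulr_suml ler_pM// sumr_ge0// => m _; exact: decay_ge0.
Qed.

Lemma abs_sum_le (I : choiceType) (f : I -> R) (C : R) : 0 <= C ->
  (\esum_(i in [set: I]) (`|f i|)%:E <= C%:E)%E -> `|abs_sum f| <= C.
Proof.
move=> C0 fC; have h (g : I -> R) : (forall i, 0 <= g i <= `|f i|) ->
    0 <= fine (\esum_(i in [set: I]) (g i)%:E) <= C.
  move=> gf; have g0 : (0 <= \esum_(i in [set: I]) (g i)%:E)%E.
    by apply: esum_ge0 => i _; rewrite lee_fin; have /andP[] := gf i.
  have gC : (\esum_(i in [set: I]) (g i)%:E <= C%:E)%E.
    apply: le_trans fC; apply: le_esum => i _; rewrite lee_fin.
    by have /andP[] := gf i.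
  have gfin : \esum_(i in [set: I]) (g i)%:E \is a fin_num.
    by rewrite ge0_fin_numE// (le_lt_trans gC)// ltry.
  by rewrite fine_ge0//= -lee_fin fineK.
rewrite /abs_sum.
have := h (fun i => Num.max (f i) 0); have := h (fun i => Num.max (- f i) 0).
move=> /(_ _)/andP[|? ?]; first by move=> i; rewrite le_max lexx orbT ge_max normr_ge0 andbT -normrN ler_norm.
move=> /(_ _)/andP[|? ?]; first by move=> i; rewrite le_max lexx orbT ge_max normr_ge0 andbT ler_norm.
by rewrite ler_norml; apply/andP; split; lra.
Qed.

(** Numbering the index set by [pickle] turns the sum into a series of measurable functions. *)
Lemma measurable_esum_count d (T : measurableType d) (I : countType)
    (f : I -> T -> \bar R) :
  (forall i x, 0 <= f i x)%E -> (forall i, measurable_fun setT (f i)) ->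
  measurable_fun setT (fun x => \esum_(i in [set: I]) f i x)%E.
Proof.
move=> f0 mf.
pose a n x : \bar R := if @pickle_inv I n is Some i then f i x else 0%E.
pose P : pred nat := fun n => isSome (@pickle_inv I n).
have e x : (\esum_(i in [set: I]) f i x = \sum_(n <oo | P n) a n x)%E.
  rewrite nneseries_esum; last by move=> n _; rewrite /a; case: pickle_inv.
  have -> : [set n | P n] = @pickle I @` setT.
    apply/seteqP; split=> n; last by move=> [i _ <-]; rewrite /= /P pickleK_inv.
    rewrite /= /P => Pn; case E : (pickle_inv n) Pn => [i|]// _; exists i => //.
    by have := @pickle_invK I n; rewrite /oapp E.
  rewrite esum_image; last by move=> i j _ _; exact: (pcan_inj pickleK_inv).
  by apply: eq_esum => i _; rewrite /a pickleK_inv.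
under eq_fun do rewrite e.
apply: ge0_emeasurable_sum => n.
  by move=> x _ _; rewrite /a; case: pickle_inv.
by rewrite /P /a; case: pickle_inv.
Qed.

End Summability.

Section PairPotentials.
Context {R : realType}.

Lemma leb2_setT_gt0 : (0 < leb2 [set: vec2 R])%E.
Proof.
apply: lt_le_trans (_ : leb2 unit_square <= _)%E.
  by rewrite leb2_unit_square lte_fin.
by apply: le_measure; rewrite ?inE//; exact: measurable_unit_square.
Qed.

Lemma Linfty_normE (F : vec2 R -> R) :
  'N[leb2]_+oo[(fun x => (F x)%:E)]%E = ess_sup leb2 (fun x => (`|F x|)%:E).
Proof. by rewrite unlock leb2_setT_gt0. Qed.

Lemma ae_le_Linfty_norm (F : vec2 R -> R) :
  ('N[leb2]_+oo[(fun x => (F x)%:E)] < +oo)%E ->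
  {ae leb2, forall x, `|F x| <= fine 'N[leb2]_+oo[(fun x => (F x)%:E)]%E}.
Proof.
move=> Foo; have F0 := Lnorm_ge0 leb2 +oo%E (fun x => (F x)%:E).
have Ffin : 'N[leb2]_+oo[(fun x => (F x)%:E)]%E \is a fin_num by rewrite ge0_fin_numE.
have := ess_sup_ge leb2 (fun x => (`|F x|)%:E); rewrite -Linfty_normE.
by apply: filterS => x; rewrite -{1}(fineK Ffin) lee_fin.
Qed.

Lemma enorm3_ge0 (x : vec3 R) : 0 <= enorm3 x.
Proof. exact: sqrtr_ge0. Qed.

Lemma sqr_enorm3 (x : vec3 R) :
  enorm3 x ^+ 2 = x.1.1 ^+ 2 + x.1.2 ^+ 2 + x.2 ^+ 2.
Proof. by rewrite sqr_sqrtr// !addr_ge0 ?sqr_ge0. Qed.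

Lemma enorm3_coords (x : vec3 R) :
  [/\ `|x.1.1| <= enorm3 x, `|x.1.2| <= enorm3 x & `|x.2| <= enorm3 x].
Proof.
have h (y : R) : y ^+ 2 <= enorm3 x ^+ 2 -> `|y| <= enorm3 x.
  move=> yx; rewrite -sqrtr_sqr -[leRHS]ger0_norm ?enorm3_ge0// -sqrtr_sqr.
  by rewrite ler_sqrt// sqr_ge0.
by split; apply: h; rewrite sqr_enorm3; have := sqr_ge0 x.1.1; have := sqr_ge0 x.1.2;
  have := sqr_ge0 x.2; lra.
Qed.

Lemma japanese_ge1 (x : vec3 R) : 1 <= japanese x.
Proof. by rewrite /japanese -[leLHS]sqrtr1 ler_sqrt ?lerDl ?addr_ge0 ?sqr_ge0. Qed.

Lemma enorm3_japanese (x : vec3 R) : enorm3 x <= japanese x.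
Proof.
rewrite /japanese -[leLHS]ger0_norm ?enorm3_ge0// -sqrtr_sqr.
by rewrite ler_sqrt ?lerDr ?addr_ge0 ?sqr_ge0.
Qed.

Lemma Linfty_vec_version (f : vec2 R -> vec3 R) : Linfty_vec f ->
  exists (g : vec2 R -> vec3 R) (K : R), measurable_fun setT g /\
  {ae leb2, forall x, [/\ f x = g x, enorm3 (f x) <= K
     & `|(f x).2| <= fine 'N[leb2]_+oo[(fun x => ((f x).2)%:E)]%E]}.
Proof.
move=> [[g mg fg] foo]; exists g, (fine 'N[leb2]_+oo[(fun x => (enorm3 (f x))%:E)]%E).
split=> //.
have zoo : ('N[leb2]_+oo[(fun x => ((f x).2)%:E)] < +oo)%E.
  apply: le_lt_trans foo; rewrite !Linfty_normE; apply: le_ess_sup.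
  apply: aeW => x; rewrite lee_fin [leRHS]ger0_norm ?enorm3_ge0//.
  by have [] := enorm3_coords (f x).
have h1 := ae_le_Linfty_norm foo; have h2 := ae_le_Linfty_norm zoo.
apply: filterS3 fg h1 h2 => x /(_ I) e1 e2 e3; split=> //.
by apply: le_trans e2; exact: ler_norm.
Qed.

Definition mx_abs_sum (M : 'M[R]_2) : R := `|M ord0 ord0| + `|M ord0 ord_max| +
  `|M ord_max ord0| + `|M ord_max ord_max|.

Lemma act_bound (M : 'M[R]_2) (x : vec2 R) (c : R) :
  `|x.1| <= c -> `|x.2| <= c ->
  `|(act M x).1| <= mx_abs_sum M * c /\ `|(act M x).2| <= mx_abs_sum M * c.
Proof.
move=> x1 x2; have c0 : 0 <= c by exact: le_trans x1.
rewrite actE /lin2 /mx_abs_sum /=.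
have h (p q : R) : `|p * x.1 + q * x.2| <= (`|p| + `|q|) * c.
  apply: le_trans (ler_normD _ _) _; rewrite !normrM mulrDl.
  by apply: lerD; exact: ler_wpM2l.
have n := normr_ge0; split; apply: le_trans (h _ _) _; rewrite ler_wpM2r//.
  by have := n _ _ (M ord_max ord0); have := n _ _ (M ord_max ord_max); lra.
by have := n _ _ (M ord0 ord0); have := n _ _ (M ord0 ord_max); lra.
Qed.

Lemma cell_bounded (M : 'M[R]_2) (y : vec2 R) : cell M y ->
  `|y.1| <= mx_abs_sum M /\ `|y.2| <= mx_abs_sum M.
Proof.
move=> [t [/= t1 t2] <-]; have h (s : R) : s \in `[0, 1[ -> `|s| <= 1.
  by rewrite in_itv /= => /andP[s0 s1]; rewrite ger0_norm// ltW.
by have := act_bound M (h _ t1) (h _ t2); rewrite mulr1.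
Qed.

(** If the horizontal part of [x] is within [K] of [- M n], then the coordinates of [M n] are at
    most [K + J <= (K + 1) J] with [J = japanese x >= 1]. The inverse matrix passes the bound on to
    [n]. *)
Lemma japanese_lattice (M : 'M[R]_2) (K : R) : M \in unitmx -> 0 <= K ->
  exists2 c : R, 0 < c & forall (n : int * int) (x : vec3 R),
    `|x.1.1 + (act M (intpoint n)).1| <= K ->
    `|x.1.2 + (act M (intpoint n)).2| <= K ->
    1 + `|n.1|%:~R <= c * japanese x /\ 1 + `|n.2|%:~R <= c * japanese x.
Proof.
move=> uM K0; have m0 : 0 <= mx_abs_sum (invmx M) by rewrite !addr_ge0.
exists (1 + mx_abs_sum (invmx M) * (K + 1)).
  by rewrite ltr_pwDl// mulr_ge0// addr_ge0.
move=> n x h1 h2; set J := japanese x.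
have J1 : 1 <= J := japanese_ge1 x; have eJ : enorm3 x <= J := enorm3_japanese x.
have [e1 e2 _] := enorm3_coords x; set r := act M (intpoint n) in h1 h2.
have KJ : K + J <= (K + 1) * J by rewrite mulrDl mul1r lerD2r ler_peMr.
have b (p s : R) : `|p + s| <= K -> `|p| <= enorm3 x -> `|s| <= (K + 1) * J.
  move=> ps pe; apply: le_trans KJ; rewrite -[s](addKr p) addrC.
  apply: le_trans (ler_normD _ _) _; rewrite normrN; apply: lerD => //.
  exact: le_trans pe eJ.
have := act_bound (invmx M) (b _ _ h1 e1) (b _ _ h2 e2).
rewrite actK//= !mulrA -!intr_norm => -[b1 b2]; rewrite mulrDl mul1r.
by split; apply: lerD.
Qed.

(** Both [1 + |n_1|] and [1 + |n_2|] are at most [c J], so the [r]-th power of their product is at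
    most [(c^2)^r J^(2 r)]. The exponent [2 r] in the plane thus splits into an exponent [r] for
    each coordinate, and [r > 1] makes both one-dimensional sums converge. *)
Lemma pair_decay (r C c J w : R) (n : int * int) : 1 < r -> 0 < c -> 1 <= J ->
  1 + `|n.1|%:~R <= c * J -> 1 + `|n.2|%:~R <= c * J ->
  `|J `^ (2 * r) * w| <= C ->
  `|w| <= (c ^+ 2) `^ r * C * (decay r n.1 * decay r n.2).
Proof.
move=> r1 c0 J1 h1 h2 hw; rewrite /decay.
set w1 := 1 + _ in h1 *; set w2 := 1 + _ in h2 *.
have w10 : 0 < w1 by rewrite ltr_pwDl// ler0z.
have w20 : 0 < w2 by rewrite ltr_pwDl// ler0z.
have J0 : 0 < J by lra.
have cJ : (w1 * w2) `^ r <= (c ^+ 2) `^ r * J `^ (2 * r).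
  rewrite powRrM powR_mulrn ?(ltW J0)// -powRM ?sqr_ge0// -exprMn.
  apply: ge0_ler_powR; rewrite ?nnegrE ?sqr_ge0//; first lra.
    by rewrite mulr_ge0// ltW.
  by rewrite expr2 ler_pM// ltW.
rewrite !powRN -invfM -powRM ?(ltW w10) ?(ltW w20)//.
rewrite ler_pdivlMr ?powR_gt0 ?mulr_gt0//.
apply: le_trans (ler_wpM2l (normr_ge0 w) cJ) _.
rewrite mulrCA ler_wpM2l ?powR_ge0//; apply: le_trans hw.
by rewrite normrM ger0_norm ?powR_ge0// mulrC.
Qed.

End PairPotentials.

Section LatticeSums.
Context {R : realType} (M : 'M[R]_2) (S : finType).

Lemma lattice_point_subproof (n : int * int) : act M (intpoint n) \in lattice M.
Proof. by rewrite inE; exists n. Qed.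

Definition lattice_point (n : int * int) : lattice M :=
  exist _ (act M (intpoint n)) (lattice_point_subproof n).

Definition lattice_site (p : (int * int) * S) : lattice M * S :=
  (lattice_point p.1, p.2).

Lemma lattice_site_bij : M \in unitmx ->
  set_bij [set: (int * int) * S] [set: lattice M * S] lattice_site.
Proof.
move=> uM; split=> //.
- move=> [m a] [n b] _ _ e; have -> : a = b := congr1 snd e.
  have := congr1 (fun z : lattice M * S => val z.1) e.
  move=> /(can_inj (actK uM)) [/intr_inj e1 /intr_inj e2].
  by rewrite [m]surjective_pairing e1 e2 -surjective_pairing.
- move=> [[r rM] b] _; have [n _ nr] := set_mem rM.
  exists (n, b) => //; rewrite /lattice_site /=; congr (_, _).
  exact: val_inj.
Qed.

Lemma abs_sum_lattice (f : lattice M * S -> R) : M \in unitmx ->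
  abs_sum f = abs_sum (f \o lattice_site).
Proof.
move=> uM; rewrite /abs_sum.
by congr (fine _ - fine _); apply: reindex_esum; exact: lattice_site_bij.
Qed.

Lemma measurable_abs_sum d (T : measurableType d) (I : countType) (f : I -> T -> R) :
  (forall i, measurable_fun setT (f i)) ->
  measurable_fun setT (fun x => abs_sum (fun i => f i x)).
Proof.
move=> mf; apply: measurable_funB; apply: measurableT_comp => //.
- apply: measurable_esum_count => [i x|i]; first by rewrite lee_fin le_max lexx orbT.
  by apply/measurable_EFinP; exact: measurable_maxr.
- apply: measurable_esum_count => [i x|i]; first by rewrite lee_fin le_max lexx orbT.
  apply/measurable_EFinP; apply: measurable_maxr => //.
  exact: measurableT_comp.
Qed.

End LatticeSums.

(** * Integrability of the interlayer energy density for pair potentials *)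

Section PairPotentialEnergy.
Context {R : realType} (q theta : R) (A : 'M[R]_2) (S : layer -> finType).
Local Notation B := (Amx q theta A).
Local Notation BM := (moire q theta A).
Variable tau : forall j, S j -> vec2 R.
Variable u : forall j, vec2 R -> S j -> vec3 R.
Variable Vinter : forall j, S j -> config (B (other j)) (S (other j)) -> R.
Variables (v : S layer1 -> S layer2 -> vec3 R -> R) (r : R).
Hypothesis V_pair : forall k (a : S k), is_pair_sum (pair_potential v a) (Vinter a).
Hypothesis r_gt1 : 1 < r.
Hypothesis u_bounded : forall k (a : S k), Linfty_vec (fun x => u x a).

Let D : set (vec3 R) := setT `*` [set` `[- Lz (@tau) (@u), Lz (@tau) (@u)]].

Hypothesis v_weighted : forall a b, Linfty_weighted (2 * r) D (v a b).

Lemma uz_norm_ge0 i : 0 <= uz_norm (@u) i.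
Proof. by rewrite /uz_norm; elim/big_rec: _ => // a x _ x0; rewrite le_max x0 orbT. Qed.

Lemma le_uz_norm i (a : S i) :
  fine 'N[leb2]_+oo[(fun x => ((u x a).2)%:E)]%E <= uz_norm (@u) i.
Proof.
exact: (le_bigmax 0 (fun a : S i => fine 'N[leb2]_+oo[(fun x => ((u x a).2)%:E)]%E) a).
Qed.

Lemma uz_norms_le_Lz j : uz_norm (@u) j + uz_norm (@u) (other j) <= Lz (@tau) (@u).
Proof.
rewrite /Lz; set m := \big[Num.max/0]_(a : S layer1) _.
have m0 : 0 <= m by rewrite /m; elim/big_rec: _ => // a x _ x0; rewrite le_max x0 orbT.
by case: j => /=; have := uz_norm_ge0 layer1; have := uz_norm_ge0 layer2; lra.
Qed.

Lemma layer_version i : exists (g : S i -> vec2 R -> vec3 R) (K : R),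
  [/\ forall a, measurable_fun setT (g a), 0 <= K &
   {ae leb2, forall x, forall a, [/\ u x a = g a x, enorm3 (u x a) <= K
     & `|(u x a).2| <= uz_norm (@u) i]}].
Proof.
have /choice[g /choice[K gK]] := fun a : S i => Linfty_vec_version (u_bounded a).
exists g, (\sum_a `|K a|); split; first by move=> a; case: (gK a).
  by apply: sumr_ge0.
apply: ae_forall_count => a; have [_] := gK a; apply: filterS => x [e1 e2 e3].
split=> //; last by apply: le_trans e3 _; exact: le_uz_norm.
apply: le_trans e2 _; apply: le_trans (ler_norm _) _.
by rewrite (bigD1 a)//= lerDl sumr_ge0.
Qed.

Lemma measurable_D : measurable D.
Proof. by apply: measurableX => //; exact: measurable_itv. Qed.

Lemma pair_potential_weighted j (a : S j) (b : S (other j)) :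
  Linfty_weighted (2 * r) D (pair_potential v a b).
Proof. by case: j a b => /= a b. Qed.

Lemma pair_potential_uniform j : exists2 C : R, 0 <= C &
  forall (a : S j) (b : S (other j)) x, D x ->
    `|japanese x `^ (2 * r) * pair_potential v a b x| <= C.
Proof.
have /choice[C hC] : forall p : S j * S (other j), exists C : R, forall x, D x ->
    `|japanese x `^ (2 * r) * pair_potential v p.1 p.2 x| <= C.
  by move=> p; have [_] := pair_potential_weighted p.1 p.2.
exists (\sum_p `|C p|); first by apply: sumr_ge0.
move=> a b x Dx; apply: le_trans (hC (a, b) x Dx) _.
apply: le_trans (ler_norm _) _.
by rewrite (bigD1 (a, b))//= lerDl sumr_ge0.
Qed.

Hypotheses (q_gt0 : 0 < q) (A_unit : A \in unitmx).
Hypothesis BM_unit : BM \in unitmx.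

Variable j : layer.
Let Bk := B (other j).

(* The argument of the pair potential in [Psi_inter]; [f] and [g] stand for the
   displacements or for Borel versions of them. *)
Let displ (f : S j -> vec2 R -> vec3 R) (g : S (other j) -> vec2 R -> vec3 R)
    (a : S j) (p : (int * int) * S (other j)) (z : vec2 R * vec2 R) : vec3 R :=
  emb (z.2 - act Bk (intpoint p.1) + tau a - tau p.2) + f a z.1
    - g p.2 (z.1 - z.2 + act Bk (intpoint p.1)).

Lemma displ_coords f g a p z :
  [/\ (displ f g a p z).1.1 + (act Bk (intpoint p.1)).1 =
        z.2.1 + (tau a).1 - (tau p.2).1 + (f a z.1).1.1
        - (g p.2 (z.1 - z.2 + act Bk (intpoint p.1))).1.1,
      (displ f g a p z).1.2 + (act Bk (intpoint p.1)).2 =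
        z.2.2 + (tau a).2 - (tau p.2).2 + (f a z.1).1.2
        - (g p.2 (z.1 - z.2 + act Bk (intpoint p.1))).1.2 &
      (displ f g a p z).2 =
        (f a z.1).2 - (g p.2 (z.1 - z.2 + act Bk (intpoint p.1))).2].
Proof. by split; rewrite /displ /=; [ring|ring|rewrite add0r]. Qed.

Lemma measurable_displ f g a p :
  (forall a, measurable_fun setT (f a)) -> (forall b, measurable_fun setT (g b)) ->
  measurable_fun setT (displ f g a p).
Proof.
move=> mf mg.
have mz : measurable_fun setT (fun z : vec2 R * vec2 R => z.1 - z.2 + act Bk (intpoint p.1)).
  apply: measurable_fun_pair; apply: measurable_funD => //; apply: measurable_funB;
    by apply: measurableT_comp.
have mF : measurable_fun setT (fun z : vec2 R * vec2 R => f a z.1).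
  by apply: (measurableT_comp (mf a)).
have mG := measurableT_comp (mg p.2) mz.
have m1 : measurable_fun setT (fun x : vec3 R => x.1.1).
  by apply: measurableT_comp.
have m2 : measurable_fun setT (fun x : vec3 R => x.1.2).
  by apply: measurableT_comp.
have m3 : measurable_fun setT (fun x : vec3 R => x.2) by exact: measurable_snd.
have mY : measurable_fun setT (fun z : vec2 R * vec2 R =>
    z.2 - act Bk (intpoint p.1) + tau a - tau p.2).
  have [ms _ _] := scales_shift2 (- act Bk (intpoint p.1) + tau a - tau p.2).
  have := measurableT_comp ms (@measurable_snd _ _ (vec2 R) (vec2 R)).
  by congr measurable_fun; apply/funext => z /=; rewrite !addrA.
have n1 : measurable_fun setT (fun x : vec2 R => x.1) by exact: measurable_fst.
have n2 : measurable_fun setT (fun x : vec2 R => x.2) by exact: measurable_snd.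
apply: measurable_fun_pair; first apply: measurable_fun_pair.
- apply: measurable_funB; last exact: (measurableT_comp m1 mG).
  apply: measurable_funD; last exact: (measurableT_comp m1 mF).
  exact: (measurableT_comp n1 mY).
- apply: measurable_funB; last exact: (measurableT_comp m2 mG).
  apply: measurable_funD; last exact: (measurableT_comp m2 mF).
  exact: (measurableT_comp n2 mY).
- apply: measurable_funB; last exact: (measurableT_comp m3 mG).
  by apply: measurable_funD => //; exact: (measurableT_comp m3 mF).
Qed.

(** For fixed [x] the argument is a reflection of [y] followed by a translation, so the exceptional
    set of [P] pulls back to a null set of pairs. The union over the lattice points is countable. *)
Lemma ae_displacement (P : vec2 R -> Prop) : {ae leb2, forall x, P x} ->
  {ae leb4, forall z : vec2 R * vec2 R, forall n : int * int,
    P (z.1 - z.2 + act Bk (intpoint n))}.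
Proof.
move=> aeP; apply: ae_forall_count => n; set c := act Bk (intpoint n).
have uN : (- 1%:M : 'M[R]_2) \in unitmx by rewrite -scaleN1r unitmxZ ?unitrN1// unitmx1.
have [d sd] := scales_act uN; have [_ d0 _] := sd.
pose phi (z : vec2 R * vec2 R) := act (- 1%:M) z.2 + (z.1 + c).
have phiE z : phi z = z.1 - z.2 + c by rewrite /phi actNl act1 addrC addrAC.
have mphi : measurable_fun setT phi.
  apply: measurable_fun_pair.
  - apply: measurable_funD.
    + by do 2 apply: measurableT_comp => //; exact: measurable_act.
    + by apply: measurable_funD => //; apply: measurableT_comp.
  - apply: measurable_funD.
    + by do 2 apply: measurableT_comp => //; exact: measurable_act.
    + by apply: measurable_funD => //; apply: measurableT_comp.
have sphi x : scales leb2 leb2 d (fun y => phi (x, y)).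
  by have := scales_comp sd (scales_shift2 (x + c)); rewrite mulr1.
have s := scales_comp (@scales_skew R _ _ _ _ leb2 leb2 d _ d0 mphi sphi) (scales_swap leb2).
have := scales_ae s (@ae_fst _ _ _ _ _ leb2 leb2 P aeP).
by apply: filterS => z /=; rewrite phiE.
Qed.

(** Almost everywhere the vertical part of each argument is at most L^z, so the pointwise weighted
    bound on [v] applies. For [y] in the cell the horizontal part stays within a fixed distance of
    minus the lattice vector, so [pair_decay] dominates the terms by a summable family independent
    of the point. The resulting bound on the density is uniform on a set of finite measure. *)
Theorem Psi_inter_L1 :
  L1 leb4 (cell BM `*` cell Bk)
    (fun z => Psi_inter (@Vinter) (@tau) (@u) j z.1 z.2).
Proof.
have uBk : Bk \in unitmx by exact: Amx_unit.
have [f [Kf [mf Kf0 aef]]] := layer_version j.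
have [g [Kg [mg Kg0 aeg]]] := layer_version (other j).
have [C C0 hC] := pair_potential_uniform j.
pose T0 := \sum_(a : S j) (`|(tau a).1| + `|(tau a).2|) : R.
pose T1 := \sum_(b : S (other j)) (`|(tau b).1| + `|(tau b).2|) : R.
have T00 : 0 <= T0 by apply: sumr_ge0 => a _; rewrite addr_ge0.
have T10 : 0 <= T1 by apply: sumr_ge0 => a _; rewrite addr_ge0.
have tauT i (a : S i) : 
    `|(tau a).1| <= \sum_(b : S i) (`|(tau b).1| + `|(tau b).2|) /\
    `|(tau a).2| <= \sum_(b : S i) (`|(tau b).1| + `|(tau b).2|).
  rewrite (bigD1 a)//=.
  have : 0 <= \sum_(b : S i | b != a) (`|(tau b).1| + `|(tau b).2|).
    by apply: sumr_ge0 => b _; rewrite addr_ge0.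
  by split; have := normr_ge0 (tau a).1; have := normr_ge0 (tau a).2; lra.
(* Bounds each horizontal coordinate of the argument once the lattice vector is removed: [y] in its
   cell, the two shift vectors and the two displacements. *)
pose K := mx_abs_sum Bk + T0 + T1 + Kf + Kg.
have m0 : 0 <= mx_abs_sum Bk by rewrite !addr_ge0.
have K0 : 0 <= K by rewrite !addr_ge0.
have [c c0 hc] := japanese_lattice uBk K0.
have [E E0 hE] := esum_decay (S (other j)) r_gt1.
pose C3 := (c ^+ 2) `^ r * C.
have C30 : 0 <= C3 by rewrite mulr_ge0 ?powR_ge0.
(* The potentials are measurable on [D] only; extension by zero gives a Borel function on all of
   space, and almost every argument lies in [D]. *)
pose w (a : S j) (b : S (other j)) : vec3 R -> R := pair_potential v a b \_ D.
have mw a b : measurable_fun setT (w a b).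
  apply/(measurable_restrictT _ measurable_D).
  by have [[]] := pair_potential_weighted a b.
pose h z := (area (cell (B j)))^-1 * \sum_(a : S j)
  (2^-1 * abs_sum (fun p => w a p.2 (displ f g a p z))).
have mh : measurable_fun setT h.
  apply: measurable_funM => //; apply: measurable_sum => a.
  apply: measurable_funM => //; apply: measurable_abs_sum => p.
  exact: (measurableT_comp (mw a p.2) (measurable_displ _ _ mf mg)).
pose C4 := `|(area (cell (B j)))^-1| * \sum_(a : S j) (2^-1 * (C3 * E)).
have C40 : 0 <= C4.
  apply: mulr_ge0 => //; apply: sumr_ge0 => a _.
  by apply: mulr_ge0 => //; exact: mulr_ge0.
have key : {ae leb4, forall z, cell Bk z.2 ->
    Psi_inter (@Vinter) (@tau) (@u) j z.1 z.2 = h z /\ `|h z| <= C4}.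
  have := ae_displacement aeg.
  apply: filterS2 (@ae_fst _ _ _ _ _ leb2 leb2 _ aef) => -[x y] /= Hf Hg yB.
  have [y1 y2] := cell_bounded yB.
  have bnd a (p : (int * int) * S (other j)) :
      D (displ f g a p (x, y)) /\
      `|pair_potential v a p.2 (displ f g a p (x, y))| <=
        C3 * (decay r p.1.1 * decay r p.1.2).
    have [ef nf zf] := Hf a; have [eg ng zg] := Hg p.1 p.2.
    pose x' := x - y + act Bk (intpoint p.1).
    have [d1 d2 d3] : [/\ (displ f g a p (x, y)).1.1 + (act Bk (intpoint p.1)).1 =
        y.1 + (tau a).1 - (tau p.2).1 + (u x a).1.1 - (u x' p.2).1.1,
      (displ f g a p (x, y)).1.2 + (act Bk (intpoint p.1)).2 =
        y.2 + (tau a).2 - (tau p.2).2 + (u x a).1.2 - (u x' p.2).1.2 &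
      (displ f g a p (x, y)).2 = (u x a).2 - (u x' p.2).2].
      by rewrite /x' ef eg; exact: displ_coords.
    have [f1 f2 _] := enorm3_coords (u x a).
    have [g1 g2 _] := enorm3_coords (u x' p.2).
    have [t1 t2] := tauT _ a; have [t3 t4] := tauT _ p.2.
    have tri (e1 e2 e3 e4 e5 : R) : `|e1| <= mx_abs_sum Bk -> `|e2| <= T0 ->
        `|e3| <= T1 -> `|e4| <= Kf -> `|e5| <= Kg -> `|e1 + e2 - e3 + e4 - e5| <= K.
      move=> q1 q2 q3 q4 q5; rewrite /K; apply: le_trans (ler_normB _ _) _; apply: lerD => //.
      apply: le_trans (ler_normD _ _) _; apply: lerD => //.
      apply: le_trans (ler_normB _ _) _; apply: lerD => //.
      by apply: le_trans (ler_normD _ _) _; apply: lerD.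
    have Dd : D (displ f g a p (x, y)).
      suff hz : `|(displ f g a p (x, y)).2| <= Lz (@tau) (@u).
        by split=> //=; rewrite in_itv /= -ler_norml; exact: hz.
      rewrite d3; apply: le_trans (ler_normB _ _) _; apply: le_trans (uz_norms_le_Lz j).
      exact: lerD.
    split=> //.
    have [] := hc p.1 (displ f g a p (x, y)).
    - rewrite d1; apply: tri => //; first exact: le_trans f1 nf.
      exact: le_trans g1 ng.
    - rewrite d2; apply: tri => //; first exact: le_trans f2 nf.
      exact: le_trans g2 ng.
    move=> j1 j2; apply: (pair_decay r_gt1 c0 (japanese_ge1 _) j1 j2).
    exact: hC.
  have wE a p : w a p.2 (displ f g a p (x, y)) =
      pair_potential v a p.2 (displ f g a p (x, y)).
    by rewrite /w patchE mem_set//; have [] := bnd a p.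
  have esumw a : (\esum_(p in [set: (int * int) * S (other j)])
      (`|w a p.2 (displ f g a p (x, y))|)%:E <= (C3 * E)%:E)%E.
    apply: le_trans (hE C3 C30); apply: le_esum => p _.
    by rewrite lee_fin wE; have [] := bnd a p.
  split.
    rewrite /Psi_inter /h; congr (_ * _); apply: eq_bigr => a _.
    set cfg := (fun r' b => _) : config Bk (S (other j)).
    have cfgE p : cfg (lattice_point Bk p.1) p.2 = displ f g a p (x, y).
      rewrite /cfg /displ /=; have [-> _ _] := Hf a.
      by have [-> _ _] := Hg p.1 p.2.
    rewrite (@V_pair j a cfg); last first.
      rewrite /summable (reindex_esum _ _ _ _ (lattice_site_bij _ uBk)).
      apply: le_lt_trans (_ : (C3 * E)%:E < +oo)%E; last exact: ltry.
      apply: le_trans (esumw a); apply: le_esum => p _.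
      by rewrite /lattice_site /= lee_fin cfgE wE.
    congr (_ * _); rewrite abs_sum_lattice//; congr abs_sum.
    by apply/funext => p; rewrite /lattice_site /= cfgE wE.
  rewrite /h normrM ler_wpM2l//; apply: le_trans (ler_norm_sum _ _ _) _.
  apply: ler_sum => a _; rewrite normrM ger0_norm// ler_wpM2l//.
  by apply: abs_sum_le => //; rewrite mulr_ge0.
have l4 : (leb4 (cell BM `*` cell Bk) < +oo)%E.
  have -> : leb4 (cell BM `*` cell Bk) = (leb2 (cell BM) * leb2 (cell Bk))%E.
    by apply: product_measure1E; exact: measurable_cell.
  apply: lte_mul_pinfty => //; last exact: leb2_cell_lty.
  by rewrite ge0_fin_numE//; exact: leb2_cell_lty.
(* Truncation at [C4] makes the Borel function bounded everywhere without changing it where [key]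
   holds. *)
exists (fun z => Num.max (- C4) (Num.min (h z) C4)).
  apply: (@bounded_integrable _ _ _ _ _ _ C4).
  - by apply: measurableX; exact: measurable_cell.
  - exact: l4.
  - apply: measurable_funTS; apply: measurable_maxr => //.
    exact: measurable_minr.
  - by move=> z _; rewrite ler_norml le_max lexx /= ge_max ge_min lexx orbT andbT; lra.
apply: filterS key => z hz [_ zB]; have [-> h1] := hz zB.
move: h1; rewrite ler_norml => /andP[h1 h2].
by rewrite min_l// max_r.
Qed.

End PairPotentialEnergy.

Theorem theorem2p17 (R : realType) (q theta : R) (A : 'M[R]_2)
  (S : layer -> finType)
  (tau : forall j, S j -> vec2 R)
  (u : forall j, vec2 R -> S j -> vec3 R)
  (Vmono : forall j, S j -> config (Amx q theta A j) (S j) -> R)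
  (Vinter : forall j, S j ->
     config (Amx q theta A (other j)) (S (other j)) -> R)
  (q_gt0 : 0 < q)
  (A_unit : A \in unitmx)
  (dual_incommensurate :
     dual_lattice (Amx q theta A layer1) `&`
     dual_lattice (Amx q theta A layer2) = [set 0])
  (incommensurate :
     lattice (Amx q theta A layer1) `&`
     lattice (Amx q theta A layer2) = [set 0])
  (u_L1 : forall j (a : S j),
     L1_space leb2 (cell (moire q theta A)) (fun x => u j x a))
  (u_periodic : forall j (a : S j),
     lattice_periodic (moire q theta A) (fun x => u j x a))
  (Vinter_even : forall j (a : S j), even_potential (Vinter j a))
  (Vinter_translation : forall j (a : S j),
     translation_invariant (Vinter j a))
  (j : layer)
  (Phi_mono_L1 : L1 leb2 (cell (moire q theta A)) (Phi_mono Vmono u j))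
  (cases :
     (* general many-body potentials *)
     (L1 leb4 (cell (moire q theta A) `*` cell (Amx q theta A (other j)))
         (fun z => Psi_inter Vinter tau u j z.1 z.2) /\
      forall g : vec2 R * vec2 R,
        cell (Amx q theta A layer1) g.1 ->
        cell (Amx q theta A layer2) g.2 ->
        L1 leb2 (cell (moire q theta A)) (Phi_inter Vinter tau u j g))
     \/
     (* pair potentials *)
     (exists (v : S layer1 -> S layer2 -> vec3 R -> R) (r : R),
        [/\ forall a b x, v a b (- x) = v a b x,
            forall k (a : S k),
              is_pair_sum (pair_potential v a) (Vinter k a),
            1 < r,
            forall k (a : S k), Linfty_vec (fun x => u k x a)
          & forall a b,
              Linfty_weighted (2 * r)
                (setT `*` [set` `[- Lz tau u, Lz tau u]]) (v a b)])) :
  {ae leb4, forall g : vec2 R * vec2 R,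
     cell (Amx q theta A layer1) g.1 ->
     cell (Amx q theta A layer2) g.2 ->
     ((fun N => e_mono_N Vmono u j N (shift_of g j)) @ \oo
        --> e_mono Vmono u j) /\
     ((fun N => e_inter_N Vinter tau u j N g) @ \oo
        --> e_inter Vinter tau u j g)}.
Proof.
have BM_unit := moire_unit q_gt0 A_unit incommensurate.
have Psi_L1 : L1 leb4 (cell (moire q theta A) `*` cell (Amx q theta A (other j)))
    (fun z => Psi_inter Vinter tau u j z.1 z.2).
  case: cases => [[]//|[v [r [_ V_pair r_gt1 u_bounded v_weighted]]]].
  exact: (Psi_inter_L1 V_pair r_gt1 u_bounded v_weighted q_gt0 A_unit BM_unit).
have := ae_cvg_energies u_periodic Vinter_translation q_gt0 A_unit
  dual_incommensurate incommensurate Phi_mono_L1 Psi_L1.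
by apply: filterS => g energies _ _.
Qed.
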